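(* (Equivalence of quadratic hedging with and without numeraire change.) Let $S$ be an $\mathbb R^d$-valued semimartingale ($d\ge2$) such that $X:=S^1$ is a nice numeraire under $\mathsf P$. Let $H\in L^2(\mathsf P)$, $v\in\mathbb R$, and put $\hat S=S/X$, $\hat H=H/X_T$, $\hat v=v/X_0$, and $\frac{d\hat{\mathsf P}}{d\mathsf P}=\frac{X_T^2}{\mathsf E[X_T^2]}$. Then $$\overline\Theta_v(S,\mathsf P)=\overline\Theta_{\hat v}(\hat S,\hat{\mathsf P}),$$ $$\inf_{\vartheta\in\overline\Theta_v(S,\mathsf P)}\mathsf E[(\vartheta_TS_T-H)^2]=\mathsf E[X_T^2]\inf_{\vartheta\in\overline\Theta_{\hat v}(\hat S,\hat{\mathsf P})}\mathsf E^{\hat{\mathsf P}}[(\vartheta_T\hat S_T-\hat H)^2],$$ and $$\operatorname{argmin}_{\vartheta\in\overline\Theta_v(S,\mathsf P)}\mathsf E[(\vartheta_TS_T-H)^2]=\operatorname{argmin}_{\vartheta\in\overline\Theta_{\hat v}(\hat S,\hat{\mathsf P})}\mathsf E^{\hat{\mathsf P}}[(\vartheta_T\hat S_T-\hat H)^2].$$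
   Context: $(\Omega,\mathscr F,(\mathscr F_t)_{t\in[0,T]},\mathsf P)$ is a filtered probability space with $\mathscr F_0$ trivial. Price processes are column vectors, strategies $\vartheta$ row vectors; $L(S)$ is the set of predictable $S$-integrable processes; $\vartheta\bullet S$ is the stochastic integral; $\vartheta S=\sum_i\vartheta^iS^i$. For a price process $S$ and a probability measure $\mathsf P$: $\vartheta\in L(S)$ is self-financing if $\vartheta S=\vartheta_0S_0+\vartheta\bullet S$ on $[0,T]$. It is tame, $\vartheta\in\Theta(S,\mathsf P)$, if it is self-financing and $\sup_\sigma\mathsf E[(\vartheta_\sigma S_\sigma)^2]<\infty$ over all $[0,T]$-valued stopping times $\sigma$. It is admissible, $\vartheta\in\overline\Theta(S,\mathsf P)$, if it is self-financing and there is a sequence $\vartheta^{(n)}\in\Theta(S,\mathsf P)$ with $\vartheta^{(n)}_\sigma S_\sigma\to\vartheta_\sigma S_\sigma$ in probability for all $[0,T]$-valued stopping times $\sigma$ and $\vartheta^{(n)}_TS_T\to\vartheta_TS_T$ in $L^2(\mathsf P)$. $\overline\Theta_v(S,\mathsf P)$ denotes the subset with $\vartheta_0S_0=v$. $N$ is a nice numeraire under $\mathsf P$ if $N>0$, $N_->0$ and there are constants $0<\underline\delta\le\overline\delta<\infty$ with $\underline\delta\le\mathsf E[N_T^2|\mathscr F_t]/N_t^2\le\overline\delta$ for all $t\in[0,T]$. *)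

(* Defs.v *)
From mathcomp Require Import all_boot all_order all_algebra.
From mathcomp Require Import all_classical all_reals all_analysis.

Set Implicit Arguments.
Unset Strict Implicit.
Unset Printing Implicit Defensive.

Import Order.TTheory GRing.Theory Num.Theory.
Import numFieldNormedType.Exports.

Local Open Scope classical_set_scope.
Local Open Scope ring_scope.

(* Conventions.  The time set is [0, T].  A process is a function
   R -> Omega -> E of which only the values at times in [0, T] matter.
   Neither completeness nor right-continuity of the filtration is assumed. *)

Section FilteredSpace.
Context {d : measure_display} {Omega : measurableType d} {R : realType}.
Variables (F : R -> set (set Omega)) (T : R).

Definition filtration : Prop :=
  (forall t, 0 <= t <= T ->
     sigma_algebra setT (F t) /\ F t `<=` measurable) /\
  (forall s t, 0 <= s -> s <= t -> t <= T -> F s `<=` F t).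

Definition adapted (Y : R -> Omega -> R) : Prop :=
  forall t, 0 <= t <= T ->
  forall B : set R, measurable B -> F t (Y t @^-1` B).

Definition cadlag (Y : R -> Omega -> R) : Prop :=
  forall w,
    (forall t, 0 <= t < T -> Y s w @[s --> t^'+] --> Y t w) /\
    (forall t, 0 < t <= T -> cvg (Y s w @[s --> t^'-])).

Definition stopping_time (sigma : Omega -> R) : Prop :=
  (forall w, 0 <= sigma w <= T) /\
  (forall t, 0 <= t <= T -> F t [set w | sigma w <= t]).

Definition predictable_rectangles : set (set (R * Omega)) :=
  [set D | (exists2 A, F 0 A & D = [set 0] `*` A) \/
           (exists s t A, [/\ 0 <= s, s <= t, t <= T, F s A &
                             D = `]s, t] `*` A])].

Definition predictable (K : R -> Omega -> R) : Prop :=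
  forall B : set R, measurable B ->
    <<s `[0, T] `*` setT, predictable_rectangles >>
      ((`[0, T] `*` setT) `&` [set x | B (K x.1 x.2)]).

Definition predictable_vec (n : nat) (theta : R -> Omega -> 'rV[R]_n) : Prop :=
  forall i, predictable (fun t w => theta t w ord0 i).

(* Data of the bounded integrand sum_i wgt_i 1_(lft_i, rgt_i]; the intervals
   may overlap. *)
Record simple_integrand := SimpleIntegrand {
  nterms : nat ;
  lft : 'I_nterms -> R ;
  rgt : 'I_nterms -> R ;
  wgt : 'I_nterms -> Omega -> R ;
  simple_times : forall i, [/\ 0 <= lft i, lft i <= rgt i & rgt i <= T] ;
  simple_meas : forall i (B : set R), measurable B ->
    F (lft i) (wgt i @^-1` B) ;
  simple_bounded : forall i, exists C, forall w, `|wgt i w| <= C }.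

Definition simple_val (k : simple_integrand) (t : R) (w : Omega) : R :=
  \sum_(i < nterms k) (if lft i < t <= rgt i then wgt i w else 0).

Definition simple_int (k : simple_integrand) (Y : R -> Omega -> R)
    (t : R) (w : Omega) : R :=
  \sum_(i < nterms k)
     wgt i w * (Y (Num.min t (rgt i)) w - Y (Num.min t (lft i)) w).

End FilteredSpace.

Section StochasticIntegral.
Context {d : measure_display} {Omega : measurableType d} {R : realType}.
Variables (P : probability Omega R) (F : R -> set (set Omega)) (T : R).

Definition cond_expectation (G : set (set Omega)) (Z Y : Omega -> R) : Prop :=
  [/\ P.-integrable setT (EFin \o Z),
      P.-integrable setT (EFin \o Y),
      (forall B : set R, measurable B -> G (Y @^-1` B)) &
      (forall A, G A ->
         \int[P]_(w in A) (Y w)%:E = \int[P]_(w in A) (Z w)%:E)%E].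

Definition martingale (M : R -> Omega -> R) : Prop :=
  adapted F T M /\
  forall s t, 0 <= s -> s <= t -> t <= T ->
    cond_expectation (F s) (M t) (M s).

(* On [0, T], a localizing sequence eventually equals T almost surely. *)
Definition local_martingale (M : R -> Omega -> R) : Prop :=
  [/\ adapted F T M, cadlag T M &
   exists tau : nat -> Omega -> R,
    [/\ (forall m, stopping_time F T (tau m)),
        (forall m w, tau m w <= tau m.+1 w),
        {ae P, forall w, exists m, tau m w = T} &
        (forall m,
           martingale (fun t w => M (Num.min t (tau m w)) w - M 0 w))]].

Definition semimartingale (Y : R -> Omega -> R) : Prop :=
  [/\ adapted F T Y, cadlag T Y &
   exists M A : R -> Omega -> R,
    [/\ local_martingale M,
        [/\ adapted F T A, cadlag T A &
            forall w, bounded_variation 0 T (A ^~ w)],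
        (forall w, M 0 w = 0 /\ A 0 w = 0) &
        {ae P, forall w, forall t, 0 <= t <= T ->
           Y t w = Y 0 w + M t w + A t w}]].

Definition semimartingale_vec (n : nat) (S : R -> Omega -> 'cV[R]_n) : Prop :=
  forall i, semimartingale (fun t w => S t w i ord0).

(* The outer P-measure of A is at most e; used because events of the form
   {sup_t |Y_t| > c} need not be measurable for a general process Y. *)
Definition outer_prob_le (A : set Omega) (e : R) : Prop :=
  exists B, [/\ measurable B, A `<=` B & (P B <= e%:E)%E].

(* Convergence in probability, uniformly on [0, T]. *)
Definition ucp_cvg (Yn : nat -> R -> Omega -> R) (Y : R -> Omega -> R) : Prop :=
  forall c e, 0 < c -> 0 < e -> exists N, forall m, (N <= m)%N ->
    outer_prob_le
      [set w | exists2 t, 0 <= t <= T & c < `|Yn m t w - Y t w|] e.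

(* Convergence in Emery's semimartingale topology on [0, T], with the test
   integrands |K| <= 1 ranging over simple ones. *)
Definition emery_cvg (Yn : nat -> R -> Omega -> R) (Y : R -> Omega -> R)
    : Prop :=
  ucp_cvg Yn Y /\
  forall c e, 0 < c -> 0 < e -> exists N, forall m, (N <= m)%N ->
  forall k : simple_integrand F T,
    (forall t w, 0 < t <= T -> `|simple_val k t w| <= 1) ->
    outer_prob_le
      [set w | exists2 t, 0 <= t <= T &
        c < `|simple_int k (fun s w' => Yn m s w' - Y s w') t w|] e.

(* [bounded_int Y K I]: I is a version of the integral over (0, .] of the
   bounded integrand K against the scalar semimartingale Y, i.e. (K, I) is
   reached from the simple integrands by bounded pointwise limits, along which
   the integrals converge u.c.p. (dominated convergence).  By a monotone class
   argument every bounded predictable K is reached, and I is unique up to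
   indistinguishability.  The value of K at time 0 is irrelevant. *)
Inductive bounded_int (Y : R -> Omega -> R) :
    (R -> Omega -> R) -> (R -> Omega -> R) -> Prop :=
| bounded_int_simple (k : simple_integrand F T) :
    bounded_int Y (simple_val k) (simple_int k Y)
| bounded_int_lim (Kn In : nat -> R -> Omega -> R) (K I : R -> Omega -> R)
    (C : R) :
    (forall m, bounded_int Y (Kn m) (In m)) ->
    (forall m t w, 0 < t <= T -> `|Kn m t w| <= C) ->
    (forall t w, 0 < t <= T -> Kn m t w @[m --> \oo] --> K t w) ->
    ucp_cvg In I ->
    bounded_int Y K I.

Definition bounded_int_vec (n : nat) (S : R -> Omega -> 'cV[R]_n)
    (theta : R -> Omega -> 'rV[R]_n) (I : R -> Omega -> R) : Prop :=
  exists J : 'I_n -> R -> Omega -> R,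
    (forall i, bounded_int (fun t w => S t w i ord0)
                           (fun t w => theta t w ord0 i) (J i)) /\
    (forall t w, I t w = \sum_i J i t w).

Definition truncate (n : nat) (theta : R -> Omega -> 'rV[R]_n) (m : nat)
    (t : R) (w : Omega) : 'rV[R]_n :=
  if [forall i, `|theta t w ord0 i| <= m%:R] then theta t w else 0.

(* The vector stochastic integral in the form of Chou, Meyer and Stricker:
   theta is in L(S) with integral I iff theta is predictable and the integrals
   of the truncations theta 1_{|theta| <= m} converge to I in the
   semimartingale topology.  The components theta^i need not be individually
   S^i-integrable. *)
Definition stoch_int (n : nat) (S : R -> Omega -> 'cV[R]_n)
    (theta : R -> Omega -> 'rV[R]_n) (I : R -> Omega -> R) : Prop :=
  predictable_vec F T theta /\
  exists In : nat -> R -> Omega -> R,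
    (forall m, bounded_int_vec S (truncate theta m) (In m)) /\
    emery_cvg In I.

End StochasticIntegral.

Section Strategies.
Context {d : measure_display} {Omega : measurableType d} {R : realType}.
Variables (F : R -> set (set Omega)) (T : R).

Definition wealth (n : nat) (S : R -> Omega -> 'cV[R]_n)
    (theta : R -> Omega -> 'rV[R]_n) (t : R) (w : Omega) : R :=
  (theta t w *m S t w) ord0 ord0.

Definition self_financing (n : nat) (S : R -> Omega -> 'cV[R]_n)
    (P : probability Omega R) (theta : R -> Omega -> 'rV[R]_n) : Prop :=
  exists2 I, stoch_int P F T S theta I &
    {ae P, forall w, forall t, 0 <= t <= T ->
       wealth S theta t w = wealth S theta 0 w + I t w}.

Definition tame (n : nat) (S : R -> Omega -> 'cV[R]_n)
    (P : probability Omega R) : set (R -> Omega -> 'rV[R]_n) :=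
  [set theta | self_financing S P theta /\
    (ereal_sup [set 'E_P[fun w => (wealth S theta (sigma w) w ^+ 2)%R]
               | sigma in stopping_time F T] < +oo)%E].

Definition cvg_in_probability (P : probability Omega R)
    (Zn : nat -> Omega -> R) (Z : Omega -> R) : Prop :=
  forall c, 0 < c ->
    P [set w | c < `|Zn m w - Z w|] @[m --> \oo] --> 0%E.

Definition cvg_in_L2 (P : probability Omega R)
    (Zn : nat -> Omega -> R) (Z : Omega -> R) : Prop :=
  'E_P[fun w => ((Zn m w - Z w) ^+ 2)%R]%E @[m --> \oo] --> 0%E.

Definition admissible (n : nat) (S : R -> Omega -> 'cV[R]_n)
    (P : probability Omega R) : set (R -> Omega -> 'rV[R]_n) :=
  [set theta | self_financing S P theta /\
    exists thetan : nat -> R -> Omega -> 'rV[R]_n,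
      [/\ (forall m, tame S P (thetan m)),
          (forall sigma, stopping_time F T sigma ->
             cvg_in_probability P
               (fun m w => wealth S (thetan m) (sigma w) w)
               (fun w => wealth S theta (sigma w) w)) &
          cvg_in_L2 P (fun m => wealth S (thetan m) T) (wealth S theta T)]].

Definition admissible_from (v : R) (n : nat) (S : R -> Omega -> 'cV[R]_n)
    (P : probability Omega R) : set (R -> Omega -> 'rV[R]_n) :=
  [set theta | admissible S P theta /\
    {ae P, forall w, wealth S theta 0 w = v}].

Definition nice_numeraire (P : probability Omega R) (N : R -> Omega -> R)
    : Prop :=
  {ae P, forall w, (forall t, 0 <= t <= T -> 0 < N t w) /\
                   (forall t, 0 < t <= T -> 0 < lim (N s w @[s --> t^'-]))} /\
  exists lo hi : R, [/\ 0 < lo, lo <= hi &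
    forall t, 0 <= t <= T ->
      exists2 Y, cond_expectation P (F t) (fun w => N T w ^+ 2) Y &
        {ae P, forall w, lo <= Y w / N t w ^+ 2 <= hi}].

Definition hedging_error (n : nat) (S : R -> Omega -> 'cV[R]_n)
    (P : probability Omega R) (H : Omega -> R)
    (theta : R -> Omega -> 'rV[R]_n) : \bar R :=
  'E_P[fun w => ((wealth S theta T w - H w) ^+ 2)%R]%E.

End Strategies.

Definition argmin_on {R : realType} {A : Type} (D : set A) (f : A -> \bar R)
    : set A :=
  [set a | D a /\ forall b, D b -> (f a <= f b)%E].

(* Main.v *)
(** Everything is done at the level of convergence in probability.  A process is
    called good when its path is right-continuous and bounded and when the
    integrals over (0, T] of simple integrands bounded by 1 are bounded in
    probability.  Semimartingales are good (Burkholder's function handles the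
    local martingale part), and good processes are stable under products and
    reciprocals.  For finitely many good processes, the smallness of all the
    integrals of simple integrands carried by a set is an exhaustive and
    continuous submeasure, so that bounded predictable integrands are
    approximated by simple ones off sets of small submeasure, simultaneously for
    all the processes, and the integrals converge in Emery's topology.

    Self-financing is invariant under S -> S Z: if k_N is a simple approximation
    of theta 1_{|theta| <= N} and g_N = k_N . S, integration by parts on a grid
    gives k_N . (S Z) = g_N Z + h_N . Z with h_N = k_N S_- - g_-, and h_N is close
    to the initial wealth V_0 because the jumps of V are theta times those of S.
    With Z = 1/X and Z = X this matches the self-financing strategies for S and
    for S/X.  Tameness is transferred in both directions by the bounds defining a
    nice numeraire along stopping times with finitely many values that decrease to
    the given one; the rest is the identity
    E[(V_T - H)^2] = E[X_T^2] E^Phat[(V_T / X_T - H / X_T)^2]. *)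
Require Import Defs.
From mathcomp Require Import all_boot all_order all_algebra.
From mathcomp Require Import all_classical all_reals all_analysis.
From mathcomp Require Import measurable_realfun ring lra.

Set Implicit Arguments.
Unset Strict Implicit.
Unset Printing Implicit Defensive.

Import Order.TTheory GRing.Theory Num.Theory.
Import numFieldNormedType.Exports.

Local Open Scope classical_set_scope.
Local Open Scope ring_scope.

(** * Grids and simple integrands *)

(** The filtration need not satisfy the usual conditions. Hitting times therefore cannot be assumed
    to be stopping times, and suprema of paths need not be measurable. This forces outer
    probabilities, stopping along finite grids, and maximal bounds recovered by letting the grids
    grow. Integrals are given only by a limit relation, so every estimate is made on simple
    integrands and is uniform over those bounded by 1; stability of goodness under products and
    reciprocals plays the role of Itô's formula. A change of numeraire needs one sequence of simple
    integrands that works against S, S Z and Z at once, hence a submeasure attached to a finite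
    family. The delicate point is the size of h_N. Where k_N approximates badly, it is bounded only
    by a constant depending on N, so that set must be small relative to this constant. Where |theta|
    > N, the truncation vanishes, k_N is near 0 and h_N has a bound independent of N. Elsewhere the
    jump relation makes h_N - V_0 small. The new measure enters the self-financing condition only
    through its null sets. *)

Section Grids.
Context {R : realType} (T : R).
Hypothesis T_ge0 : 0 <= T.

(** Nodes may repeat, so any sorted list of times is a grid; empty cells contribute zero
    increments. *)
Definition is_grid (t : nat -> R) (r : nat) : Prop :=
  [/\ t 0%N = 0, t r = T & {homo t : i j / (i <= j)%N >-> i <= j}].

Definition on_grid (t : nat -> R) (r : nat) (x : R) : Prop :=
  exists2 j, (j <= r)%N & t j = x.

Lemma grid_exists (s : seq R) : (forall x, x \in s -> 0 <= x <= T) ->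
  exists t r, is_grid t r /\ forall x, x \in s -> on_grid t r x.
Proof.
move=> s01; pose s' := sort <=%R (0 :: s).
have szs' : size s' = (size s).+1 by rewrite size_sort.
have s'01 x : x \in s' -> 0 <= x <= T.
  by rewrite mem_sort inE => /orP[/eqP->|/s01//]; rewrite lexx T_ge0.
have s'le : sorted <=%R s' by apply: sort_sorted; exact: le_total.
(* The default value [T] of [nth] supplies the final node just beyond the sorted list. *)
exists (nth T s'), (size s).+1; split; last first.
  move=> x xs; exists (index x s'); last first.
    by rewrite nth_index// mem_sort inE xs orbT.
  by rewrite -szs' index_size.
have mono : {homo nth T s' : i j / (i <= j)%N >-> i <= j}.
  move=> i j ij; have [jlt|jge] := ltnP j (size s').
    apply: (sorted_leq_nth le_trans lexx) => //; rewrite inE//.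
    exact: leq_ltn_trans jlt.
  rewrite (nth_default _ jge); have [ilt|ige] := ltnP i (size s').
    by have /s'01/andP[] := mem_nth T ilt.
  by rewrite (nth_default _ ige).
split=> //; last by rewrite nth_default// szs'.
apply/eqP; rewrite eq_le; apply/andP; split; last first.
  by have /s'01/andP[] : nth T s' 0 \in s' by apply: mem_nth; rewrite szs'.
have : 0 \in s' by rewrite mem_sort inE eqxx.
by move=> /(nth_index T) h; rewrite -[X in _ <= X]h; exact: mono.
Qed.

Section OneGrid.
Variables (t : nat -> R) (r : nat).
Hypothesis tg : is_grid t r.

Lemma grid_in j : (j <= r)%N -> 0 <= t j <= T.
Proof.
case: tg => t0 tr tm jr.
by apply/andP; split; [rewrite -t0|rewrite -[leRHS]tr]; exact: tm.
Qed.

Lemma grid_on_in x : on_grid t r x -> 0 <= x <= T.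
Proof. by move=> [j jr <-]; exact: grid_in. Qed.

Lemma grid_le x j : on_grid t r x -> x < t j.+1 -> x <= t j.
Proof.
case: tg => t0 tr tm [i ir <-] h; apply: (tm _ _).
by rewrite leqNgt; apply/negP => /tm; rewrite leNgt h.
Qed.

Lemma grid_locate x : 0 < x <= T -> exists2 j, (j < r)%N & t j < x <= t j.+1.
Proof.
case: tg => t0 tr tm /andP[x0 xT].
have ex : exists j, x <= t j by exists r; rewrite tr.
case: (ex_minnP ex) => -[|j]; first by rewrite t0 leNgt x0.
move=> xj jm; exists j.
  by have := jm r; rewrite tr; apply.
rewrite xj andbT ltNge; apply/negP => /jm; by rewrite ltnn.
Qed.

Lemma grid_telescope a b (f : R -> R) : on_grid t r a -> on_grid t r b -> a <= b ->
  \sum_(j < r) (if a < t j.+1 <= b then f (t j.+1) - f (t j) else 0) = f b - f a.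
Proof.
move=> ag bg ab; have [t0 tr tm] := tg.
(* Freezing [f] at a grid point [c] switches off exactly the increments after [c]; the difference of
   the cases [b] and [a] leaves the cells in between. *)
have H c j : on_grid t r c ->
  f (Num.min (t j.+1) c) - f (Num.min (t j) c) =
  if t j.+1 <= c then f (t j.+1) - f (t j) else 0.
  move=> cg; have tj : t j <= t j.+1 by exact: tm.
  case: ifPn => [jc|]; first by rewrite !min_l// (le_trans tj).
  by rewrite -ltNge => cj; rewrite !min_r ?subrr ?(ltW cj)// grid_le.
have S c : on_grid t r c ->
  \sum_(j < r) (if t j.+1 <= c then f (t j.+1) - f (t j) else 0) = f c - f 0.
  move=> cg; under eq_bigr do rewrite -H//.
  rewrite -(big_mkord xpredT (fun j => f (Num.min (t j.+1) c) - f (Num.min (t j) c))).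
  rewrite telescope_sumr// tr t0; have /andP[c0 cT] := grid_on_in cg.
  by rewrite (min_r cT) (min_l c0).
transitivity ((f b - f 0) - (f a - f 0)); last by rewrite opprB addrA subrK.
rewrite -(S b)// -(S a)// -sumrB; apply: eq_bigr => j _.
have [aj|ja] := ltP a (t j.+1); first by rewrite subr0.
by rewrite (le_trans ja ab) subrr.
Qed.

End OneGrid.
End Grids.

(** * Measurability with respect to a sub-sigma-algebra *)

Section FMeasurable.
Context {d : measure_display} {Omega : measurableType d} {R : realType}.

Definition Fmeas (G : set (set Omega)) (f : Omega -> R) : Prop :=
  forall B : set R, measurable B -> G (f @^-1` B).

Variable G : set (set Omega).
Hypothesis sG : sigma_algebra setT G.

(** [G] is already a sigma-algebra, so generating adds no set, and the closure properties of
    measurable functions transfer to [Fmeas]. *)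
Lemma FmeasP f :
  Fmeas G f <-> measurable_fun [set: g_sigma_algebraType G] f.
Proof.
split=> [fG _ B mB|mf B mB].
  by rewrite setTI; apply: sub_sigma_algebra; exact: fG.
have := mf measurableT B mB; rewrite setTI.
by rewrite /measurable/= sigma_algebra_id.
Qed.

Lemma Fmeas_cst (c : R) : Fmeas G (cst c).
Proof. by apply/FmeasP; exact: measurable_cst. Qed.

Lemma Fmeas_comp (g : R -> R) f :
  measurable_fun setT g -> Fmeas G f -> Fmeas G (fun w => g (f w)).
Proof. by move=> mg /FmeasP mf; apply/FmeasP; exact: measurableT_comp mf. Qed.

Lemma FmeasD f g : Fmeas G f -> Fmeas G g -> Fmeas G (fun w => f w + g w).
Proof. by move=> /FmeasP mf /FmeasP mg; apply/FmeasP; exact: measurable_funD. Qed.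

Lemma FmeasB f g : Fmeas G f -> Fmeas G g -> Fmeas G (fun w => f w - g w).
Proof. by move=> /FmeasP mf /FmeasP mg; apply/FmeasP; exact: measurable_funB. Qed.

Lemma FmeasM f g : Fmeas G f -> Fmeas G g -> Fmeas G (fun w => f w * g w).
Proof. by move=> /FmeasP mf /FmeasP mg; apply/FmeasP; exact: measurable_funM. Qed.

Lemma Fmeas_sum (I : Type) (s : seq I) (h : I -> Omega -> R) :
  (forall i, Fmeas G (h i)) -> Fmeas G (fun w => \sum_(i <- s) h i w).
Proof.
move=> mh; apply/FmeasP; apply: measurable_sum => i.
by apply/FmeasP; exact: mh.
Qed.

Lemma Fmeas_comp2 (g : R * R -> R) f1 f2 :
  measurable_fun setT g -> Fmeas G f1 -> Fmeas G f2 ->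
  Fmeas G (fun w => g (f1 w, f2 w)).
Proof.
move=> mg /FmeasP m1 /FmeasP m2; apply/FmeasP.
by apply: (measurableT_comp mg); exact: measurable_fun_pair.
Qed.

Lemma Fmeas_if (A : set Omega) f g : G A -> Fmeas G f -> Fmeas G g ->
  Fmeas G (fun w => if w \in A then f w else g w).
Proof.
move=> GA /FmeasP mf /FmeasP mg; apply/FmeasP; apply: measurable_fun_ifT => //.
apply: (measurable_fun_bool true); rewrite setTI.
rewrite (_ : _ @^-1` _ = A); first exact: sub_sigma_algebra.
by apply/seteqP; split=> w /=; [exact: set_mem|exact: mem_set].
Qed.

End FMeasurable.

Lemma Fmeas_sub {d} {Omega : measurableType d} {R : realType}
    (G H : set (set Omega)) (f : Omega -> R) :
  G `<=` H -> Fmeas G f -> Fmeas H f.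
Proof. by move=> GH fG B mB; apply: GH; exact: fG. Qed.

Lemma Fmeas_measurable {d} {Omega : measurableType d} {R : realType}
    (f : Omega -> R) : Fmeas (@measurable d Omega) f <-> measurable_fun setT f.
Proof.
split=> [fm _ B mB|mf B mB]; first by rewrite setTI; exact: fm.
by rewrite -[_ @^-1` _]setTI; exact: mf.
Qed.

(** * Calculus of simple integrands on common grids *)

Section Simple.
Context {d : measure_display} {Omega : measurableType d} {R : realType}.
Variables (F : R -> set (set Omega)) (T : R).
Hypotheses (T_ge0 : 0 <= T) (Ffil : filtration F T).
Implicit Types (k : simple_integrand F T) (Y : R -> Omega -> R).

Lemma Fsigma s : 0 <= s <= T -> sigma_algebra setT (F s).
Proof. by move=> /(Ffil.1)[]. Qed.

Lemma Fmeasurable s : 0 <= s <= T -> F s `<=` measurable.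
Proof. by move=> /(Ffil.1)[]. Qed.

Lemma Fmeas_mono s t (f : Omega -> R) : 0 <= s -> s <= t -> t <= T ->
  Fmeas (F s) f -> Fmeas (F t) f.
Proof. by move=> s0 st tT; apply: Fmeas_sub; exact: Ffil.2. Qed.

Lemma Fmeas_meas s (f : Omega -> R) : 0 <= s <= T -> Fmeas (F s) f ->
  measurable_fun setT f.
Proof. by move=> /Fmeasurable sT mf; apply/Fmeas_measurable; exact: Fmeas_sub mf. Qed.

Definition compat k (t : nat -> R) (r : nat) : Prop :=
  forall i : 'I_(nterms k), on_grid t r (lft i) /\ on_grid t r (rgt i).

(** Locked so that the concatenation stays opaque when membership in larger concatenations of end
    points is split. *)
Definition ends k : seq R := locked
  ([seq lft i | i <- enum 'I_(nterms k)] ++ [seq rgt i | i <- enum 'I_(nterms k)]).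

Lemma ends_in k x : x \in ends k -> 0 <= x <= T.
Proof.
rewrite /ends -lock mem_cat => /orP[] /mapP[i _ ->]; have [l0 lr rT] := simple_times i.
  by rewrite l0 (le_trans lr).
by rewrite rT (le_trans l0).
Qed.

Lemma compat_ends k t r :
  (forall x, x \in ends k -> on_grid t r x) -> compat k t r.
Proof.
by move=> h i; split; apply: h; rewrite /ends -lock mem_cat map_f ?orbT// mem_enum.
Qed.

Lemma simple_val_out k x w : ~~ (0 < x <= T) -> simple_val k x w = 0.
Proof.
move=> xT; rewrite /simple_val big1// => i _; case: ifP => // /andP[lx xr].
have [l0 lr rT] := simple_times i.
by rewrite (le_lt_trans l0)// (le_trans xr) in xT.
Qed.

Lemma simple_val_bounded k : exists2 C : R, 0 <= C & forall (x : R) (w : Omega), `|simple_val k x w| <= C.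
Proof.
have [C HC] := choice (@Defs.simple_bounded _ _ _ _ _ k).
exists (\sum_i `|C i|) => [|x w]; first exact: sumr_ge0.
rewrite (le_trans (ler_norm_sum _ _ _))// ler_sum// => i _.
case: ifP => _; last by rewrite normr0.
exact: le_trans (HC i w) (ler_norm _).
Qed.

Lemma simple_int0 k Y w : simple_int k Y 0 w = 0.
Proof.
rewrite /simple_int big1// => i _; have [l0 lr rT] := simple_times i.
by rewrite !min_l ?subrr ?mulr0// (le_trans l0).
Qed.

Lemma simple_int_Fmeas k Y s : adapted F T Y -> 0 <= s <= T ->
  Fmeas (F s) (simple_int k Y s).
Proof.
move=> aY sT; have sG := Fsigma sT; have /andP[s0 sT'] := sT.
apply: (Fmeas_sum sG) => i; have [l0 lr rT] := simple_times i.
have [ls|] := boolP (lft i <= s); last first.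
  rewrite -ltNge => sl.
  rewrite (_ : (fun _ => _) = cst 0); first exact: Fmeas_cst.
  by apply/funext => w/=; rewrite !min_l ?subrr ?mulr0 ?(ltW sl)// (le_trans (ltW sl)).
apply: (FmeasM sG).
  by apply: (Fmeas_mono l0 ls sT') => B mB; exact: simple_meas.
have H x : 0 <= x <= T -> Fmeas (F s) (Y (Num.min s x)).
  move=> /andP[x0 xT]; have m0 : 0 <= Num.min s x by rewrite le_min s0.
  apply: (Fmeas_mono m0 _ sT'); first by rewrite ge_min lexx.
  by move=> B mB; apply: aY => //; rewrite m0 ge_min sT'.
by apply: (FmeasB sG); apply: H; rewrite ?l0 ?rT ?(le_trans l0)// (le_trans lr).
Qed.

Section OnGrid.
Variables (t : nat -> R) (r : nat).
Hypothesis tg : is_grid T t r.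

Lemma grid_step j : t j <= t j.+1.
Proof. by case: tg => _ _; apply. Qed.

Lemma grid_degen j : t j.+1 <= 0 -> t j.+1 = t j.
Proof.
have [t0 _ tm] := tg => h; apply/eqP; rewrite eq_le grid_step andbT.
by rewrite (le_trans h)// -t0 tm.
Qed.

Lemma simple_val_cst k j x w : compat k t r -> (j < r)%N -> t j < x <= t j.+1 ->
  simple_val k x w = simple_val k (t j.+1) w.
Proof.
move=> kc jr /andP[jx xj]; apply: eq_bigr => i _; have [lg rg] := kc i.
congr (if _ then _ else _); apply/andP/andP => -[h1 h2]; split.
- exact: lt_le_trans xj.
- rewrite leNgt; apply/negP => /(grid_le tg rg) h; have := lt_le_trans jx h2.
  by rewrite ltNge h.
- exact: le_lt_trans (grid_le tg lg h1) jx.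
- exact: le_trans h2.
Qed.

Lemma simple_val_Fmeas k j : compat k t r -> (j < r)%N ->
  Fmeas (F (t j)) (simple_val k (t j.+1)).
Proof.
move=> kc jr; have tj := grid_in tg (ltnW jr).
apply: (Fmeas_sum (Fsigma tj)) => i; have [lg rg] := kc i.
case: (boolP (lft i < t j.+1 <= rgt i)) => [/andP[h1 h2]|_]; last exact: (Fmeas_cst (Fsigma tj)).
have [l0 lr rT] := simple_times i; have /andP[_ tjT] := tj.
by apply: (Fmeas_mono l0 (grid_le tg lg h1) tjT) => B mB; exact: simple_meas.
Qed.

Lemma simple_int_grid k Y s w : compat k t r -> simple_int k Y s w =
  \sum_(j < r) simple_val k (t j.+1) w *
     (Y (Num.min s (t j.+1)) w - Y (Num.min s (t j)) w).
Proof.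
move=> kc; under [RHS]eq_bigr do rewrite /simple_val mulr_suml.
rewrite exchange_big/=; apply: eq_bigr => i _; have [lg rg] := kc i.
have [l0 lr rT] := simple_times i.
rewrite -(grid_telescope tg (fun x => Y (Num.min s x) w) lg rg lr) mulr_sumr.
by apply: eq_bigr => j _; case: ifP => _; rewrite ?mul0r ?mulr0.
Qed.

Lemma simple_int_incr k Y j a b w : compat k t r -> (j < r)%N ->
  t j <= a -> a <= b -> b <= t j.+1 ->
  simple_int k Y b w - simple_int k Y a w =
  simple_val k (t j.+1) w * (Y b w - Y a w).
Proof.
move=> kc jr ja ab bj; rewrite !simple_int_grid// -sumrB.
have [t0 tr tm] := tg.
rewrite (bigD1 (Ordinal jr))//= big1 ?addr0 => [|l].
  by rewrite (min_l bj) (min_l (le_trans ab bj)) (min_r ja) (min_r (le_trans ja ab)); ring.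
rewrite -val_eqE/= neq_ltn => /orP[lj|jl].
  have h : t l.+1 <= a by apply: le_trans ja; exact: tm.
  have h' : t l <= a by apply: le_trans h; exact: grid_step.
  by rewrite (min_r h) (min_r h') (min_r (le_trans h ab)) (min_r (le_trans h' ab)) subrr.
have h : b <= t l by apply: (le_trans bj); exact: tm.
have h' : b <= t l.+1 by apply: (le_trans h); exact: grid_step.
by rewrite (min_l h) (min_l h') (min_l (le_trans ab h)) (min_l (le_trans ab h')) !subrr.
Qed.

Lemma simple_int_incr_min k Y j s w : compat k t r -> (j < r)%N ->
  simple_int k Y (Num.min s (t j.+1)) w - simple_int k Y (Num.min s (t j)) w =
  simple_val k (t j.+1) w * (Y (Num.min s (t j.+1)) w - Y (Num.min s (t j)) w).
Proof.
move=> kc jr; have tj := grid_step j; have [js|] := boolP (t j <= s).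
  by apply: simple_int_incr => //; rewrite ?le_min ?js ?tj ?lexx ?ge_min ?lexx ?tj ?orbT.
rewrite -ltNge => sj.
by rewrite (min_l (le_trans (ltW sj) tj)) (min_l (ltW sj)) !subrr mulr0.
Qed.

Lemma simple_int_pt k Y j w : compat k t r -> (j <= r)%N ->
  simple_int k Y (t j) w =
  \sum_(l < j) simple_val k (t l.+1) w * (Y (t l.+1) w - Y (t l) w).
Proof.
move=> kc; elim: j => [|j IH] jr.
  by have [-> _ _] := tg; rewrite simple_int0 big_ord0.
rewrite big_ord_recr/= -IH ?(ltnW jr)//.
have tj := grid_step j.
by rewrite -(simple_int_incr _ _ kc jr (lexx _) tj (lexx _)) addrC subrK.
Qed.

(** The converse of the grid representation: a bounded weight on each cell, known at its left end,
    comes from a simple integrand. All integrands used below are built this way. *)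
Lemma gsimple_ex (u : nat -> Omega -> R) :
  (forall j, (j < r)%N -> Fmeas (F (t j)) (u j)) ->
  (forall j, (j < r)%N -> exists C, forall w, `|u j w| <= C) ->
  exists k, [/\ compat k t r,
    (forall j (x : R) (w : Omega), (j < r)%N -> t j < x <= t j.+1 -> simple_val k x w = u j w) &
    (forall Y s w, simple_int k Y s w =
      \sum_(j < r) u j w * (Y (Num.min s (t j.+1)) w - Y (Num.min s (t j)) w))].
Proof.
move=> uF ub; have [t0 tr tm] := tg.
have H1 (i : 'I_r) : [/\ 0 <= t i, t i <= t i.+1 & t i.+1 <= T].
  split; last by have /andP[] := grid_in tg (ltn_ord i).
  - by have /andP[] := grid_in tg (ltnW (ltn_ord i)).
  - exact: grid_step.
exists (@SimpleIntegrand _ _ _ F T r (fun i => t i) (fun i => t i.+1) (fun i => u i)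
  H1 (fun i => uF i (ltn_ord i)) (fun i => ub i (ltn_ord i))).
split=> //.
- move=> i; split; first by exists i => //; exact/ltnW/ltn_ord.
  by exists i.+1 => //; exact: ltn_ord.
- move=> j x w jr jx; rewrite /simple_val/= (bigD1 (Ordinal jr))//= jx.
  rewrite big1 ?addr0// => l; rewrite -val_eqE/= neq_ltn => lj; case: ifP => //.
  move: jx => /andP[h1 h2] /andP[h3 h4]; exfalso; case/orP: lj => lj.
    by have := lt_le_trans h1 h4; rewrite ltNge tm.
  by have := lt_le_trans h3 h2; rewrite ltNge tm.
Qed.

End OnGrid.

(** Integrals depend on the values of an integrand and not on its representation: on a common
    refinement each cell carries the value at its right end, and degenerate cells at time 0
    contribute nothing. *)
Lemma simple_int_lin k k1 k2 a b :
  (forall (x : R) (w : Omega), 0 < x <= T -> simple_val k x w = a * simple_val k1 x w + b * simple_val k2 x w) ->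
  forall Y s w, simple_int k Y s w = a * simple_int k1 Y s w + b * simple_int k2 Y s w.
Proof.
move=> h Y s w.
have [|t [r [tg tp]]] := @grid_exists _ T T_ge0 (ends k ++ ends k1 ++ ends k2).
  by move=> x; rewrite !mem_cat => /or3P[]; exact: ends_in.
have kc : compat k t r by apply: compat_ends => x xe; apply: tp; rewrite !mem_cat xe.
have kc1 : compat k1 t r by apply: compat_ends => x xe; apply: tp; rewrite !mem_cat xe orbT.
have kc2 : compat k2 t r by apply: compat_ends => x xe; apply: tp; rewrite !mem_cat xe !orbT.
rewrite (simple_int_grid tg _ _ _ kc) (simple_int_grid tg _ _ _ kc1) (simple_int_grid tg _ _ _ kc2).
rewrite !mulr_sumr -big_split/=; apply: eq_bigr => j _.
have /andP[tj0 tjT] := grid_in tg (ltn_ord j).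
have [t1|] := ltP 0 (t j.+1); first by rewrite h ?t1//; ring.
by move=> t1; rewrite (grid_degen tg t1) subrr !mulr0 addr0.
Qed.

(** One device for scaling, sums, products, clipping and level sets of simple integrands.
    Boundedness of [f] on bounded sets keeps the new weights bounded. *)
Lemma simple_map2 (f : R * R -> R) k1 k2 : measurable_fun setT f ->
  (forall C : R, exists C' : R, forall x y : R, `|x| <= C -> `|y| <= C -> `|f (x, y)| <= C') ->
  exists k, forall x w, 0 < x <= T ->
    simple_val k x w = f (simple_val k1 x w, simple_val k2 x w).
Proof.
move=> mf fb.
have [|t [r [tg tp]]] := @grid_exists _ T T_ge0 (ends k1 ++ ends k2).
  by move=> x; rewrite !mem_cat => /orP[]; exact: ends_in.
have kc1 : compat k1 t r by apply: compat_ends => x xe; apply: tp; rewrite !mem_cat xe.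
have kc2 : compat k2 t r by apply: compat_ends => x xe; apply: tp; rewrite !mem_cat xe !orbT.
have [C1 C10 HC1] := simple_val_bounded k1.
have [C2 C20 HC2] := simple_val_bounded k2.
have [C' HC'] := fb (C1 + C2).
have [||k [kc kv ki]] := @gsimple_ex t r tg
    (fun j w => f (simple_val k1 (t j.+1) w, simple_val k2 (t j.+1) w)).
- move=> j jr; have tj := Fsigma (grid_in tg (ltnW jr)).
  by apply: (Fmeas_comp2 tj mf); apply: (simple_val_Fmeas tg).
- move=> j jr; exists C' => w; apply: HC'.
    by rewrite (le_trans (HC1 _ _))// lerDl.
  by rewrite (le_trans (HC2 _ _))// lerDr.
exists k => x w /(grid_locate tg)[j jr jx].
by rewrite (kv _ _ _ jr jx) -(simple_val_cst tg w kc1 jr jx) -(simple_val_cst tg w kc2 jr jx).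
Qed.

Lemma simple_int_comp k k0 (kk : simple_integrand F T) Y s w :
  (forall (x : R) (w : Omega), 0 < x <= T -> simple_val kk x w = simple_val k x w * simple_val k0 x w) ->
  simple_int k (simple_int k0 Y) s w = simple_int kk Y s w.
Proof.
move=> h.
have [|t [r [tg tp]]] := @grid_exists _ T T_ge0 (ends k ++ ends k0 ++ ends kk).
  by move=> x; rewrite !mem_cat => /or3P[]; exact: ends_in.
have kc : compat k t r by apply: compat_ends => x xe; apply: tp; rewrite !mem_cat xe.
have kc0 : compat k0 t r by apply: compat_ends => x xe; apply: tp; rewrite !mem_cat xe orbT.
have kkc : compat kk t r by apply: compat_ends => x xe; apply: tp; rewrite !mem_cat xe !orbT.
rewrite (simple_int_grid tg _ _ _ kc) (simple_int_grid tg _ _ _ kkc); apply: eq_bigr => j _.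
rewrite (simple_int_incr_min tg _ _ _ kc0) ?ltn_ord// mulrA.
have /andP[tj0 tjT] := grid_in tg (ltn_ord j).
have [t1|] := ltP 0 (t j.+1); first by rewrite h ?t1.
by move=> t1; rewrite (grid_degen tg t1) subrr !mulr0.
Qed.

Lemma simple_intY k Y Y' s w : (forall x, 0 <= x <= T -> Y x w = Y' x w) ->
  0 <= s -> simple_int k Y s w = simple_int k Y' s w.
Proof.
move=> h s0; apply: eq_bigr => i _; have [l0 lr rT] := simple_times i.
by rewrite !h// ?le_min ?ge_min ?s0 ?l0 ?rT ?(le_trans l0 lr) ?(le_trans lr rT) ?orbT.
Qed.

Lemma simple_intB k Y Y' s w : simple_int k (fun x w => Y x w - Y' x w) s w =
  simple_int k Y s w - simple_int k Y' s w.
Proof. by rewrite /simple_int -sumrB; apply: eq_bigr => i _; ring. Qed.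

Lemma simple_intD k Y Y' s w : simple_int k (fun x w => Y x w + Y' x w) s w =
  simple_int k Y s w + simple_int k Y' s w.
Proof. by rewrite /simple_int -big_split; apply: eq_bigr => i _ /=; ring. Qed.

End Simple.

(** * Outer probability and paths *)

Section Outer.
Context {d : measure_display} {Omega : measurableType d} {R : realType}.
Variable P : probability Omega R.
Implicit Types (A B : set Omega) (e : R).

Lemma outer_sub A B e : A `<=` B -> outer_prob_le P B e -> outer_prob_le P A e.
Proof. by move=> AB [C [mC BC PC]]; exists C; split=> //; exact: subset_trans BC. Qed.

Lemma outer_le A e e' : e <= e' -> outer_prob_le P A e -> outer_prob_le P A e'.
Proof.
by move=> ee [C [mC BC PC]]; exists C; split=> //; rewrite (le_trans PC)// lee_fin.
Qed.

Lemma outerU A B a b : outer_prob_le P A a -> outer_prob_le P B b ->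
  outer_prob_le P (A `|` B) (a + b).
Proof.
move=> [A' [mA AA PA]] [B' [mB BB PB]]; exists (A' `|` B'); split.
- exact: measurableU.
- exact: setUSS.
- rewrite (le_trans (measureU2 _ _ _))// EFinD; exact: leeD.
Qed.

Lemma outer_negl A e : 0 <= e -> P.-negligible A -> outer_prob_le P A e.
Proof. by move=> e0 [C [mC PC AC]]; exists C; split=> //; rewrite PC lee_fin. Qed.

Lemma outer_aesub A B e : {ae P, forall w, B w -> A w} ->
  outer_prob_le P A e -> outer_prob_le P B e.
Proof.
move=> BA PA; have /(outer_negl (lexx 0)) N := BA.
rewrite -[e]addr0; apply: outer_sub (outerU PA N) => w Bw.
by have [Aw|nAw] := pselect (A w); [left|right => /(_ Bw)].
Qed.

Lemma outer_meas A e : measurable A -> outer_prob_le P A e <-> (P A <= e%:E)%E.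
Proof.
move=> mA; split=> [[C [mC AC PC]]|PA]; last by exists A; split.
by apply: le_trans PC; apply: le_measure => //; rewrite inE.
Qed.

Lemma outer_sum (n : nat) (A : nat -> set Omega) (a : nat -> R) :
  (forall i, (i < n)%N -> outer_prob_le P (A i) (a i)) ->
  outer_prob_le P [set w | exists2 i, (i < n)%N & A i w] (\sum_(i < n) a i).
Proof.
elim: n => [|n IH] h.
  by rewrite big_ord0; apply: outer_negl => //; apply: negligibleS (negligible_set0 P) => w [].
rewrite big_ord_recr/=.
have := outerU (IH (fun i ni => h i (ltnW ni))) (h n (ltnSn n)).
apply: outer_sub => w [i]; rewrite ltnS leq_eqVlt => /orP[/eqP->|ni] Aw; first by right.
by left; exists i.
Qed.

(** Fatou's lemma for outer probability: the intersections of tails of measurable hulls increase,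
    each has probability at most [e], and their union contains [A]. *)
Lemma outer_liminf (An : nat -> set Omega) A e :
  (forall n, outer_prob_le P (An n) e) ->
  (forall w, A w -> exists n, forall m, (n <= m)%N -> An m w) ->
  outer_prob_le P A e.
Proof.
move=> /choice[B hB] h; pose C n := \bigcap_(m in [set m | (n <= m)%N]) B m.
have mC n : measurable (C n).
  by apply: bigcap_measurable => [|m _]; [exists n => /=|case: (hB m)].
exists (\bigcup_n C n); split; first exact: bigcup_measurable.
  move=> w /h[n hn]; exists n => // m /= nm.
  by have [_ + _] := hB m; apply; exact: hn.
have cv := @nondecreasing_cvg_mu _ _ _ P C mC (bigcup_measurable (fun k _ => mC k)).
have {}cv := cv _.
rewrite -(cvg_lim _ (cv _))//; last first.
  by move=> n m nm; apply/subsetPset => w Cw l /= ml; apply: Cw => /=; exact: leq_trans ml.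
apply: lime_le.
  apply/cvg_ex; eexists; apply: cv.
  by move=> n m nm; apply/subsetPset => w Cw l /= ml; apply: Cw => /=; exact: leq_trans ml.
apply: nearW => n /=; have [mB _ PB] := hB n; apply: le_trans PB.
by apply: le_measure; rewrite ?inE// => w; apply => /=.
Qed.

(** Continuity from above, with the slack [e] so that a finite index is reached. It turns almost
    sure finiteness into a uniform bound. *)
Lemma outer_cont (B : nat -> set Omega) A p e : 0 < e ->
  (forall n, measurable (B n)) -> (forall n, B n.+1 `<=` B n) ->
  \bigcap_n B n `<=` A -> outer_prob_le P A p ->
  exists n, outer_prob_le P (B n) (p + e).
Proof.
move=> e0 mB Bd BA PA.
have mI : measurable (\bigcap_n B n) by exact: bigcapT_measurable.
have PI : (P (\bigcap_n B n) <= p%:E)%E.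
  by apply/outer_meas => //; exact: outer_sub PA.
have cv : (P \o B) x @[x --> \oo] --> P (\bigcap_n B n).
  apply: nonincreasing_cvg_mu => //.
    by rewrite (le_lt_trans (probability_le1 _ _)) ?ltry.
  apply/nonincreasing_seqP => n; exact/subsetPset.
have : \forall n \near \oo, ((P \o B) n < (p + e)%:E)%E.
  have h : (P (\bigcap_n B n) < (p + e)%:E)%E by rewrite (le_lt_trans PI)// lte_fin ltrDl.
  exact: (cv _ (open_ereal_lt' h)).
move=> [n _ /(_ n (leqnn _)) h]; exists n; apply/outer_meas => //; exact: ltW.
Qed.

End Outer.

(** * Right-continuous bounded paths and suprema over countably many times *)

Section Paths.
Context {R : realType} (T : R).
Hypothesis T_gt0 : 0 < T.
Implicit Types f g : R -> R.

Definition rcont f : Prop := forall t, 0 <= t < T -> forall e, 0 < e ->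
  exists2 h : R, 0 < h & forall s, t <= s < t + h -> `|f s - f t| < e.

Definition bounded01 f : Prop := exists c : R, forall t, 0 <= t <= T -> `|f t| <= c.

Lemma rcontP f : (forall t, 0 <= t < T -> f s @[s --> t^'+] --> f t) <-> rcont f.
Proof.
split=> fc t tT.
  move=> e e0; have /cvgrPdist_lt/(_ e e0) := fc t tT.
  move=> /nbhs_ballP[h/= h0 H]; exists h => // s /andP[ts sh].
  have [->|st] := eqVneq s t; first by rewrite subrr normr0.
  rewrite distrC; apply: H; last by rewrite lt_neqAle eq_sym st.
  by rewrite /ball/= ltr0_norm ?subr_lt0 ?lt_neqAle 1?eq_sym ?st//; lra.
apply/cvgrPdist_lt => e e0; have [h h0 H] := fc t tT e e0.
near=> s; rewrite distrC; apply: H; apply/andP; split.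
  by near: s; exact: nbhs_right_ge.
by near: s; apply: nbhs_right_lt; rewrite ltrDl.
Unshelve. all: by end_near. Qed.

Lemma rcontD f g : rcont f -> rcont g -> rcont (fun x => f x + g x).
Proof.
by move=> /rcontP fc /rcontP gc; apply/rcontP => t tT; apply: cvgD; [exact: fc|exact: gc].
Qed.

Lemma rcontB f g : rcont f -> rcont g -> rcont (fun x => f x - g x).
Proof.
by move=> /rcontP fc /rcontP gc; apply/rcontP => t tT; apply: cvgB; [exact: fc|exact: gc].
Qed.

Lemma rcontM f g : rcont f -> rcont g -> rcont (fun x => f x * g x).
Proof.
by move=> /rcontP fc /rcontP gc; apply/rcontP => t tT; apply: cvgM; [exact: fc|exact: gc].
Qed.

Lemma rcont_cst c : rcont (fun=> c).
Proof. by apply/rcontP => t _; exact: cvg_cst. Qed.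

Lemma rcont_sum (I : Type) (s : seq I) (h : I -> R -> R) :
  (forall i, rcont (h i)) -> rcont (fun x => \sum_(i <- s) h i x).
Proof.
move=> hc; elim: s => [|i s IH].
  by rewrite (_ : (fun _ => _) = fun=> 0); [exact: rcont_cst|apply/funext => x; rewrite big_nil].
rewrite (_ : (fun _ => _) = fun x => h i x + \sum_(i <- s) h i x); first exact: rcontD.
by apply/funext => x; rewrite big_cons.
Qed.

Lemma rcontV f : (forall t, 0 <= t < T -> f t != 0) -> rcont f -> rcont (fun x => (f x)^-1).
Proof.
move=> f0 /rcontP fc; apply/rcontP => t tT; apply: cvgV; [exact: f0|exact: fc].
Qed.

Lemma rcont_min f x : rcont f -> rcont (fun t => f (Num.min t x)).
Proof.
move=> fc t /andP[t0 tT] e e0; have [tx|xt] := ltP t x; last first.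
  by exists 1 => // s /andP[ts _]; rewrite (min_r (le_trans xt ts)) subrr normr0.
have [|h h0 H] := fc t _ e e0; first by rewrite t0.
exists (Num.min h (x - t)); first by rewrite lt_min h0 subr_gt0.
move=> s /andP[ts st]; have /andP[s1 s2] : (s < t + h) && (s < x).
  have [h1 h2] : Num.min h (x - t) <= h /\ Num.min h (x - t) <= x - t by rewrite !ge_min !lexx orbT.
  by apply/andP; split; lra.
by rewrite (min_l (ltW s2)); apply: H; rewrite ts.
Qed.

Lemma eq_rcont f g : (forall t, 0 <= t <= T -> f t = g t) -> rcont f -> rcont g.
Proof.
move=> fg fc t /andP[t0 tT] e e0; have [|h h0 H] := fc t _ e e0; first by rewrite t0.
exists (Num.min h (T - t)); first by rewrite lt_min h0 subr_gt0.
move=> s /andP[ts st]; have /andP[s1 s2] : (s < t + h) && (s < T).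
  have [h1 h2] : Num.min h (T - t) <= h /\ Num.min h (T - t) <= T - t by rewrite !ge_min !lexx orbT.
  by apply/andP; split; lra.
by rewrite -!fg; [apply: H; rewrite ts|rewrite t0 ltW|rewrite (le_trans t0 ts) ltW].
Qed.

Lemma unif_rcont (fn : nat -> R -> R) f : (forall n, rcont (fn n)) ->
  (forall e, 0 < e -> exists n, forall t, 0 <= t <= T -> `|fn n t - f t| <= e) -> rcont f.
Proof.
move=> fc h t /andP[t0 tT] e e0; have e30 : 0 < e / 4 by lra.
have [n hn] := h _ e30.
have [|r r0 H] := fc n t _ _ e30; first by rewrite t0.
exists (Num.min r (T - t)); first by rewrite lt_min r0 subr_gt0.
move=> s /andP[ts st]; have /andP[s1 s2] : (s < t + r) && (s < T).
  have [h1 h2] : Num.min r (T - t) <= r /\ Num.min r (T - t) <= T - t by rewrite !ge_min !lexx orbT.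
  by apply/andP; split; lra.
have h1 : `|fn n s - fn n t| < e / 4 by apply: H; rewrite ts.
have h2 : `|fn n s - f s| <= e / 4 by apply: hn; rewrite (le_trans t0 ts) ltW.
have h3 : `|fn n t - f t| <= e / 4 by apply: hn; rewrite t0 ltW.
move: h1 h2 h3; rewrite !ltr_norml !ler_norml => /andP[a1 a2] /andP[b1 b2] /andP[c1 c2].
by apply/andP; split; lra.
Qed.

Lemma bounded01D f g : bounded01 f -> bounded01 g -> bounded01 (fun x => f x + g x).
Proof.
move=> [a ha] [b hb]; exists (a + b) => t tT.
by rewrite (le_trans (ler_normD _ _))// lerD ?ha ?hb.
Qed.

Lemma bounded01B f g : bounded01 f -> bounded01 g -> bounded01 (fun x => f x - g x).
Proof.
move=> [a ha] [b hb]; exists (a + b) => t tT.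
by rewrite (le_trans (ler_normB _ _))// lerD ?ha ?hb.
Qed.

Lemma bounded01M f g : bounded01 f -> bounded01 g -> bounded01 (fun x => f x * g x).
Proof.
move=> [a ha] [b hb]; exists (a * b) => t tT.
by rewrite normrM ler_pM ?ha ?hb.
Qed.

Lemma bounded01_cst c : bounded01 (fun=> c).
Proof. by exists `|c|. Qed.

Lemma bounded01_sum (I : Type) (s : seq I) (h : I -> R -> R) :
  (forall i, bounded01 (h i)) -> bounded01 (fun x => \sum_(i <- s) h i x).
Proof.
move=> hc; elim: s => [|i s IH].
  by rewrite (_ : (fun _ => _) = fun=> 0); [exact: bounded01_cst|apply/funext => x; rewrite big_nil].
rewrite (_ : (fun _ => _) = fun x => h i x + \sum_(i <- s) h i x); first exact: bounded01D.
by apply/funext => x; rewrite big_cons.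
Qed.

Lemma locally_bounded01 f :
  (forall t, 0 <= t < T -> exists2 h : R, 0 < h & exists c : R, forall s, t < s < t + h -> `|f s| <= c) ->
  (forall t, 0 < t <= T -> exists2 h : R, 0 < h & exists c : R, forall s, t - h < s < t -> `|f s| <= c) ->
  bounded01 f.
Proof.
(* Continuous induction: the left bound puts the supremum of [A] into [A], and the right bound moves
   past it unless it equals [T]. *)
move=> hr hl; pose A := [set x | 0 <= x <= T /\ exists c : R, forall s, 0 <= s <= x -> `|f s| <= c].
have A0 : A 0.
  split; first by rewrite lexx ltW.
  by exists `|f 0| => s /andP[s0 s0']; rewrite (_ : s = 0)//; apply/eqP; rewrite eq_le s0 s0'.
have Aub : ubound A T by move=> x [/andP[]].
have supA : has_sup A by split; [exists 0|exists T].
set z := sup A.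
have z0 : 0 <= z by apply: ub_le_sup => //; exists T.
have zT : z <= T by apply: ge_sup => //; exists 0.
have Az : A z.
  split; first by rewrite z0.
  have [zz|zpos] := eqVneq z 0; first by rewrite zz; case: A0.
  have [|h h0 [c hc]] := hl z; first by rewrite lt_neqAle eq_sym zpos z0.
  have [x Ax xz] := sup_adherent h0 supA.
  have [/andP[x0 xT] [c' hc']] := Ax.
  exists (`|c| + `|c'| + `|f z|) => s /andP[s0 sz].
  have [->|sz'] := eqVneq s z; first by rewrite lerDr addr_ge0.
  have {}sz' : s < z by rewrite lt_neqAle sz'.
  have n1 := normr_ge0 c; have n2 := normr_ge0 c'; have n3 := normr_ge0 (f z).
  have [sx|xs] := leP s x.
    have := hc' s; rewrite s0 sx => /(_ erefl) h1.
    by have := ler_norm c'; lra.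
  have := hc s; rewrite sz' (lt_trans xz xs) => /(_ erefl) h1.
  by have := ler_norm c; lra.
have [zT'|Tz] := ltP z T; last first.
  have zE : z = T by apply/eqP; rewrite eq_le Tz zT.
  by case: Az => _; rewrite zE.
have [|h h0 [c hc]] := hr z; first by rewrite z0.
have [_ [c' hc']] := Az.
pose y := Num.min (z + h / 2) T.
have zy : z < y by rewrite lt_min zT' andbT; lra.
have yh : y < z + h by rewrite gt_min; apply/orP; left; lra.
suff Ay : A y.
  by have := ub_le_sup (ex_intro _ T Aub) Ay; rewrite -/z leNgt zy.
split; first by rewrite (le_trans z0 (ltW zy)) ge_min lexx orbT.
exists (`|c| + `|c'|) => s /andP[s0 sy].
have n1 := normr_ge0 c; have n2 := normr_ge0 c'.
have [sz|zs] := leP s z.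
  have := hc' s; rewrite s0 sz => /(_ erefl) h1.
  by have := ler_norm c'; lra.
have := hc s; rewrite zs (le_lt_trans sy yh) => /(_ erefl) h1.
by have := ler_norm c; lra.
Qed.

Lemma at_right_bound f (t l : R) : f s @[s --> t^'+] --> l ->
  exists2 h : R, 0 < h & exists c : R, forall s, t < s < t + h -> `|f s| <= c.
Proof.
move=> /cvgrPdist_lt/(_ 1 ltr01) /nbhs_ballP[h/= h0 H]; exists h => //.
exists (`|l| + 1) => s /andP[ts st].
have : `|l - f s| < 1 by apply: H => //; rewrite /ball/= ltr0_norm ?subr_lt0//; lra.
rewrite ltr_norml => /andP[a b]; have := ler_norm l; have := ler_norm (- l); rewrite normrN.
by rewrite ler_norml => *; apply/andP; split; lra.
Qed.

Lemma at_left_bound f (t l : R) : f s @[s --> t^'-] --> l ->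
  exists2 h : R, 0 < h & exists c : R, forall s, t - h < s < t -> `|f s| <= c.
Proof.
move=> /cvgrPdist_lt/(_ 1 ltr01) /nbhs_ballP[h/= h0 H]; exists h => //.
exists (`|l| + 1) => s /andP[ts st].
have : `|l - f s| < 1 by apply: H => //; rewrite /ball/= gtr0_norm ?subr_gt0//; lra.
rewrite ltr_norml => /andP[a b]; have := ler_norm l; have := ler_norm (- l); rewrite normrN.
by rewrite ler_norml => *; apply/andP; split; lra.
Qed.

Lemma cadlag_bounded01 f :
  (forall t, 0 <= t < T -> f s @[s --> t^'+] --> f t) ->
  (forall t, 0 < t <= T -> cvg (f s @[s --> t^'-])) -> bounded01 f.
Proof.
move=> hr hl; apply: locally_bounded01 => t tT.
  exact: at_right_bound (hr t tT).
exact: at_left_bound (hl t tT).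
Qed.

(** The condition [N_- > 0] on a numeraire acts here: without it the reciprocal could explode on
    approach to a time from the left. *)
Lemma cadlagV_bounded01 f :
  (forall t, 0 <= t < T -> f s @[s --> t^'+] --> f t) ->
  (forall t, 0 < t <= T -> cvg (f s @[s --> t^'-])) ->
  (forall t, 0 <= t <= T -> f t != 0) ->
  (forall t, 0 < t <= T -> lim (f s @[s --> t^'-]) != 0) ->
  bounded01 (fun x => (f x)^-1).
Proof.
move=> hr hl h0 h1; apply: locally_bounded01 => t tT.
  apply: (@at_right_bound _ _ (f t)^-1); apply: cvgV; last exact: hr.
  by apply: h0; case/andP: tT => -> /ltW.
apply: (@at_left_bound _ _ (lim (f s @[s --> t^'-]))^-1); apply: cvgV; first exact: h1.
exact: hl.
Qed.

(** The rationals clamped to [[0, T]], so that every index gives an admissible time; indices coding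
    no rational give [T]. *)
Definition qs (n : nat) : R :=
  Num.max 0 (Num.min T (odflt T (omap (@ratr R) (@unpickle rat n)))).

Lemma qs_in n : 0 <= qs n <= T.
Proof. by rewrite /qs le_max lexx/= ge_max ltW//= ge_min lexx. Qed.

Lemma qs_pickle (q : rat) : 0 <= (ratr q : R) <= T -> qs (pickle q) = ratr q.
Proof. by move=> /andP[q0 qT]; rewrite /qs pickleK/= (min_r qT) (max_r q0). Qed.

Lemma qs_dense t h : 0 <= t < T -> 0 < h -> exists n, t < qs n < t + h.
Proof.
move=> /andP[t0 tT] h0; have lt : t < Num.min (t + h) T by rewrite lt_min tT ltrDl h0.
have [q] := rat_in_itvoo lt; rewrite in_itv/= => /andP[tq].
rewrite lt_min => /andP[qh qT]; exists (pickle q); rewrite qs_pickle ?tq//.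
by rewrite (le_trans t0 (ltW tq)) ltW.
Qed.

(** Right-continuity reaches [t] from rationals to its right, which exist only for [t < T]; hence
    the separate case of [T]. *)
Lemma rcont_sup f c : rcont f -> (exists2 t, 0 <= t <= T & c < `|f t|) ->
  c < `|f T| \/ exists n, c < `|f (qs n)|.
Proof.
move=> fc [t /andP[t0 tT] ct]; have [tT'|Tt] := ltP t T; last first.
  by left; rewrite (_ : T = t)//; apply/eqP; rewrite eq_le Tt tT.
right; have [||h h0 H] := fc t _ (`|f t| - c); rewrite ?subr_gt0 ?t0//.
have [|n /andP[n1 n2]] := @qs_dense t h _ h0; first by apply/andP; split; [exact: t0|exact: tT'].
exists n; have := H (qs n); rewrite (ltW n1) n2 => /(_ erefl).
by have := ler_distD (f (qs n)) (f t) 0; rewrite !subr0 distrC; lra.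
Qed.

End Paths.

(** The product of indicators stops the sequence at its first value beyond [c], so an excess at an
    intermediate index is still visible at the end. *)
Lemma stopped_sum {R : realType} (I : nat -> R) (c : R) m : I 0%N = 0 ->
  let S := \sum_(j < m) (\prod_(i < j.+1) (if `|I i| <= c then 1 else 0)) * (I j.+1 - I j) in
  ((forall i, (i < m)%N -> `|I i| <= c) -> S = I m) /\
  ((exists2 i, (i < m)%N & c < `|I i|) -> c < `|S|).
Proof.
move=> I0; elim: m => [|m [IH1 IH2]] /=.
  by rewrite big_ord0; split=> [//|[]].
rewrite big_ord_recr/=; split=> [h|[i im ci]].
  rewrite IH1; last by move=> i im; exact: h (ltnW im).
  rewrite big1 ?mul1r; first by rewrite addrC subrK.
  by move=> i _; rewrite h// ltn_ord.
rewrite (bigD1 (Ordinal im))//= leNgt ci mul0r mul0r addr0.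
move: im; rewrite ltnS leq_eqVlt => /orP[/eqP im|im]; last by apply: IH2; exists i.
have [all|] := pselect (forall l, (l < m)%N -> `|I l| <= c); first by rewrite IH1// -im.
move=> /existsNP[l] /not_implyP[lm /negP]; rewrite -ltNge => cl; by apply: IH2; exists l.
Qed.

Lemma measurable_le_ind {R : realType} (c : R) :
  measurable_fun setT (fun x : R => if `|x| <= c then 1 else 0 : R).
Proof.
apply: measurable_fun_ifT => //; apply: measurable_fun_ler => //.
Qed.

(** * Good processes *)

Section Good.
Context {d : measure_display} {Omega : measurableType d} {R : realType}.
Variables (P : probability Omega R) (F : R -> set (set Omega)) (T : R).
Hypotheses (T_gt0 : 0 < T) (Ffil : filtration F T).
Implicit Types (k : simple_integrand F T) (Y Z : R -> Omega -> R).

Let T_ge0 : 0 <= T := ltW T_gt0.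

Definition supgt Y (c : R) : set Omega :=
  [set w | exists2 t, 0 <= t <= T & c < `|Y t w|].

Definition gtset (f : Omega -> R) (c : R) : set Omega := [set w | c < `|f w|].

Definition le_val k (H : R -> Omega -> R) : Prop :=
  forall (x : R) (w : Omega), 0 < x <= T -> `|simple_val k x w| <= H x w.

Definition regular Y : Prop :=
  adapted F T Y /\
  {ae P, forall w, rcont T (Y ^~ w) /\ bounded01 T (Y ^~ w)}.

(** The good integrators of the Bichteler-Dellacherie theorem: elementary integrals are bounded in
    probability. The two path properties in [regular] are those that pass directly to uniform
    limits. *)
Definition good Y : Prop := regular Y /\
  forall e, 0 < e -> exists2 c : R, 0 < c &
    forall k, le_val k (fun _ _ => 1) -> outer_prob_le P (gtset (simple_int k Y T) c) e.

Lemma gtset_measurable f c : measurable_fun setT f -> measurable (gtset f c).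
Proof.
move=> mf; rewrite (_ : gtset f c = (fun w => `|f w|) @^-1` `]c, +oo[%classic).
  rewrite -[_ @^-1` _]setTI.
  by apply: (measurableT_comp (@normr_measurable R setT) mf) => //; exact: measurable_itv.
by apply/seteqP; split=> w; rewrite /gtset/= in_itv/= andbT.
Qed.

Lemma gtset_add (f g h : Omega -> R) a b x y :
  (forall w, `|h w| <= `|f w| + `|g w|) ->
  outer_prob_le P (gtset f a) x -> outer_prob_le P (gtset g b) y ->
  outer_prob_le P (gtset h (a + b)) (x + y).
Proof.
move=> hfg fa gb; apply: outer_sub (outerU fa gb) => w; rewrite /gtset/= => ab.
have [fa'|fa'] := ltP a `|f w|; first by left.
by right => /=; have := hfg w; lra.
Qed.

Lemma supgt_add Y Z W a b x y :
  (forall t w, 0 <= t <= T -> `|W t w| <= `|Y t w| + `|Z t w|) ->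
  outer_prob_le P (supgt Y a) x -> outer_prob_le P (supgt Z b) y ->
  outer_prob_le P (supgt W (a + b)) (x + y).
Proof.
move=> h fa gb; apply: outer_sub (outerU fa gb) => w [t tT ab].
have [fa'|fa'] := ltP a `|Y t w|; first by left; exists t.
by right; exists t => //; have := h t w tT; lra.
Qed.

Lemma gtset_le (f : Omega -> R) a b : a <= b -> gtset f b `<=` gtset f a.
Proof. by move=> ab w; exact: le_lt_trans. Qed.

Lemma supgt_le Y a b : a <= b -> supgt Y b `<=` supgt Y a.
Proof. by move=> ab w [t tT h]; exists t => //; exact: le_lt_trans h. Qed.

Lemma adapted_meas Y t : adapted F T Y -> 0 <= t <= T -> measurable_fun setT (Y t).
Proof. by move=> aY tT; apply: (Fmeas_meas Ffil tT); exact: aY. Qed.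

Lemma simple_int_adapted k Y : adapted F T Y -> adapted F T (simple_int k Y).
Proof. by move=> aY t tT; exact: simple_int_Fmeas. Qed.

Lemma simple_int_meas k Y t : adapted F T Y -> 0 <= t <= T ->
  measurable_fun setT (simple_int k Y t).
Proof. by move=> aY tT; apply: adapted_meas => //; exact: simple_int_adapted. Qed.

Lemma TT : 0 <= T <= T. Proof. by rewrite T_ge0 lexx. Qed.
Lemma zT : 0 <= (0 : R) <= T. Proof. by rewrite lexx. Qed.

Lemma bounded01_min f x : 0 <= x -> bounded01 T f -> bounded01 T (fun t => f (Num.min t x)).
Proof.
move=> x0 [c hc]; exists c => t /andP[t0 tT]; apply: hc.
by rewrite le_min t0 x0 ge_min tT.
Qed.

Lemma rcont_simple_int k Y w : rcont T (Y ^~ w) -> rcont T ((simple_int k Y) ^~ w).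
Proof.
move=> Yc; apply: rcont_sum => i; apply: rcontM; first exact: rcont_cst.
by apply: rcontB; apply: (rcont_min (f := Y ^~ w)).
Qed.

Lemma bounded01_simple_int k Y w : bounded01 T (Y ^~ w) -> bounded01 T ((simple_int k Y) ^~ w).
Proof.
move=> Yb; apply: bounded01_sum => i; apply: bounded01M; first exact: bounded01_cst.
have [l0 lr rT] := simple_times i.
by apply: bounded01B; apply: (bounded01_min (f := Y ^~ w)) => //; exact: le_trans lr.
Qed.

Lemma regular_simple_int k Y : regular Y -> regular (simple_int k Y).
Proof.
move=> [aY rY]; split; first exact: simple_int_adapted.
apply: filterS rY => w [h1 h2]; split; first exact: rcont_simple_int.
exact: bounded01_simple_int.
Qed.

Lemma regularD Y Z : regular Y -> regular Z -> regular (fun t w => Y t w + Z t w).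
Proof.
move=> [aY rY] [aZ rZ]; split.
  by move=> t tT; apply: (FmeasD (Fsigma Ffil tT)) => B mB; [exact: aY|exact: aZ].
apply: filterS2 rY rZ => w [h1 h2] [h3 h4].
by split; [exact: rcontD|exact: bounded01D].
Qed.

Lemma regularB Y Z : regular Y -> regular Z -> regular (fun t w => Y t w - Z t w).
Proof.
move=> [aY rY] [aZ rZ]; split.
  by move=> t tT; apply: (FmeasB (Fsigma Ffil tT)) => B mB; [exact: aY|exact: aZ].
apply: filterS2 rY rZ => w [h1 h2] [h3 h4].
by split; [exact: rcontB|exact: bounded01B].
Qed.

Lemma regularM Y Z : regular Y -> regular Z -> regular (fun t w => Y t w * Z t w).
Proof.
move=> [aY rY] [aZ rZ]; split.
  by move=> t tT; apply: (FmeasM (Fsigma Ffil tT)) => B mB; [exact: aY|exact: aZ].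
apply: filterS2 rY rZ => w [h1 h2] [h3 h4].
by split; [exact: rcontM|exact: bounded01M].
Qed.

Lemma regular_cst (f : Omega -> R) : Fmeas (F 0) f -> regular (fun _ => f).
Proof.
move=> mf; split.
  by move=> t /andP[t0 tT]; exact: (Fmeas_mono Ffil (lexx _) t0 tT mf).
by apply: aeW => w; split; [exact: rcont_cst|exact: bounded01_cst].
Qed.

Lemma regular_sum (I : Type) (s : seq I) (Ys : I -> R -> Omega -> R) :
  (forall i, regular (Ys i)) -> regular (fun t w => \sum_(i <- s) Ys i t w).
Proof.
move=> h; elim: s => [|i s IH].
  rewrite (_ : (fun _ _ => _) = fun _ => cst 0); first by apply: regular_cst; apply: Fmeas_cst; exact: (Fsigma Ffil zT).
  by apply/funext => t; apply/funext => w; rewrite big_nil.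
rewrite (_ : (fun _ _ => _) = fun t w => Ys i t w + \sum_(i <- s) Ys i t w); first exact: regularD.
by apply/funext => t; apply/funext => w; rewrite big_cons.
Qed.

(** Almost every path is bounded, so the events of exceeding [n] on the countable set of times
    decrease to a null set, and right-continuity extends the bound to all times. *)
Lemma regular_amp Y e : regular Y -> 0 < e ->
  exists2 c : R, 0 < c & outer_prob_le P (supgt Y c) e.
Proof.
move=> [aY rY] e0.
pose B n := (gtset (Y T) n.+1%:R) `|` \bigcup_m gtset (Y (qs T m)) n.+1%:R.
have mB n : measurable (B n).
  apply: measurableU; first by apply: gtset_measurable; exact: adapted_meas TT.
  by apply: bigcup_measurable => m _; apply: gtset_measurable; apply: adapted_meas => //; exact: qs_in.
have Bd n : B n.+1 `<=` B n.
  move=> w [h|[m _ h]]; [left|right; exists m => //]; apply: gtset_le h; by rewrite ler_nat.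
have [] := @outer_cont _ _ _ P B (~` [set w | rcont T (Y ^~ w) /\ bounded01 T (Y ^~ w)]) 0 e e0 mB Bd.
- move=> w Bw /= [_ [c hc]]; have := Bw (Num.truncn `|c|) I.
  have h x : `|x| <= c -> ~ (Num.truncn `|c|).+1%:R < `|x|.
    move=> xc h; have := truncnS_gt `|c|; have := ler_norm c; lra.
  by case=> [|[m _]]; apply: h; apply: hc; [exact: TT|exact: qs_in].
- exact: outer_negl.
move=> n; rewrite add0r => h; exists n.+1%:R => //.
apply: outer_aesub h; apply: filterS rY => w [rc _] /(rcont_sup rc)[h|[m h]]; first by left.
by right; exists m.
Qed.

Lemma stop_finite k Y c t r : adapted F T Y -> is_grid T t r -> compat k t r ->
  exists k', le_val k' (fun x w => `|simple_val k x w|) /\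
    forall w, (exists2 j, (j <= r)%N & c < `|simple_int k Y (t j) w|) ->
      c < `|simple_int k' Y T w|.
Proof.
move=> aY tg kc; have [t0 tr tm] := tg.
pose ind (x : R) : R := if `|x| <= c then 1 else 0.
pose I w j := simple_int k Y (t j) w.
pose u j w := (\prod_(i < j.+1) ind (I w i)) * simple_val k (t j.+1) w.
have ind01 x : 0 <= ind x <= 1 by rewrite /ind; case: ifP; rewrite lexx ?ler01.
have p01 w j : 0 <= \prod_(i < j.+1) ind (I w i) <= 1.
  apply/andP; split; first by apply: prodr_ge0 => i _; case/andP: (ind01 (I w i)).
  by apply: prodr_ile1 => i _.
have [C C0 HC] := simple_val_bounded k.
have ule j w : `|u j w| <= `|simple_val k (t j.+1) w|.
  rewrite /u normrM; have /andP[a b] := p01 w j.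
  by rewrite (ger0_norm a) ler_piMl.
have [||k' [kc' kv' ki']] := @gsimple_ex _ _ _ F T t r tg u.
- move=> j jr; have sj := Fsigma Ffil (grid_in tg (ltnW jr)).
  apply: (FmeasM sj); last exact: (simple_val_Fmeas Ffil tg kc jr).
  have FI l : (l <= j)%N -> Fmeas (F (t j)) (fun w => I w l).
    move=> lj; have ljr := leq_trans lj (ltnW jr).
    have /andP[l0 lT] := grid_in tg ljr; have /andP[_ jT] := grid_in tg (ltnW jr).
    apply: (Fmeas_mono Ffil l0 (tm _ _ lj) jT).
    by apply: (simple_int_Fmeas Ffil k aY); rewrite l0.
  have H : forall l, (l <= j)%N -> Fmeas (F (t j)) (fun w => \prod_(i < l.+1) ind (I w i)).
    elim=> [|l IH] lj.
      rewrite (_ : (fun _ => _) = fun w => ind (I w 0%N)); last first.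
        by apply/funext => w; rewrite big_ord_recl big_ord0 mulr1.
      exact: (Fmeas_comp sj (@measurable_le_ind R c) (FI _ lj)).
    rewrite (_ : (fun _ => _) = fun w => (\prod_(i < l.+1) ind (I w i)) * ind (I w l.+1)); last first.
      by apply/funext => w; rewrite big_ord_recr.
    apply: (FmeasM sj); first exact: IH (ltnW lj).
    exact: (Fmeas_comp sj (@measurable_le_ind R c) (FI _ lj)).
  exact: H.
- by move=> j jr; exists C => w; exact: le_trans (ule j w) (HC _ _).
exists k'; split.
  move=> x w /(grid_locate tg)[j jr jx]; rewrite (kv' _ _ _ jr jx).
  by rewrite (simple_val_cst tg w kc jr jx); exact: ule.
move=> w [j jr cj].
have I0 : I w 0%N = 0 by rewrite /I t0 simple_int0.
have [S1 S2] := stopped_sum c r I0.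
have -> : simple_int k' Y T w = \sum_(j < r) (\prod_(i < j.+1) ind (I w i)) * (I w j.+1 - I w j).
  rewrite ki'; apply: eq_bigr => l _.
  have tlT i : (i <= r)%N -> t i <= T by move=> ir; case/andP: (grid_in tg ir).
  rewrite !min_r ?tlT// ?(ltnW (ltn_ord l))// /u -mulrA; congr (_ * _).
  rewrite /I (simple_int_incr tg _ _ kc (ltn_ord l) (lexx _) (grid_step tg _) (lexx _))//.
have [ex|nex] := pselect (exists2 i, (i < r)%N & c < `|I w i|); first exact: S2.
have all i : (i < r)%N -> `|I w i| <= c.
  by move=> ir; rewrite leNgt; apply/negP => ci; apply: nex; exists i.
rewrite S1//; move: jr; rewrite leq_eqVlt => /orP[/eqP <-//|jr].
by have := all _ jr; rewrite leNgt cj.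
Qed.

(** This replaces a maximal inequality. Stopping is done along finite grids containing more and more
    of the times [qs], where it yields again a simple integrand dominated by [k]; the limit is taken
    in outer probability. *)
Lemma stop k Y c e : regular Y ->
  (forall k', le_val k' (fun x w => `|simple_val k x w|) ->
     outer_prob_le P (gtset (simple_int k' Y T) c) e) ->
  outer_prob_le P (supgt (simple_int k Y) c) e.
Proof.
move=> [aY rY] h.
pose An n := [set w | c < `|simple_int k Y T w| \/
  exists2 m, (m < n)%N & c < `|simple_int k Y (qs T m) w| ].
apply: (@outer_aesub _ _ _ _ (\bigcup_n An n)).
  apply: filterS rY => w [rc _] /(rcont_sup (rcont_simple_int k rc))[cT|[n cn]].
    by exists 0%N => //; left.
  by exists n.+1 => //; right; exists n.
apply: (@outer_liminf _ _ _ P An).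
  move=> n.
  have [|t [r [tg tp]]] := @grid_exists _ T T_ge0 (ends k ++ map (qs T) (iota 0 n)).
    move=> x; rewrite mem_cat => /orP[]; first exact: ends_in.
    by move=> /mapP[m _ ->]; exact: qs_in.
  have kc : compat k t r by apply: compat_ends => x xe; apply: tp; rewrite mem_cat xe.
  have [k' [kk' kw]] := stop_finite c aY tg kc.
  apply: outer_sub (h k' kk') => w [cT|[m mn cm]]; apply: kw.
    by exists r => //; have [_ -> _] := tg.
  have [|j jr je] := tp (qs T m).
    by rewrite mem_cat; apply/orP; right; apply: map_f; rewrite mem_iota.
  by exists j; rewrite ?je.
move=> w [n _ [cT|[m mn cm]]]; first by exists 0%N => l _; left.
by exists n => l nl; right; exists m => //; exact: leq_trans nl.
Qed.

Lemma simple_scale a k : exists k', forall (x : R) w, 0 < x <= T ->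
  simple_val k' x w = a * simple_val k x w.
Proof.
have [||k' hk'] := @simple_map2 _ _ _ F T T_ge0 Ffil (fun p => a * p.1) k k.
- by apply: measurable_funM => //; exact: measurable_fst.
- by move=> C; exists (`|a| * C) => x y xC _; rewrite normrM ler_wpM2l.
by exists k' => x w xT; rewrite hk'.
Qed.

Lemma simple_add k1 k2 a b : exists k, forall (x : R) w, 0 < x <= T ->
  simple_val k x w = a * simple_val k1 x w + b * simple_val k2 x w.
Proof.
have [||k' hk'] := @simple_map2 _ _ _ F T T_ge0 Ffil (fun p => a * p.1 + b * p.2) k1 k2.
- by apply: measurable_funD; apply: measurable_funM => //;
    first [exact: measurable_fst | exact: measurable_snd].
- move=> C; exists (`|a| * C + `|b| * C) => x y xC yC.
  by rewrite (le_trans (ler_normD _ _))// !normrM lerD// ler_wpM2l.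
by exists k' => x w xT; rewrite hk'.
Qed.

Lemma simple_mul k1 k2 : exists k, forall (x : R) w, 0 < x <= T ->
  simple_val k x w = simple_val k1 x w * simple_val k2 x w.
Proof.
have [||k' hk'] := @simple_map2 _ _ _ F T T_ge0 Ffil (fun p => p.1 * p.2) k1 k2.
- by apply: measurable_funM; [exact: measurable_fst|exact: measurable_snd].
- by move=> C; exists (C * C) => x y xC yC; rewrite normrM ler_pM.
by exists k' => x w xT; rewrite hk'.
Qed.

Lemma simple_gt_ind k a : 0 <= a -> exists k', forall (x : R) w, 0 < x <= T ->
  simple_val k' x w = if a < `|simple_val k x w| then 1 else 0.
Proof.
move=> a0; have [||k' hk'] := @simple_map2 _ _ _ F T T_ge0 Ffil (fun p => if a < `|p.1| then 1 else 0) k k.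
- apply: measurable_fun_ifT => //; apply: measurable_fun_ltr => //.
  by apply: (measurableT_comp (@normr_measurable R setT)); exact: measurable_fst.
- by move=> C; exists 1 => x y _ _ /=; case: ifP; rewrite ?normr1 ?normr0.
by exists k' => x w xT; rewrite hk'.
Qed.

(** Boundedness in probability read as continuity at zero, by homogeneity: [e = a / c] when [c] is
    the bound at probability [a]. *)
Lemma good_rho Y a : good Y -> 0 < a -> exists2 e : R, 0 < e & forall k,
  le_val k (fun _ _ => e) -> outer_prob_le P (gtset (simple_int k Y T) a) a.
Proof.
move=> [_ gY] a0; have [c c0 hc] := gY a a0.
exists (a / c); first exact: divr_gt0.
move=> k kle; have [k' hk'] := simple_scale (c / a) k.
have kle' : le_val k' (fun _ _ => 1).
  move=> x w xT; rewrite hk'// normrM gtr0_norm ?divr_gt0//.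
  have := kle x w xT; rewrite -(ler_pM2l (x := c / a)) ?divr_gt0// => /le_trans; apply.
  by rewrite mulrA divfK ?gt_eqF// divff ?gt_eqF.
apply: outer_sub (hc k' kle') => w; rewrite /gtset/=.
rewrite (@simple_int_lin _ _ _ _ _ T_ge0 k' k k (c / a) 0); last by move=> x w' /hk' ->; ring.
rewrite mul0r addr0 normrM (gtr0_norm (divr_gt0 c0 a0)) => h.
by rewrite -mulrA mulrC -ltr_pdivrMr// divff ?gt_eqF// mulrC ltr_pdivlMr// mul1r.
Qed.

Lemma le_val_trans k (H H' : R -> Omega -> R) : le_val k H ->
  (forall x w, 0 < x <= T -> H x w <= H' x w) -> le_val k H'.
Proof. by move=> h hh x w xT; exact: le_trans (h x w xT) (hh x w xT). Qed.

Lemma goodD Y Z : good Y -> good Z -> good (fun t w => Y t w + Z t w).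
Proof.
move=> [rY gY] [rZ gZ]; split; first exact: regularD.
move=> e e0; have e20 : 0 < e / 2 by lra.
have [c c0 hc] := gY _ e20; have [c' c0' hc'] := gZ _ e20.
exists (c + c'); first lra.
move=> k kle; rewrite (splitr e); apply: gtset_add (hc k kle) (hc' k kle) => w.
by rewrite simple_intD ler_normD.
Qed.

Lemma good_ae Y Z : good Y -> adapted F T Z ->
  {ae P, forall w, forall t, 0 <= t <= T -> Y t w = Z t w} -> good Z.
Proof.
move=> [[aY rY] gY] aZ YZ; split.
  split=> //; apply: filterS2 YZ rY => w e [rc [c bc]]; split; first exact: eq_rcont rc.
  by exists c => t tT; rewrite -e// bc.
move=> e e0; have [c c0 hc] := gY e e0; exists c => // k kle.
apply: outer_aesub (hc k kle); apply: filterS YZ => w ew; rewrite /gtset/=.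
by rewrite -(simple_intY _ ew T_ge0).
Qed.

End Good.

(** * Semimartingales are good *)

Section Burkholder.
Context {R : realType}.
Implicit Types x y h k : R.

(* Burkholder's special function: evaluated along a martingale and its transform,
   [bU] is a supermartingale, which yields the weak-type inequality; [bA] and [bB]
   are its slopes. *)
Definition bU x y : R := if `|x| + `|y| <= 1 then y ^+ 2 - x ^+ 2 else 1 - 2 * `|x|.
Definition bA x y : R := if `|x| + `|y| <= 1 then - 2 * x else - 2 * (if 0 <= x then 1 else - 1).
Definition bB x y : R := if `|x| + `|y| <= 1 then 2 * y else 0.

Lemma bU_le x y : bU x y <= 1 - 2 * `|x|.
Proof.
rewrite /bU; case: ifPn => // h.
rewrite -(real_normK (num_real y)) -(real_normK (num_real x)).
by have := normr_ge0 x; have := normr_ge0 y; nra.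
Qed.

Lemma bU_ge x y : - 2 * `|x| <= bU x y.
Proof.
rewrite /bU; case: ifPn => [h|_]; last lra.
rewrite -(real_normK (num_real y)) -(real_normK (num_real x)).
by have := normr_ge0 x; have := normr_ge0 y; nra.
Qed.

Lemma bU_ge1 x y : 1 <= `|y| -> 1 - 2 * `|x| <= bU x y.
Proof.
move=> y1; rewrite /bU; case: ifPn => [h|_//].
rewrite -(real_normK (num_real y)) -(real_normK (num_real x)).
by have := normr_ge0 x; nra.
Qed.

(** Concavity along directions with [|k| <= |h|]. In the region [|x| + |y| <= 1] the second-order
    term is [k ^+ 2 - h ^+ 2 <= 0]; outside it, [1 - 2 * |x|] is concave and dominates [bU]
    everywhere. *)
Lemma bU_step x y h k : `|k| <= `|h| ->
  bU (x + h) (y + k) <= bU x y + bA x y * h + bB x y * k.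
Proof.
move=> kh; have kh2 : k ^+ 2 <= h ^+ 2.
  by rewrite -(real_normK (num_real k)) -(real_normK (num_real h)) lerXn2r ?nnegrE.
have [hin|hout] := boolP (`|x| + `|y| <= 1); last first.
  rewrite /bA /bB {2}/bU (negbTE hout) mul0r addr0.
  apply: (le_trans (bU_le _ _)); case: ifPn => [x0|]; last rewrite -ltNge => x0.
    rewrite (ger0_norm x0); have := ler_norm (x + h); lra.
  rewrite (ltr0_norm x0); have := ler_norm (- (x + h)); rewrite normrN; lra.
rewrite /bA /bB {2}/bU hin /bU; case: ifPn => [h2|].
  nra.
rewrite -ltNge => hout.
(* The step leaves the inner region. Both sides are invariant under changing the signs of [x] and
   [h], so [0 <= x + h] may be assumed. *)
suff H : forall x h, `|x| + `|y| <= 1 -> `|k| <= `|h| -> k ^+ 2 <= h ^+ 2 ->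
    1 < `|x + h| + `|y + k| -> 0 <= x + h ->
    1 - 2 * `|x + h| <= y ^+ 2 - x ^+ 2 + - 2 * x * h + 2 * y * k.
  have [xh|xh] := leP 0 (x + h); first exact: H.
  have := H (- x) (- h); rewrite -opprD !normrN !sqrrN => H'.
  by have := H' hin kh kh2 hout; rewrite oppr_ge0 (ltW xh) => /(_ erefl); lra.
move=> {hout hin kh kh2}{}x {}h hin kh kh2 hout xh0.
rewrite (ger0_norm xh0) in hout *.
have yk : `|y * k| <= `|y| * `|h| by rewrite normrM ler_wpM2l.
have yk' : - (`|y| * `|h|) <= y * k by move: yk; rewrite ler_norml => /andP[].
have [xh1|xh1] := leP (x + h) 1.
  (* Outside the inner region the quadratic branch at the new point dominates [1 - 2 * (x + h)] as
     long as [x + h <= 1]. *)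
  have : (1 - (x + h)) ^+ 2 <= (y + k) ^+ 2.
    rewrite -(real_normK (num_real (y + k))) lerXn2r ?nnegrE//; lra.
  nra.
have xn := ler_norm x; have yn := normr_ge0 y.
have h0 : 0 < h by lra.
rewrite (gtr0_norm h0) in yk'.
have y2 := real_normK (num_real y); rewrite -y2.
set a := `|y| in hin yk' yn y2 *.
have ab : a <= 1 - x by lra.
have hb : 1 - x <= h by lra.
(* This product is the difference of the two sides once [y * k] is replaced by its lower bound
   [- a * h]; both factors are nonnegative because [a <= 1 - x <= h]. *)
suff : 0 <= (1 - x - a) * (2 * h - a - (1 - x)) by nra.
apply: mulr_ge0; lra.
Qed.

Lemma measurable_norm_sum_le1 :
  measurable_fun setT (fun p : R * R => `|p.1| + `|p.2| <= 1).
Proof.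
apply: measurable_fun_ler => //; apply: measurable_funD.
  by apply: (measurableT_comp (@normr_measurable R setT)); exact: measurable_fst.
by apply: (measurableT_comp (@normr_measurable R setT)); exact: measurable_snd.
Qed.

Lemma measurable_bA : measurable_fun setT (fun p : R * R => bA p.1 p.2).
Proof.
apply: measurable_fun_ifT; first exact: measurable_norm_sum_le1.
  by apply: measurable_funM => //; exact: measurable_fst.
apply: measurable_funM => //; apply: measurable_fun_ifT => //.
by apply: measurable_fun_ler => //; exact: measurable_fst.
Qed.

Lemma measurable_bB : measurable_fun setT (fun p : R * R => bB p.1 p.2).
Proof.
apply: measurable_fun_ifT; first exact: measurable_norm_sum_le1.
  by apply: measurable_funM => //; exact: measurable_snd.
exact: measurable_cst.
Qed.

Lemma bA_bound x y : `|bA x y| <= 2.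
Proof.
rewrite /bA; case: ifPn => h.
  by rewrite normrM normrN (@ger0_norm _ 2)//; have := normr_ge0 y; lra.
by case: ifPn => _; rewrite normrM normrN ?normrN normr1 mulr1 ger0_norm.
Qed.

Lemma bB_bound x y : `|bB x y| <= 2.
Proof.
rewrite /bB; case: ifPn => h; last by rewrite normr0.
by rewrite normrM ger0_norm//; have := normr_ge0 x; lra.
Qed.

End Burkholder.

(** * Martingale increments against bounded weights known at the start *)

Section Orthogonality.
Context {d : measure_display} {Omega : measurableType d} {R : realType}.
Variable P : probability Omega R.
Implicit Types (D h : Omega -> R).

Lemma integrable_measurable D : P.-integrable setT (EFin \o D) -> measurable_fun setT D.
Proof. by move=> /measurable_int /measurable_EFinP. Qed.

Lemma bounded_mul_integrable h D C : measurable_fun setT h -> (forall w, `|h w| <= C) ->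
  P.-integrable setT (EFin \o D) -> P.-integrable setT (fun w => (h w * D w)%:E).
Proof.
move=> mh hC iD; apply: (le_integrable measurableT _ _ (integrableZl measurableT C iD)).
  by apply/measurable_EFinP; apply: measurable_funM => //; exact: integrable_measurable.
move=> w _ /=; rewrite lee_fin !normrM ler_wpM2r//.
exact: le_trans (hC w) (ler_norm _).
Qed.

Lemma integral_indic_mul D A : measurable A ->
  (\int[P]_w (\1_A w * D w)%:E = \int[P]_(w in A) (D w)%:E)%E.
Proof.
move=> mA; rewrite [RHS]integral_mkcond; apply: eq_integral => w _.
by rewrite patchE indicE; case: ifP => _; rewrite ?mul1r ?mul0r.
Qed.

Lemma integral_step_mul D m (c : nat -> R) (A : nat -> set Omega) :
  P.-integrable setT (EFin \o D) -> (forall i, measurable (A i)) ->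
  (forall i, \int[P]_(w in A i) (D w)%:E = 0)%E ->
  (\int[P]_w ((\sum_(i < m) c i * \1_(A i) w) * D w)%:E = 0)%E.
Proof.
move=> iD mA A0.
have H : (fun w => ((\sum_(i < m) c i * \1_(A i) w) * D w)%:E) =
    (fun w => \sum_(i < m) (c i)%:E * (\1_(A i) w * D w)%:E)%E.
  apply/funext => w; rewrite mulr_suml -sumEFin; apply: eq_bigr => i _.
  by rewrite -mulrA EFinM.
have iA i : P.-integrable setT (fun w => (\1_(A i) w * D w)%:E).
  apply: (@bounded_mul_integrable _ _ 1) => // w.
  by rewrite indicE; case: (_ \in _); rewrite ?normr1 ?normr0.
rewrite H integral_sum//; last by move=> i; exact: integrableZl.
by rewrite big1// => i _; rewrite integralZl// integral_indic_mul// A0 mule0.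
Qed.

(** Conditional expectation is given through integrals over sets of [G], so [h] is quantised at mesh
    [1 / n.+1]; the step part integrates to zero and the error is at most the mesh times the [L^1]
    norm of [D]. *)
Lemma integral_orth D h C (G : set (set Omega)) : sigma_algebra setT G -> G `<=` measurable ->
  P.-integrable setT (EFin \o D) ->
  (forall A, G A -> \int[P]_(w in A) (D w)%:E = 0)%E ->
  Fmeas G h -> (forall w, `|h w| <= C) -> (\int[P]_w (h w * D w)%:E = 0)%E.
Proof.
move=> sG Gm iD D0 Gh hC.
have mh : measurable_fun setT h by apply/Fmeas_measurable; exact: Fmeas_sub Gh.
have mD := integrable_measurable iD.
have iabs := integrable_abse iD.
pose K := fine (\int[P]_w (`|D w|)%:E)%E.
have KE : (\int[P]_w (`|D w|)%:E = K%:E)%E.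
  by rewrite fineK//; exact: (integrable_fin_num measurableT iabs).
have K0 : 0 <= K by rewrite fine_ge0// integral_ge0.
have key n : (`| \int[P]_w (h w * D w)%:E | <= (n.+1%:R^-1 * K)%:E)%E.
  (* The shift by [C] makes [q] nonnegative and the scaling turns the levels into unit intervals, so
     [Num.truncn] indexes them. *)
  pose q (w : Omega) := (h w + C) * n.+1%:R.
  have q0 w : 0 <= q w.
    by rewrite mulr_ge0//; have := hC w; rewrite ler_norml => /andP[]; lra.
  pose A i := [set w | i%:R <= q w < i.+1%:R].
  have GA i : G (A i).
    rewrite (_ : A i = q @^-1` `[i%:R, i.+1%:R[%classic); last first.
      by apply/seteqP; split => w /=; rewrite in_itv.
    have : Fmeas G q.
      apply: (Fmeas_comp (f := h) (g := fun x => (x + C) * n.+1%:R) sG) => //.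
      by apply: measurable_funM => //; exact: measurable_funD.
    by apply; exact: measurable_itv.
  pose m := (Num.truncn (2 * C * n.+1%:R)).+1.
  pose z w := \sum_(i < m) (i%:R / n.+1%:R - C) * \1_(A i) w.
  have zE w : z w = (Num.truncn (q w))%:R / n.+1%:R - C.
    have C0 : 0 <= C := le_trans (normr_ge0 _) (hC w).
    have qm : (Num.truncn (q w) < m)%N.
      rewrite ltnS truncn_ge_nat ?mulr_ge0 ?C0// (le_trans (y := q w)) ?truncn_le ?q0//.
      by rewrite ler_wpM2r//; have := hC w; rewrite ler_norml => /andP[]; lra.
    rewrite /z (bigD1 (Ordinal qm))//= big1 ?addr0.
      by rewrite indicE mem_set ?mulr1//; exact: truncn_itv.
    move=> i; rewrite -val_eqE/= => iq; rewrite indicE memNset ?mulr0// => /truncn_def h1.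
    by rewrite h1 eqxx in iq.
  have hz w : `|h w - z w| <= n.+1%:R^-1.
    have /andP[a b] := truncn_itv (q0 w).
    have n0 : 0 < n.+1%:R :> R by [].
    have -> : h w - z w = (q w - (Num.truncn (q w))%:R) / n.+1%:R.
      by rewrite zE /q mulrBl mulfK ?gt_eqF//; ring.
    rewrite normrM (gtr0_norm (x := _^-1)) ?invr_gt0// ler_piMl ?invr_ge0//.
    rewrite ger0_norm ?subr_ge0// -natr1 in b *; lra.
  have mz : measurable_fun setT z.
    apply: measurable_sum => i; apply: measurable_funM => //.
    by apply: measurable_indic; exact: Gm.
  have z0 : (\int[P]_w (z w * D w)%:E = 0)%E.
    by apply: (@integral_step_mul D m (fun i => i%:R / n.+1%:R - C) A iD) => i; [exact: Gm|exact: D0].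
  have ih : P.-integrable setT (fun w => ((h w - z w) * D w)%:E).
    by apply: bounded_mul_integrable hz iD; exact: measurable_funB.
  have iz : P.-integrable setT (fun w => (z w * D w)%:E).
    apply: (@bounded_mul_integrable _ _ (C + n.+1%:R^-1)) => // w.
    have -> : z w = h w - (h w - z w) by ring.
    by rewrite (le_trans (ler_normB _ _))// lerD.
  have -> : (fun w => (h w * D w)%:E) = (fun w => ((h w - z w) * D w)%:E + (z w * D w)%:E)%E.
    by apply/funext => w; rewrite -EFinD; congr EFin; ring.
  rewrite integralD// z0 adde0.
  apply: (le_trans (le_abse_integral _ measurableT (measurable_int _ ih))).
  rewrite EFinM -KE -integralZl//.
  apply: ge0_le_integral => //.
  - by apply: measurableT_comp => //; exact: (measurable_int _ ih).
  - apply: measurable_funeM; apply/measurable_EFinP.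
    exact: (measurableT_comp (@normr_measurable R setT) mD).
  - by move=> w _; rewrite /= lee_fin normrM ler_wpM2r.
have fin : (\int[P]_w (h w * D w)%:E)%E \is a fin_num.
  exact: (integrable_fin_num measurableT (bounded_mul_integrable mh hC iD)).
rewrite -(fineK fin); congr EFin; apply/eqP; rewrite -normr_le0.
apply/ler_addgt0Pr => e e0; rewrite add0r.
have := key (Num.truncn (K / e)); rewrite -(fineK fin) abse_EFin lee_fin => /le_trans; apply.
have h1 := truncnS_gt (K / e).
rewrite mulrC ler_pdivrMr// mulrC -ler_pdivrMr//; exact: ltW.
Qed.

End Orthogonality.

Section SemimartingaleGood.
Context {d : measure_display} {Omega : measurableType d} {R : realType}.
Variables (P : probability Omega R) (F : R -> set (set Omega)) (T : R).
Hypotheses (T_gt0 : 0 < T) (Ffil : filtration F T).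
Implicit Types (k : simple_integrand F T) (Y Z N M A : R -> Omega -> R).

Let T_ge0 : 0 <= T := ltW T_gt0.

Lemma simple_int_end t r k Y w : is_grid T t r -> compat k t r ->
  simple_int k Y T w = \sum_(l < r) simple_val k (t l.+1) w * (Y (t l.+1) w - Y (t l) w).
Proof.
move=> tg kc; rewrite (simple_int_grid tg _ _ _ kc); apply: eq_bigr => l _.
have /andP[_ h1] := grid_in tg (ltn_ord l); have /andP[_ h2] := grid_in tg (ltnW (ltn_ord l)).
by rewrite (min_r h1) (min_r h2).
Qed.

Lemma martingale_orth N s t h C : martingale P F T N -> 0 <= s -> s <= t -> t <= T ->
  Fmeas (F s) h -> (forall w, `|h w| <= C) ->
  P.-integrable setT (fun w => (h w * (N t w - N s w))%:E) /\
  (\int[P]_w (h w * (N t w - N s w))%:E = 0)%E.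
Proof.
move=> [aN cN] s0 st tT hF hC; have [i1 i2 _ ie] := cN s t s0 st tT.
have sT : 0 <= s <= T by rewrite s0 (le_trans st).
have iD : P.-integrable setT (EFin \o (fun w => N t w - N s w)).
  exact: (integrableB measurableT i1 i2).
split.
  by apply: bounded_mul_integrable hC iD; exact: (Fmeas_meas Ffil sT).
apply: (integral_orth (Fsigma Ffil sT) (Fmeasurable Ffil sT) iD _ hF hC) => A FA.
have mA : measurable A by exact: (Fmeasurable Ffil sT).
under eq_integral do rewrite EFinB.
rewrite integralB_EFin//.
- rewrite ie//; apply: subee; apply: (integrable_fin_num mA).
  exact: (integrableS measurableT mA _ i1).
- exact: (integrableS measurableT mA _ i1).
- exact: (integrableS measurableT mA _ i2).
Qed.

(** Let [x] and [y] be [N] and its transform divided by [c]. [bU] starts at 0 and moves by at most a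
    term of zero mean, while the indicator of [|y| >= 1] is at most [2 * |x| + bU x y]; this gives
    the constant [2 / c]. *)
Lemma martingale_weak N k c : martingale P F T N -> (forall w, N 0 w = 0) -> 0 < c ->
  le_val k (fun _ _ => 1) ->
  (P (gtset (simple_int k N T) c) <= (2 / c)%:E * \int[P]_w (`|N T w|)%:E)%E.
Proof.
move=> mN N0 c0 k1; have [aN cN] := mN.
have [|t [r [tg tp]]] := @grid_exists _ T T_ge0 (ends k); first exact: ends_in.
have kc : compat k t r by exact: compat_ends.
have [t0 tr tm] := tg.
pose x j w := N (t j) w / c; pose y j w := simple_int k N (t j) w / c.
pose u j w := simple_val k (t j.+1) w.
pose xi j w := (bA (x j w) (y j w) + bB (x j w) (y j w) * u j w) / c.
have u1 j w : (j < r)%N -> `|u j w| <= 1 \/ N (t j.+1) w - N (t j) w = 0.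
  move=> jr; have [jp|jn] := ltP 0 (t j.+1).
    by left; apply: k1; rewrite jp/=; case/andP: (grid_in tg jr).
  by right; rewrite (grid_degen tg jn) subrr.
(* The bound on [k] says nothing about the value at time 0, met in degenerate cells. Clipping bounds
   all weights and changes nothing where the increment of [N] is nonzero. *)
pose v j w := Num.max (- 1) (Num.min 1 (u j w)).
pose xi' j w := (bA (x j w) (y j w) + bB (x j w) (y j w) * v j w) / c.
have v1 j w : `|v j w| <= 1.
  by rewrite ler_norml /v le_max lexx/= ge_max ge_min lexx/= andbT; lra.
have vu j w : `|u j w| <= 1 -> v j w = u j w.
  by rewrite ler_norml => /andP[a b]; rewrite /v min_r// max_r.
have step j w : (j < r)%N ->
    bU (x j.+1 w) (y j.+1 w) <= bU (x j w) (y j w) + xi' j w * (N (t j.+1) w - N (t j) w).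
  move=> jr.
  have ye : simple_int k N (t j.+1) w = simple_int k N (t j) w +
      u j w * (N (t j.+1) w - N (t j) w).
    rewrite -(simple_int_incr tg _ _ kc jr (lexx _) (grid_step tg _) (lexx _)).
    by rewrite addrC subrK.
  have xE : x j.+1 w = x j w + (N (t j.+1) w - N (t j) w) / c by rewrite /x; ring.
  have yE : y j.+1 w = y j w + u j w * (N (t j.+1) w - N (t j) w) / c by rewrite /y ye; ring.
  have kh : `|u j w * (N (t j.+1) w - N (t j) w) / c| <= `|(N (t j.+1) w - N (t j) w) / c|.
    case: (u1 j w jr) => [u1w|->]; last by rewrite mulr0 mul0r.
    by rewrite -mulrA normrM ler_piMl.
  rewrite xE yE; apply: (le_trans (bU_step _ _ kh)).
  rewrite le_eqVlt; apply/orP; left; apply/eqP; rewrite /xi'.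
  case: (u1 j w jr) => [u1w|->]; last by ring.
  by rewrite vu//; ring.
have sum_step m w : (m <= r)%N ->
    bU (x m w) (y m w) <= \sum_(j < m) xi' j w * (N (t j.+1) w - N (t j) w).
  elim: m => [|m IH] mr.
    by rewrite big_ord0 /x /y t0 N0 simple_int0 mul0r /bU normr0 addr0 ler01 expr0n/= subr0.
  rewrite big_ord_recr/=; apply: (le_trans (step m w mr)).
  by rewrite lerD2r IH// ltnW.
have xi'F j : (j < r)%N -> Fmeas (F (t j)) (xi' j).
  move=> jr; have tj := grid_in tg (ltnW jr); have sj := Fsigma Ffil tj.
  have xF : Fmeas (F (t j)) (x j).
    by apply: (FmeasM sj); [exact: aN|exact: Fmeas_cst].
  have yF : Fmeas (F (t j)) (y j).
    by apply: (FmeasM sj); [exact: simple_int_Fmeas|exact: Fmeas_cst].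
  apply: (FmeasM sj); last exact: Fmeas_cst.
  apply: (FmeasD sj); first exact: (Fmeas_comp2 sj (measurable_bA) xF yF).
  apply: (FmeasM sj); first exact: (Fmeas_comp2 sj (measurable_bB) xF yF).
  apply: (Fmeas_comp (g := fun z => Num.max (- 1) (Num.min 1 z)) sj).
    apply: measurable_maxr => //.
    by apply: measurable_minr.
  exact: (simple_val_Fmeas Ffil tg kc jr).
have xi'b j w : `|xi' j w| <= 4 / c.
  rewrite /xi' normrM (gtr0_norm (x := c^-1)) ?invr_gt0// ler_wpM2r ?invr_ge0 ?(ltW c0)//.
  rewrite (le_trans (ler_normD _ _))//.
  have h1 := bA_bound (x j w) (y j w).
  have h2 : `|bB (x j w) (y j w) * v j w| <= 2 * 1.
    by rewrite normrM ler_pM// bB_bound.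
  lra.
have orth j : (j < r)%N -> P.-integrable setT (fun w => (xi' j w * (N (t j.+1) w - N (t j) w))%:E) /\
    (\int[P]_w (xi' j w * (N (t j.+1) w - N (t j) w))%:E = 0)%E.
  move=> jr; have /andP[tj0 _] := grid_in tg (ltnW jr); have /andP[_ tjT] := grid_in tg jr.
  exact: martingale_orth mN tj0 (grid_step tg j) tjT (xi'F j jr) (xi'b j).
have [_ iNT _ _] := cN T T T_ge0 (lexx _) (lexx _).
have iaN := integrable_abse iNT.
have mgt : measurable (gtset (simple_int k N T) c).
  by apply: gtset_measurable; apply: (simple_int_meas Ffil) => //; rewrite T_ge0 lexx.
have pw w : \1_(gtset (simple_int k N T) c) w <=
    2 / c * `|N T w| + \sum_(j < r) xi' j w * (N (t j.+1) w - N (t j) w).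
  have h := sum_step r w (leqnn _).
  have xr : `|x r w| = `|N T w| / c.
    by rewrite /x tr normrM (gtr0_norm (x := c^-1)) ?invr_gt0.
  rewrite indicE; case: (boolP (w \in _)) => [/set_mem|] gw.
    have yr : 1 <= `|y r w|.
      rewrite /y tr normrM (gtr0_norm (x := c^-1)) ?invr_gt0// ler_pdivlMr// mul1r.
      exact: ltW.
    have := bU_ge1 (x r w) yr; rewrite xr /=; lra.
  have := bU_ge (x r w) (y r w); rewrite xr /=; lra.
rewrite -[gtset _ _]setIT -integral_indic//.
have iS : P.-integrable setT (fun w => \sum_(j < r) (xi' j w * (N (t j.+1) w - N (t j) w))%:E)%E.
  by apply: (integrable_sum measurableT) => j _; have [] := orth j (ltn_ord j).
have i1 : P.-integrable setT (fun w => (2 / c)%:E * (`|N T w|)%:E)%E by exact: integrableZl.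
apply: (@le_trans _ _ (\int[P]_w ((2 / c)%:E * (`|N T w|)%:E +
    \sum_(j < r) (xi' j w * (N (t j.+1) w - N (t j) w))%:E))%E).
  apply: le_integral => //.
  - exact: integrable_indic.
  - exact: integrableD.
  - by move=> w _; rewrite sumEFin -EFinM -EFinD lee_fin.
rewrite integralD// integralZl// integral_sum//; last first.
  by move=> j; have [] := orth j (ltn_ord j).
rewrite big1 ?adde0// => j _; by have [] := orth j (ltn_ord j).
Qed.

Lemma cadlag_regular Y : adapted F T Y -> cadlag T Y -> regular P F T Y.
Proof.
move=> aY cY; split=> //; apply: aeW => w; have [h1 h2] := cY w; split; first exact/rcontP.
exact: cadlag_bounded01.
Qed.

Lemma local_martingale_good M : local_martingale P F T M -> good P F T M.
Proof.
move=> [aM cM [tau [tst tincr tae tmart]]]; split; first exact: cadlag_regular.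
move=> e e0; have e20 : 0 < e / 2 by lra.
pose B m := [set w | tau m w < T].
have mB m : measurable (B m).
  (* The stopping-time property concerns closed inequalities, so [tau m < T] is reached through a
     countable union. *)
  have -> : B m = \bigcup_n [set w | tau m w <= T - T / n.+1%:R].
    apply/seteqP; split => w; rewrite /B/=; last first.
      move=> [n _ /=] /le_lt_trans; apply; by rewrite gtrBl divr_gt0.
    move=> tT; have tT0 : 0 < T - tau m w by rewrite subr_gt0.
    exists (Num.truncn (T / (T - tau m w))) => //=.
    rewrite lerBrDr -lerBrDl ler_pdivrMr// mulrC -ler_pdivrMr//.
    exact: ltW (truncnS_gt _).
  apply: bigcup_measurable => n _.
  have nT : 0 <= T - T / n.+1%:R <= T.
    rewrite gerBl divr_ge0// andbT subr_ge0 ler_pdivrMr// ler_peMr//.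
    by rewrite ler1n.
  by apply: (Fmeasurable Ffil nT); have [_] := tst m; apply.
have [] := @outer_cont _ _ _ P B (~` [set w | exists m, tau m w = T]) 0 _ e20 mB.
- by move=> m w; rewrite /B/=; apply: le_lt_trans.
- by move=> w Bw /= [m tm]; have := Bw m I; rewrite /B/= tm ltxx.
- exact: outer_negl.
move=> m; rewrite add0r => PB.
pose N := fun t w => M (Num.min t (tau m w)) w - M 0 w.
have N0 w : N 0 w = 0.
  by rewrite /N min_l ?subrr//; have [/(_ w)/andP[]] := tst m.
have [_ cN] := tmart m; have [_ iNT _ _] := cN T T T_ge0 (lexx _) (lexx _).
have fK := integrable_fin_num measurableT (integrable_abse iNT).
set K : \bar R := (\int[P]_w _)%E in fK.
have K0 : 0 <= fine K.
  by apply: fine_ge0; apply: integral_ge0 => w _; exact: abse_ge0.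
(* Chosen so that [2 * K / c <= e / 2]; the summand 1 keeps [c] positive when [K] vanishes. *)
pose c := (4 * fine K + 1) / e.
have c0 : 0 < c by apply: divr_gt0 => //; lra.
exists c => // k k1.
have h := martingale_weak (tmart m) N0 c0 k1.
have {h} : outer_prob_le P (gtset (simple_int k N T) c) (e / 2).
  apply/outer_meas.
    apply: gtset_measurable; apply: (simple_int_meas Ffil); last by rewrite T_ge0 lexx.
    by have [] := tmart m.
  apply: (le_trans h); rewrite -/K -(fineK fK) -EFinM lee_fin.
  rewrite mulrAC ler_pdivrMr// /c mulrA ler_pdivlMr//; nra.
move=> /outerU /(_ PB); rewrite -splitr; apply: outer_sub => w ck.
have [tT|Tt] := ltP (tau m w) T; [by right|left].
rewrite /gtset/= /N simple_intB.
rewrite (_ : simple_int k (fun _ w0 => M 0 w0) T w = 0) ?subr0; last first.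
  by rewrite /simple_int big1// => i _; rewrite subrr mulr0.
rewrite (_ : simple_int k _ T w = simple_int k M T w)//.
apply: (@simple_intY _ _ _ F T) => // x /andP[x0 xT]; by rewrite min_l// (le_trans xT Tt).
Qed.

Lemma variation_sum f t m : t 0%N = 0 -> {homo t : i j / (i <= j)%N >-> i <= j} ->
  ((\sum_(j < m) `|f (t j.+1) - f (t j)|)%:E <= total_variation (0 : R) (t m) f)%E.
Proof.
move=> t0 tm; elim: m => [|m IH].
  by rewrite big_ord0 total_variation_ge0// t0.
have h0 : 0 <= t m by rewrite -t0 tm.
have h1 : t m <= t m.+1 by rewrite tm.
rewrite big_ord_recr/= EFinD (total_variationD f h0 h1).
by apply: leeD => //; exact: total_variation_ge.
Qed.

(** Each path bounds its elementary integrals by its total variation, whose measurability in [w] is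
    not established. Hence the argument by contradiction through measurable events built from
    countably many integrands. *)
Lemma bounded_variation_good A : adapted F T A -> cadlag T A ->
  (forall w, bounded_variation 0 T (A ^~ w)) -> good P F T A.
Proof.
move=> aA cA bA; split; first exact: cadlag_regular.
move=> e e0; apply: contrapT => nex.
have /choice[ks hks] : forall n : nat, exists k, le_val k (fun _ _ => 1) /\
    ~ outer_prob_le P (gtset (simple_int k A T) n.+1%:R) e.
  move=> n; apply: contrapT => h; apply: nex; exists n.+1%:R => // k k1.
  by apply: contrapT => h'; apply: h; exists k.
(* These events decrease to the empty set, since the total variation of the path at [w] is below all
   large [m]. *)
pose U n := \bigcup_(m in [set m | (n <= m)%N]) gtset (simple_int (ks m) A T) m.+1%:R.
have mU n : measurable (U n).
  apply: bigcup_measurable => m _; apply: gtset_measurable.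
  by apply: (simple_int_meas Ffil) => //; rewrite T_ge0 lexx.
have [] := @outer_cont _ _ _ P U set0 0 e e0 mU.
- by move=> n w [m /= nm h]; exists m => //=; exact: ltnW.
- move=> w Uw; have /bounded_variationP - /(_ T_ge0) fTV := bA w.
  pose V := fine (total_variation 0 T (A ^~ w)).
  have V0 : 0 <= V by rewrite fine_ge0// total_variation_ge0.
  have [m /= Vm] := Uw (Num.truncn V) I; rewrite /gtset/=.
  apply/negP; rewrite -leNgt.
  have {Vm} : V <= m.+1%:R.
    by rewrite (le_trans (ltW (truncnS_gt V)))// ler_nat ltnS.
  apply: le_trans; rewrite -lee_fin fineK//.
  have [|t [r [tg tp]]] := @grid_exists _ T T_ge0 (ends (ks m)); first exact: ends_in.
  have kc : compat (ks m) t r by exact: compat_ends.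
  have [t0 tr tm] := tg.
  apply: (@le_trans _ _ (\sum_(j < r) `|A (t j.+1) w - A (t j) w|)%:E); last first.
    by rewrite -[X in total_variation 0 X _]tr; exact: variation_sum.
  rewrite lee_fin.
  rewrite (simple_int_end _ _ tg kc).
  rewrite (le_trans (ler_norm_sum _ _ _))//; apply: ler_sum => j _.
  have [jp|jn] := ltP 0 (t j.+1); last by rewrite (grid_degen tg jn) !subrr mulr0 normr0.
  rewrite normrM ler_piMl//; apply: (hks m).1.
  by rewrite jp/=; case/andP: (grid_in tg (ltn_ord j)).
- by apply: outer_negl => //; exact: negligible_set0.
move=> n; rewrite add0r => h; apply: (hks n).2; apply: outer_sub h.
by move=> w h; exists n => /=.
Qed.

Lemma semimartingale_good Y : semimartingale P F T Y -> good P F T Y.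
Proof.
move=> [aY cY [M [A [lM [aA cA bA] _ eq]]]].
have c0 : good P F T (fun _ => Y 0).
  have rY : regular P F T (fun _ => Y 0).
    have Y0 : Fmeas (F 0) (Y 0) by apply: aY; rewrite lexx.
    exact: (regular_cst P Ffil Y0).
  split=> // e e0; exists 1 => // k _; apply: outer_negl (ltW e0) _.
  apply: negligibleS (negligible_set0 P) => w; rewrite /gtset/= /simple_int big1 ?normr0 ?ltr10//.
  by move=> i _; rewrite subrr mulr0.
have g := goodD Ffil (goodD Ffil c0 (local_martingale_good lM)) (bounded_variation_good aA cA bA).
apply: (good_ae T_gt0 g) => //; apply: filterS eq => w e t tT; exact/esym/e.
Qed.

End SemimartingaleGood.

(** * Products and reciprocals *)

Lemma sum_prod_expand {R : realType} (J y z : nat -> R) r :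
  \sum_(j < r) J j * (y j.+1 * z j.+1 - y j * z j) =
  \sum_(j < r) (J j * y j) * (z j.+1 - z j) + \sum_(j < r) (J j * z j) * (y j.+1 - y j) +
  \sum_(j < r) J j * ((y j.+1 - y j) * (z j.+1 - z j)).
Proof. by rewrite -!big_split/=; apply: eq_bigr => j _; ring. Qed.

Lemma sum_square_expand {R : realType} (y : nat -> R) r :
  \sum_(j < r) (y j.+1 - y j) ^+ 2 =
  y r ^+ 2 - y 0%N ^+ 2 - 2 * \sum_(j < r) y j * (y j.+1 - y j).
Proof.
elim: r => [|r IH]; first by rewrite !big_ord0; ring.
by rewrite !big_ord_recr/= IH; ring.
Qed.

Definition clip1 {R : realType} (x : R) : R := Num.max (- 1) (Num.min 1 x).

Lemma clip1_le {R : realType} (x : R) : `|clip1 x| <= 1.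
Proof. by rewrite ler_norml /clip1 le_max lexx/= ge_max ge_min lexx/= andbT; lra. Qed.

Lemma clip1_id {R : realType} (x : R) : `|x| <= 1 -> clip1 x = x.
Proof. by rewrite ler_norml => /andP[a b]; rewrite /clip1 min_r// max_r. Qed.

Lemma clip1_div {R : realType} (x a : R) : 0 < a -> `|x| <= a -> a * clip1 (x / a) = x.
Proof.
move=> a0 xa; rewrite clip1_id; first by rewrite mulrC divfK// gt_eqF.
by rewrite normrM normfV (gtr0_norm a0) ler_pdivrMr// mul1r.
Qed.

Lemma measurable_clip1 {R : realType} : measurable_fun setT (@clip1 R).
Proof. by apply: measurable_maxr => //; exact: measurable_minr. Qed.

Section Products.
Context {d : measure_display} {Omega : measurableType d} {R : realType}.
Variables (P : probability Omega R) (F : R -> set (set Omega)) (T : R).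
Hypotheses (T_gt0 : 0 < T) (Ffil : filtration F T).
Implicit Types (k : simple_integrand F T) (Y Z X : R -> Omega -> R).

Let T_ge0 : 0 <= T := ltW T_gt0.

Lemma unit_weight_simple t r (u : nat -> Omega -> R) : is_grid T t r ->
  (forall j, (j < r)%N -> Fmeas (F (t j)) (u j)) -> (forall j w, `|u j w| <= 1) ->
  exists2 k : simple_integrand F T, le_val k (fun _ _ => 1) & forall Y w,
    simple_int k Y T w = \sum_(j < r) u j w * (Y (t j.+1) w - Y (t j) w).
Proof.
move=> tg uF u1; have [|k [kc kv ki]] := gsimple_ex tg uF.
  by move=> j _; exists 1.
exists k; first by move=> x w /(grid_locate tg)[j jr jx]; rewrite (kv _ _ _ jr jx).
move=> Y w; rewrite ki; apply: eq_bigr => l _.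
have /andP[_ h1] := grid_in tg (ltn_ord l); have /andP[_ h2] := grid_in tg (ltnW (ltn_ord l)).
by rewrite (min_r h1) (min_r h2).
Qed.

Lemma le_val1 k t w : le_val k (fun _ _ => 1) -> `|simple_val k t w| <= 1.
Proof.
move=> k1; have [tT|tT] := boolP (0 < t <= T); first exact: k1.
by rewrite simple_val_out// normr0.
Qed.

Definition unit_bd Y (c e : R) : Prop := forall k, le_val k (fun _ _ => 1) ->
  outer_prob_le P (gtset (simple_int k Y T) c) e.

Lemma clip_weight t r k Y a : is_grid T t r -> compat k t r -> le_val k (fun _ _ => 1) ->
  adapted F T Y -> exists2 k' : simple_integrand F T, le_val k' (fun _ _ => 1) & forall Z w,
    simple_int k' Z T w = \sum_(j < r) simple_val k (t j.+1) w * clip1 (Y (t j) w / a) *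
      (Z (t j.+1) w - Z (t j) w).
Proof.
move=> tg kc k1 aY.
apply: (unit_weight_simple (u := fun j w => simple_val k (t j.+1) w * clip1 (Y (t j) w / a))) => //.
  move=> j jr; have tj := grid_in tg (ltnW jr); have sj := Fsigma Ffil tj.
  apply: (FmeasM sj); first exact: (simple_val_Fmeas Ffil tg kc jr).
  apply: (Fmeas_comp sj (measurable_clip1)).
  by apply: (FmeasM sj); [exact: aY|exact: Fmeas_cst].
by move=> j w; rewrite normrM mulr_ile1// ?clip1_le// le_val1.
Qed.

Lemma one_simple : exists k, forall (x : R) w, 0 < x <= T -> simple_val k x w = 1.
Proof.
have [|t [r [tg tp]]] := @grid_exists _ T T_ge0 [::]; first by [].
have [||k [kc kv ki]] := @gsimple_ex _ _ _ F T t r tg (fun _ _ => 1).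
- by move=> j jr; apply: Fmeas_cst; apply: (Fsigma Ffil); apply: (grid_in tg); exact: ltnW.
- by move=> j jr; exists 1 => w; rewrite normr1.
by exists k => x w /(grid_locate tg)[j jr jx]; rewrite (kv _ _ _ jr jx).
Qed.

Lemma clip_weight1 t r Y a : is_grid T t r ->
  adapted F T Y -> exists2 k' : simple_integrand F T, le_val k' (fun _ _ => 1) & forall Z w,
    simple_int k' Z T w = \sum_(j < r) clip1 (Y (t j) w / a) * (Z (t j.+1) w - Z (t j) w).
Proof.
move=> tg aY; apply: (unit_weight_simple (u := fun j w => clip1 (Y (t j) w / a))) => //.
  move=> j jr; have tj := grid_in tg (ltnW jr); have sj := Fsigma Ffil tj.
  apply: (Fmeas_comp sj (measurable_clip1)).
  by apply: (FmeasM sj); [exact: aY|exact: Fmeas_cst].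
by move=> j w; exact: clip1_le.
Qed.

Lemma gtsetC (f : Omega -> R) c w : ~ gtset f c w -> `|f w| <= c.
Proof. by move=> /negP; rewrite -leNgt. Qed.

Lemma supgtC Y c w : ~ supgt T Y c w -> forall t, 0 <= t <= T -> `|Y t w| <= c.
Proof.
by move=> h t tT; rewrite leNgt; apply/negP => ct; apply: h; exists t.
Qed.

(** Discrete integration by parts: two integrals with clipped weights plus a bracket, bounded by the
    two quadratic variations. The weight [l] balances these: 1 suffices for [goodM], while
    [small_mul] takes it large so that a small [Y] absorbs the factor. *)
Lemma unit_bdM Y Z aY aZ cY cZ e1 e2 e3 e4 l :
  adapted F T Y -> adapted F T Z -> 0 < aY -> 0 < aZ -> 0 < l ->
  outer_prob_le P (supgt T Y aY) e1 -> outer_prob_le P (supgt T Z aZ) e2 ->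
  unit_bd Y cY e3 -> unit_bd Z cZ e4 ->
  unit_bd (fun t w => Y t w * Z t w)
    (aY * cZ + aZ * cY + (l * (aY ^+ 2 + 2 * aY * cY) + (aZ ^+ 2 + 2 * aZ * cZ) / l) / 2)
    (e1 + e2 + (e3 + e3) + (e4 + e4)).
Proof.
move=> aadY aadZ aY0 aZ0 l0 sY sZ bY bZ k k1.
have [|t [r [tg tp]]] := @grid_exists _ T T_ge0 (ends k); first exact: ends_in.
have kc : compat k t r by exact: compat_ends.
have [t0 tr tm] := tg.
have [k1' k1'1 k1'E] := clip_weight aY tg kc k1 aadY.
have [k2' k2'1 k2'E] := clip_weight aZ tg kc k1 aadZ.
have [k3' k3'1 k3'E] := clip_weight1 aY tg aadY.
have [k4' k4'1 k4'E] := clip_weight1 aZ tg aadZ.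
have := outerU (outerU (outerU sY sZ) (outerU (bY _ k2'1) (bY _ k3'1)))
   (outerU (bZ _ k1'1) (bZ _ k4'1)).
apply: outer_sub => w; apply: contraPP => /not_orP[/not_orP[/not_orP[h1 h2] /not_orP[h3 h4]] /not_orP[h5 h6]].
apply/negP; rewrite -leNgt.
have {}h1 := supgtC h1; have {}h2 := supgtC h2.
have {}h3 := gtsetC h3; have {}h4 := gtsetC h4; have {}h5 := gtsetC h5; have {}h6 := gtsetC h6.
pose y j := Y (t j) w; pose z j := Z (t j) w; pose J j := simple_val k (t j.+1) w.
have J1 j : `|J j| <= 1 by exact: le_val1.
have yb j : (j <= r)%N -> `|y j| <= aY by move=> jr; apply: h1; exact: (grid_in tg).
have zb j : (j <= r)%N -> `|z j| <= aZ by move=> jr; apply: h2; exact: (grid_in tg).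
rewrite (simple_int_end _ _ tg kc) (sum_prod_expand J y z).
have S1 : `|\sum_(j < r) J j * y j * (z j.+1 - z j)| <= aY * cZ.
  have -> : \sum_(j < r) J j * y j * (z j.+1 - z j) = aY * simple_int k1' Z T w.
    rewrite k1'E mulr_sumr; apply: eq_bigr => j _.
    by rewrite -{1}(clip1_div aY0 (yb j (ltnW (ltn_ord j)))) /J /y /z; ring.
  by rewrite normrM (gtr0_norm aY0) ler_wpM2l// ltW.
have S2 : `|\sum_(j < r) J j * z j * (y j.+1 - y j)| <= aZ * cY.
  have -> : \sum_(j < r) J j * z j * (y j.+1 - y j) = aZ * simple_int k2' Y T w.
    rewrite k2'E mulr_sumr; apply: eq_bigr => j _.
    by rewrite -{1}(clip1_div aZ0 (zb j (ltnW (ltn_ord j)))) /J /y /z; ring.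
  by rewrite normrM (gtr0_norm aZ0) ler_wpM2l// ltW.
(* Quadratic variation is the change of the square minus twice the integral of [Y] against itself;
   clipping makes that integral one with a unit weight. *)
have Q1 : \sum_(j < r) (y j.+1 - y j) ^+ 2 <= aY ^+ 2 + 2 * aY * cY.
  rewrite sum_square_expand.
  have -> : \sum_(j < r) y j * (y j.+1 - y j) = aY * simple_int k3' Y T w.
    rewrite k3'E mulr_sumr; apply: eq_bigr => j _.
    by rewrite -{1}(clip1_div aY0 (yb j (ltnW (ltn_ord j)))) /y; ring.
  have h7 := yb r (leqnn _); have h8 : y r ^+ 2 <= aY ^+ 2.
    by rewrite -(real_normK (num_real (y r))) lerXn2r ?nnegrE// ltW.
  have h9 := sqr_ge0 (y 0%N).
  have : - (aY * simple_int k3' Y T w) <= aY * cY.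
    by rewrite -mulrN ler_wpM2l ?(ltW aY0)//; move: h4; rewrite ler_norml => /andP[]; lra.
  lra.
have Q2 : \sum_(j < r) (z j.+1 - z j) ^+ 2 <= aZ ^+ 2 + 2 * aZ * cZ.
  rewrite sum_square_expand.
  have -> : \sum_(j < r) z j * (z j.+1 - z j) = aZ * simple_int k4' Z T w.
    rewrite k4'E mulr_sumr; apply: eq_bigr => j _.
    by rewrite -{1}(clip1_div aZ0 (zb j (ltnW (ltn_ord j)))) /z; ring.
  have h7 := zb r (leqnn _); have h8 : z r ^+ 2 <= aZ ^+ 2.
    by rewrite -(real_normK (num_real (z r))) lerXn2r ?nnegrE// ltW.
  have h9 := sqr_ge0 (z 0%N).
  have : - (aZ * simple_int k4' Z T w) <= aZ * cZ.
    by rewrite -mulrN ler_wpM2l ?(ltW aZ0)//; move: h6; rewrite ler_norml => /andP[]; lra.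
  lra.
have S3 : `|\sum_(j < r) J j * ((y j.+1 - y j) * (z j.+1 - z j))| <=
    (l * \sum_(j < r) (y j.+1 - y j) ^+ 2 + (\sum_(j < r) (z j.+1 - z j) ^+ 2) / l) / 2.
  rewrite (le_trans (ler_norm_sum _ _ _))//.
  rewrite mulr_sumr mulr_suml -big_split/= mulr_suml; apply: ler_sum => j _.
  rewrite normrM (le_trans (ler_piMl (normr_ge0 _) (J1 j)))//.
  set a := y j.+1 - y j; set b := z j.+1 - z j.
  have ll : l * l^-1 = 1 by rewrite divff// gt_eqF.
  have li : 0 < l^-1 by rewrite invr_gt0.
  have e1' : 0 <= l^-1 * (l * a - b) ^+ 2 by rewrite mulr_ge0 ?sqr_ge0 ?(ltW li).
  have e2' : 0 <= l^-1 * (l * a + b) ^+ 2 by rewrite mulr_ge0 ?sqr_ge0 ?(ltW li).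
  have E1 : l^-1 * (l * a - b) ^+ 2 = (l * l^-1) * (l * a ^+ 2) - 2 * (l * l^-1) * (a * b) + b ^+ 2 / l by ring.
  have E2 : l^-1 * (l * a + b) ^+ 2 = (l * l^-1) * (l * a ^+ 2) + 2 * (l * l^-1) * (a * b) + b ^+ 2 / l by ring.
  rewrite E1 in e1'; rewrite E2 in e2'; rewrite ll !mul1r !mulr1 in e1' e2'.
  by rewrite ler_norml; apply/andP; split; lra.
have li : 0 < l^-1 by rewrite invr_gt0.
have S4 : (l * \sum_(j < r) (y j.+1 - y j) ^+ 2 + (\sum_(j < r) (z j.+1 - z j) ^+ 2) / l) / 2 <=
   (l * (aY ^+ 2 + 2 * aY * cY) + (aZ ^+ 2 + 2 * aZ * cZ) / l) / 2.
  by rewrite ler_wpM2r// lerD// ?ler_wpM2l ?ler_wpM2r// ltW.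
apply: (le_trans (ler_normD _ _)); apply: lerD; last exact: le_trans S4.
by apply: (le_trans (ler_normD _ _)); exact: lerD.
Qed.

Lemma goodM Y Z : good P F T Y -> good P F T Z -> good P F T (fun t w => Y t w * Z t w).
Proof.
(* Six exceptional events are paid for: two amplitudes and two integrals against each factor. *)
move=> gY gZ; have [rY bY] := gY; have [rZ bZ] := gZ; split; first exact: regularM.
move=> e e0; have e60 : 0 < e / 6 by lra.
have [aY aY0 hY] := regular_amp T_gt0 Ffil rY e60.
have [aZ aZ0 hZ] := regular_amp T_gt0 Ffil rZ e60.
have [cY cY0 hcY] := bY _ e60; have [cZ cZ0 hcZ] := bZ _ e60.
have h := unit_bdM rY.1 rZ.1 aY0 aZ0 ltr01 hY hZ hcY hcZ.
eexists; last first.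
  by move=> k k1; apply: outer_le (h k k1); lra.
rewrite ltr_wpDr ?addr_gt0 ?mulr_gt0// divr_ge0// addr_ge0// mulr_ge0 ?invr_ge0// addr_ge0 ?sqr_ge0 ?mulr_ge0 ?(ltW aY0) ?(ltW cY0) ?(ltW aZ0) ?(ltW cZ0)//.
Qed.

(** For [y = 1 / x] the increment is exactly [- y ^+ 2 * dx + y ^+ 2 * y' * dx ^+ 2], with [y'] the
    new value. The first term is an integral with clipped weight, the second is controlled by the
    quadratic variation of [X]. *)
Lemma goodV X Y : good P F T X -> adapted F T Y ->
  {ae P, forall w, (forall t, 0 <= t <= T -> X t w != 0 /\ Y t w = (X t w)^-1) /\ bounded01 T (Y ^~ w)} ->
  good P F T Y.
Proof.
move=> gX aY hXY; have [rX bX] := gX.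
have rY : regular P F T Y.
  split=> //; apply: filterS2 hXY rX.2 => w [h b] [rc _]; split=> //.
  have xc : rcont T (fun t => (X t w)^-1).
    by apply: rcontV => // t /andP[t0 tT]; apply: (h t _).1; rewrite t0 ltW.
  by apply: eq_rcont xc => t tT; rewrite (h t tT).2.
split=> // e e0; have e60 : 0 < e / 6 by lra.
have [aX aX0 hX] := regular_amp T_gt0 Ffil rX e60.
have [b b0 hY] := regular_amp T_gt0 Ffil rY e60.
have [c c0 hc] := bX _ e60.
exists (b ^+ 2 * c + b ^+ 3 * (aX ^+ 2 + 2 * aX * c)).
  rewrite ltr_pwDl ?mulr_gt0 ?exprn_gt0// mulr_ge0 ?exprn_ge0 ?(ltW b0)//.
  by rewrite addr_ge0 ?sqr_ge0 ?mulr_ge0 ?(ltW aX0) ?(ltW c0).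
move=> k k1.
have [|t [r [tg tp]]] := @grid_exists _ T T_ge0 (ends k); first exact: ends_in.
have kc : compat k t r by exact: compat_ends.
have [k1' k1'1 k1'E] : exists2 k' : simple_integrand F T, le_val k' (fun _ _ => 1) & forall Z w,
    simple_int k' Z T w = \sum_(j < r) simple_val k (t j.+1) w * clip1 (Y (t j) w / b) *
      clip1 (Y (t j) w / b) * (Z (t j.+1) w - Z (t j) w).
  apply: (unit_weight_simple (u := fun j w => simple_val k (t j.+1) w * clip1 (Y (t j) w / b) * clip1 (Y (t j) w / b))) => //.
    move=> j jr; have tj := grid_in tg (ltnW jr); have sj := Fsigma Ffil tj.
    have cl : Fmeas (F (t j)) (fun w => clip1 (Y (t j) w / b)).
      apply: (Fmeas_comp sj (measurable_clip1)).
      by apply: (FmeasM sj); [exact: aY|exact: Fmeas_cst].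
    by apply: (FmeasM sj) => //; apply: (FmeasM sj) => //; exact: (simple_val_Fmeas Ffil tg kc jr).
  move=> j w; rewrite normrM mulr_ile1// ?clip1_le//.
  by rewrite normrM mulr_ile1// ?clip1_le// le_val1.
have [k3' k3'1 k3'E] := clip_weight1 aX tg rX.1.
have H := outerU (outerU hX hY) (outerU (hc _ k1'1) (hc _ k3'1)).
apply: (@outer_le _ _ _ _ _ (e / 6 + e / 6 + (e / 6 + e / 6))); first lra.
apply: outer_aesub H; apply: filterS hXY => w [hw _].
apply: contraPP => /not_orP[/not_orP[h1 h2] /not_orP[h3 h4]].
apply/negP; rewrite -leNgt.
have {}h1 := supgtC h1; have {}h2 := supgtC h2.
have {}h3 := gtsetC h3; have {}h4 := gtsetC h4.
pose y j := Y (t j) w; pose x j := X (t j) w; pose J j := simple_val k (t j.+1) w.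
have J1 j : `|J j| <= 1 by exact: le_val1.
have yb j : (j <= r)%N -> `|y j| <= b by move=> jr; apply: h2; exact: (grid_in tg).
have xb j : (j <= r)%N -> `|x j| <= aX by move=> jr; apply: h1; exact: (grid_in tg).
have Q1 : \sum_(j < r) (x j.+1 - x j) ^+ 2 <= aX ^+ 2 + 2 * aX * c.
  rewrite sum_square_expand.
  have -> : \sum_(j < r) x j * (x j.+1 - x j) = aX * simple_int k3' X T w.
    rewrite k3'E mulr_sumr; apply: eq_bigr => j _.
    by rewrite -{1}(clip1_div aX0 (xb j (ltnW (ltn_ord j)))) /x; ring.
  have h7 := xb r (leqnn _); have h8 : x r ^+ 2 <= aX ^+ 2.
    by rewrite -(real_normK (num_real (x r))) lerXn2r ?nnegrE// ltW.
  have h9 := sqr_ge0 (x 0%N).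
  have : - (aX * simple_int k3' X T w) <= aX * c.
    by rewrite -mulrN ler_wpM2l ?(ltW aX0)//; move: h4; rewrite ler_norml => /andP[]; lra.
  lra.
rewrite (simple_int_end _ _ tg kc).
have -> : \sum_(j < r) J j * (y j.+1 - y j) = - (b ^+ 2 * simple_int k1' X T w) +
    \sum_(j < r) J j * (y j ^+ 2 * y j.+1 * (x j.+1 - x j) ^+ 2).
  rewrite k1'E mulr_sumr -sumrN -big_split/=; apply: eq_bigr => j _.
  have yE : y j = b * clip1 (Y (t j) w / b).
    by rewrite (clip1_div b0 (yb j (ltnW (ltn_ord j)))).
  have -> : b ^+ 2 * (simple_val k (t j.+1) w * clip1 (Y (t j) w / b) * clip1 (Y (t j) w / b) *
     (X (t j.+1) w - X (t j) w)) = J j * (b * clip1 (Y (t j) w / b)) ^+ 2 * (x j.+1 - x j).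
    by rewrite /J /x; ring.
  rewrite -yE.
  have [x0 yx0] := hw _ (grid_in tg (ltnW (ltn_ord j))).
  have [x1 yx1] := hw _ (grid_in tg (ltn_ord j)).
  by rewrite /y yx0 yx1 /x; field; rewrite x0 x1.
apply: (le_trans (ler_normD _ _)); apply: lerD.
  by rewrite normrN normrM ger0_norm ?sqr_ge0// ler_wpM2l ?sqr_ge0.
apply: (@le_trans _ _ (b ^+ 3 * \sum_(j < r) (x j.+1 - x j) ^+ 2)); last first.
  by rewrite ler_wpM2l// exprn_ge0 ?ltW.
rewrite (le_trans (ler_norm_sum _ _ _))// mulr_sumr; apply: ler_sum => j _.
rewrite normrM (le_trans (ler_piMl (normr_ge0 _) (J1 j)))//.
rewrite normrM (ger0_norm (sqr_ge0 _)) ler_wpM2r ?sqr_ge0//.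
rewrite normrM normrX [b ^+ 3]exprSr; apply: ler_pM; rewrite ?exprn_ge0//.
  by rewrite lerXn2r ?nnegrE ?(ltW b0)// yb// ltnW// ltn_ord.
by apply: yb; exact: ltn_ord.
Qed.

End Products.

(** * Exhaustive submeasures *)

Lemma sum_geo_le {R : realType} (a : R) n : 0 <= a -> \sum_(k < n) a / 2 ^+ k.+1 <= a.
Proof.
move=> a0; suff -> : \sum_(k < n) a / 2 ^+ k.+1 = a - a / 2 ^+ n.
  by rewrite gerBl divr_ge0// exprn_ge0.
elim: n => [|n IH]; first by rewrite big_ord0 expr0 divr1 subrr.
by rewrite big_ord_recr/= IH exprS; field; rewrite expf_neq0.
Qed.

Lemma increasing_subseq (f : nat -> nat) : (forall N, (N <= f N)%N) ->
  exists t : nat -> nat, forall j l, (j < l)%N -> (f (t j) < f (t l))%N.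
Proof.
move=> hf; pose t := fix t j := if j is j'.+1 then (f (t j')).+1 else 0%N.
exists t => j; elim=> // l IH; rewrite ltnS leq_eqVlt => /orP[/eqP->|/IH h].
  exact: (hf (t l.+1)).
by apply: (ltn_trans h); exact: (hf (t l.+1)).
Qed.

Section Submeasure.
Context {X : Type} {R : realType}.
(** [phi D a] reads: the size of [D] is at most [a]. The relational form spares a real-valued
    supremum of outer probabilities over integrands. *)
Variables (A : set (set X)) (phi : set X -> R -> Prop).
Hypotheses (A0 : A set0)
  (AU : forall D E, A D -> A E -> A (D `|` E))
  (AD : forall D E, A D -> A E -> A (D `\` E))
  (phi_le : forall D a b, a <= b -> phi D a -> phi D b)
  (phi0 : forall a, 0 <= a -> phi set0 a)
  (phiU : forall D E a b, A D -> A E -> phi D a -> phi E b -> phi (D `|` E) (a + b))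
  (phi_exh : forall D : nat -> set X, (forall n, A (D n)) -> trivIset setT D ->
     forall a, 0 < a -> exists n, phi (D n) a).
Implicit Types (D E : set X) (a b : R).

(** The outer extension of [phi] to arbitrary sets. The covering sets increase and each has size at
    most [a], so no countable subadditivity of [phi] is presupposed. *)
Definition cov E a : Prop := exists D : nat -> set X,
  [/\ forall n, A (D n), forall n, D n `<=` D n.+1, forall n, phi (D n) a & E `<=` \bigcup_n D n].

Definition ubig (D : nat -> set X) (n : nat) : set X := \bigcup_(k in [set k | (k < n)%N]) D k.

Lemma ubigS (D : nat -> set X) n : ubig D n.+1 = ubig D n `|` D n.
Proof.
apply/seteqP; split => x.
  move=> [k /=]; rewrite ltnS leq_eqVlt => /orP[/eqP->|kn] Dx; [by right|by left; exists k].
by move=> [[k /= kn] Dx|Dx]; [exists k => //=; exact: ltnW|exists n => /=].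
Qed.

Lemma ubig0 (D : nat -> set X) : ubig D 0 = set0.
Proof. by apply/seteqP; split => x // [k]. Qed.

Lemma A_ubig (D : nat -> set X) n : (forall k, A (D k)) -> A (ubig D n).
Proof. by move=> h; elim: n => [|n IH]; rewrite ?ubig0// ubigS; exact: AU. Qed.

Lemma phi_ubig (D : nat -> set X) (a : nat -> R) n : (forall k, A (D k)) -> (forall k, phi (D k) (a k)) ->
  phi (ubig D n) (\sum_(k < n) a k).
Proof.
move=> h ha; elim: n => [|n IH]; first by rewrite ubig0 big_ord0; exact: phi0.
by rewrite ubigS big_ord_recr/=; apply: phiU => //; exact: A_ubig.
Qed.

Lemma incr_le (D : nat -> set X) : (forall n, D n `<=` D n.+1) ->
  forall n m, (n <= m)%N -> D n `<=` D m.
Proof.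
move=> h n m /subnK <-; elim: (m - n)%N => [//|l IH].
by rewrite addSn; exact: subset_trans (h _).
Qed.

(** Otherwise infinitely many successive differences, pairwise disjoint, would all have size beyond
    [a]. *)
Lemma exh_incr (D : nat -> set X) a : (forall n, A (D n)) -> (forall n, D n `<=` D n.+1) ->
  0 < a -> exists N, forall m, (N <= m)%N -> phi (D m `\` D N) a.
Proof.
move=> AD' Di a0; apply: contrapT => nex.
have /choice[f hf] : forall N, exists m, (N <= m)%N /\ ~ phi (D m `\` D N) a.
  move=> N; apply: contrapT => h; apply: nex; exists N => m Nm.
  by apply: contrapT => h'; apply: h; exists m.
pose s := fix s k := if k is k'.+1 then f (s k') else 0%N.
have smono i j : (i <= j)%N -> (s i <= s j)%N.
  move=> /subnK <-; elim: (j - i)%N => [//|l IH].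
  by rewrite addSn /=; exact: leq_trans IH (hf _).1.
have [||n] := phi_exh (D := fun k => D (s k.+1) `\` D (s k)) _ _ a0; last exact: (hf (s n)).2.
  by move=> n; exact: AD.
have H i j x : (i < j)%N -> (D (s i.+1) `\` D (s i)) x -> ~ (D (s j.+1) `\` D (s j)) x.
  by move=> ij [h1 _] [_]; apply; apply: incr_le h1 => //; exact: smono.
apply/trivIsetP => i j _ _ ij; rewrite -subset0 => x [h1 h2].
move: ij; rewrite neq_ltn => /orP[ij|ij]; first exact: (H _ _ _ ij h1 h2).
exact: (H _ _ _ ij h2 h1).
Qed.

Lemma cov_sub D E a : D `<=` E -> cov E a -> cov D a.
Proof. by move=> DE [F [h1 h2 h3 h4]]; exists F; split=> //; exact: subset_trans h4. Qed.

Lemma cov_le E a b : a <= b -> cov E a -> cov E b.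
Proof. by move=> ab [F [h1 h2 h3 h4]]; exists F; split=> // n; exact: phi_le (h3 n). Qed.

Lemma phi_cov D a : A D -> phi D a -> cov D a.
Proof. by move=> AD' h; exists (fun=> D); split; [by move=> n|by move=> n x|by move=> n|by move=> x Dx; exists 0%N]. Qed.

Lemma cov_bigcup (E : nat -> set X) (a : nat -> R) b : (forall k, cov (E k) (a k)) ->
  (forall n, \sum_(k < n) a k <= b) -> cov (\bigcup_k E k) b.
Proof.
move=> /choice[D hD] ab.
have hA k n : A (D k n) by have [] := hD k.
have hi k n : D k n `<=` D k n.+1 by have [_ + _ _] := hD k; apply.
exists (fun n => ubig (D ^~ n) n); split.
- by move=> n; exact: A_ubig.
- move=> n x [k /= kn Dx]; exists k => /=; first exact: ltnW.
  exact: hi.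
- move=> n; apply: phi_le (ab n) _; apply: phi_ubig => // k; by have [_ _ + _] := hD k; apply.
- move=> x [k _ Ex]; have [_ _ _ h4] := hD k; have [n _ Dx] := h4 _ Ex.
  exists (maxn n k.+1) => //; exists k => /=; first by rewrite leq_max ltnSn orbT.
  by apply: (incr_le (hi k)) Dx; exact: leq_maxl.
Qed.

Lemma covU D E a b : cov D a -> cov E b -> cov (D `|` E) (a + b).
Proof.
move=> [D' [h1 h2 h3 h4]] [E' [g1 g2 g3 g4]]; exists (fun n => D' n `|` E' n); split.
- by move=> n; exact: AU.
- by move=> n; exact: setUSS.
- by move=> n; exact: phiU.
- move=> x [/h4[n _ hx]|/g4[n _ hx]]; exists n => //; [by left|by right].
Qed.

Definition symd D E : set X := (D `\` E) `|` (E `\` D).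

(** The completion of the algebra for the pseudo-distance given by the size of symmetric
    differences. *)
Definition meas E : Prop := forall a, 0 < a -> exists2 D, A D & cov (symd E D) a.

Lemma meas_A D : A D -> meas D.
Proof.
move=> AD' a a0; exists D => //; rewrite /symd setDv setU0.
by apply: phi_cov => //; apply: phi0; exact: ltW.
Qed.

Lemma measD E F : meas E -> meas F -> meas (E `\` F).
Proof.
move=> mE mF a a0; have a20 : 0 < a / 2 by lra.
have [D AD' hD] := mE _ a20; have [D2 AD2 hD2] := mF _ a20.
exists (D `\` D2); first exact: AD.
apply: cov_sub (cov_le _ (covU hD hD2)); last lra.
move=> x [[[Ex nFx] nD]|[[Dx nD2] nE]].
  have [Dx|nDx] := pselect (D x); last by left; left.
  by right; right; split=> //; apply: contrapT => nD2x; apply: nD.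
have [Ex|nEx] := pselect (E x); last by left; right.
by right; left; split=> //; apply: contrapT => nFx; apply: nE.
Qed.

(** Approximation errors are summed geometrically; exhaustivity then makes a finite union of the
    approximants nearly exhaust the countable one. *)
Lemma meas_bigcup (E : nat -> set X) : (forall n, meas (E n)) -> meas (\bigcup_n E n).
Proof.
move=> mE a a0; have a20 : 0 < a / 2 by lra.
have /choice[D hD] : forall n, exists D, A D /\ cov (symd (E n) D) (a / 2 / 2 ^+ n.+1).
  by move=> n; have [|D AD' h] := mE n (a / 2 / 2 ^+ n.+1); [rewrite divr_gt0// exprn_gt0|exists D].
have AU' n : A (ubig D n) by apply: A_ubig => k; have [] := hD k.
have Ui n : ubig D n `<=` ubig D n.+1 by rewrite ubigS; exact: subsetUl.
have [N hN] := exh_incr AU' Ui a20.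
exists (ubig D N) => //.
have c1 : cov (\bigcup_n symd (E n) (D n)) (a / 2).
  by apply: cov_bigcup (fun k => (hD k).2) _ => n; apply: sum_geo_le; exact: ltW.
have c2 : cov ((\bigcup_n ubig D n) `\` ubig D N) (a / 2).
  exists (fun m => ubig D (m + N)%N `\` ubig D N); split.
  - by move=> n; exact: AD.
  - by move=> n x [h1 h2]; split=> //; rewrite addSn; exact: Ui.
  - by move=> n; apply: hN; exact: leq_addl.
  - move=> x [[n _ h1] h2]; exists n => //; split=> //.
    by apply: (incr_le Ui) h1; exact: leq_addr.
apply: cov_sub (cov_le _ (covU c1 c2)); last lra.
move=> x [[[n _ Ex] nD]|[[k /= kN Dx] nE]].
  have [Dx|nDx] := pselect (D n x); last by left; exists n => //; left.
  by right; split=> //; exists n.+1 => //; rewrite ubigS; right.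
by left; exists k => //; right; split=> // Ex; apply: nE; exists k.
Qed.

(** Continuity at the empty set, which replaces countable additivity. Off the approximation errors,
    a point of [E N] must leave some later [E n], hence enters the [F] sets after stage [N];
    exhaustivity makes this late part small. *)
Lemma meas_cont (E : nat -> set X) a : (forall n, meas (E n)) -> (forall n, E n.+1 `<=` E n) ->
  \bigcap_n E n = set0 -> 0 < a -> exists N, cov (E N) a.
Proof.
move=> mE Ed E0 a0; have a20 : 0 < a / 2 by lra.
have /choice[D hD] : forall n, exists D, A D /\ cov (symd (E n) D) (a / 2 / 2 ^+ n.+1).
  by move=> n; have [|D AD' h] := mE n (a / 2 / 2 ^+ n.+1); [rewrite divr_gt0// exprn_gt0|exists D].
(* The points of [D 0] missed by one of the first [n] approximants: an increasing sequence in the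
   algebra, to which exhaustivity applies. *)
pose F n := ubig (fun k => D 0%N `\` D k) n.
have AF n : A (F n) by apply: A_ubig => k; apply: AD; exact: (hD _).1.
have Fi n : F n `<=` F n.+1 by rewrite /F ubigS; exact: subsetUl.
have [N hN] := exh_incr AF Fi a20.
have Ed' n m : (n <= m)%N -> E m `<=` E n.
  move=> /subnK <-; elim: (m - n)%N => [//|l IH].
  by rewrite addSn; exact: subset_trans (Ed _) IH.
have c1 : cov (\bigcup_n symd (E n) (D n)) (a / 2).
  by apply: cov_bigcup (fun k => (hD k).2) _ => n; apply: sum_geo_le; exact: ltW.
have c2 : cov ((\bigcup_n F n) `\` F N) (a / 2).
  exists (fun m => F (m + N)%N `\` F N); split.
  - by move=> n; exact: AD.
  - by move=> n x [h1 h2]; split=> //; rewrite addSn; exact: Fi.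
  - by move=> n; apply: hN; exact: leq_addl.
  - move=> x [[n _ h1] h2]; exists n => //; split=> //.
    by apply: (incr_le Fi) h1; exact: leq_addr.
exists N; apply: cov_sub (cov_le _ (covU c1 c2)); last lra.
move=> x ENx.
have [h|nh] := pselect ((\bigcup_n symd (E n) (D n)) x); [by left|right].
have same n : E n x <-> D n x.
  by split=> h; apply: contrapT => h'; apply: nh; exists n => //; [left|right].
split; last by move=> [k /= kN [_ nD]]; apply: nD; apply/same; apply: (Ed' k N) => //; exact: ltnW.
have [n nE] : exists n, ~ E n x.
  apply: contrapT => h; suff : (\bigcap_n E n) x by rewrite E0.
  by move=> n _; apply: contrapT => h'; apply: h; exists n.
exists n.+1 => //; exists n => //=; split; first by apply/same; exact: (Ed' 0%N N).
by move=> /same.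
Qed.

End Submeasure.

(** * Rademacher averages *)

Section RandomSigns.
Context {R : realType}.
Implicit Types (g h : R -> R) (x y c : R) (xs : seq R).

(* The expectation of g (y + sum of the entries of xs with independent random signs). *)
Fixpoint avgS g y xs : R :=
  if xs is x :: xs' then (avgS g (y + x) xs' + avgS g (y - x) xs') / 2 else g y.

Lemma avgS_le g h y xs : (forall z, g z <= h z) -> avgS g y xs <= avgS h y xs.
Proof.
move=> gh; elim: xs y => [|x xs IH] y //=.
by have := IH (y + x); have := IH (y - x); lra.
Qed.

Lemma avgS_ge0 g y xs : (forall z, 0 <= g z) -> 0 <= avgS g y xs.
Proof.
move=> gh; elim: xs y => [|x xs IH] y //=.
by have := IH (y + x); have := IH (y - x); lra.
Qed.

Definition sum_sq xs : R := \sum_(x <- xs) x ^+ 2.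

(** The second moment of the signed sum is [y ^+ 2 + s] and the fourth at most
    [y ^+ 4 + 6 * y ^+ 2 * s + 3 * s ^+ 2], with [s] the sum of squares; both are folded into one
    induction. *)
Lemma avgS_quartic al be ga y xs : 0 <= be ->
  al * (y ^+ 2 + sum_sq xs) - be * (y ^+ 4 + 6 * y ^+ 2 * sum_sq xs + 3 * sum_sq xs ^+ 2) - ga <=
  avgS (fun z => al * z ^+ 2 - be * z ^+ 4 - ga) y xs.
Proof.
move=> be0; elim: xs y => [|x xs IH] y /=.
  by rewrite /sum_sq big_nil; rewrite le_eqVlt; apply/orP; left; apply/eqP; ring.
have h1 := IH (y + x); have h2 := IH (y - x).
have -> : sum_sq (x :: xs) = x ^+ 2 + sum_sq xs by rewrite /sum_sq big_cons.
set s := sum_sq xs in h1 h2 *.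
have h3 : 0 <= be * x ^+ 4 by rewrite mulr_ge0// exprn_even_ge0.
have E : (al * ((y + x) ^+ 2 + s) - be * ((y + x) ^+ 4 + 6 * (y + x) ^+ 2 * s + 3 * s ^+ 2) - ga +
   (al * ((y - x) ^+ 2 + s) - be * ((y - x) ^+ 4 + 6 * (y - x) ^+ 2 * s + 3 * s ^+ 2) - ga)) / 2 =
   al * (y ^+ 2 + (x ^+ 2 + s)) - be * (y ^+ 4 + 6 * y ^+ 2 * (x ^+ 2 + s) + 3 * (x ^+ 2 + s) ^+ 2) - ga
   + 2 * (be * x ^+ 4) by field.
lra.
Qed.

(* Paley-Zygmund for Rademacher sums, through a quartic minorant of the indicator. *)
Lemma avgS_large c xs : 0 < c -> 4 * c ^+ 2 <= sum_sq xs ->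
  1 / 6 <= avgS (fun z => if c < `|z| then 1 else 0) 0 xs.
Proof.
move=> c0 cs; set s := sum_sq xs in cs *.
have c20 : 0 < c ^+ 2 by rewrite exprn_gt0.
have s0 : 0 < s by lra.
(* The minorant is [q * (z ^+ 2 - c ^+ 2) * (L - z ^+ 2)]: nonpositive for [|z| <= c], with [q]
   normalising its maximum to 1. With [L = 6 * s] its mean is at least
   [q * (3 * s ^+ 2 - 5 * c ^+ 2 * s)], which exceeds [1 / 6] when [4 * c ^+ 2 <= s]. *)
pose L := 6 * s; pose q := 4 / (L - c ^+ 2) ^+ 2.
have Lc : 0 < L - c ^+ 2 by rewrite /L; lra.
have q0 : 0 < q by rewrite divr_gt0// exprn_gt0.
have qL : q * (L - c ^+ 2) ^+ 2 = 4 by rewrite /q divfK// gt_eqF// exprn_gt0.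
apply: (@le_trans _ _ (avgS (fun z => (q * (L + c ^+ 2)) * z ^+ 2 - q * z ^+ 4 - q * (c ^+ 2 * L)) 0 xs)).
  apply: le_trans (avgS_quartic _ _ _ _ (ltW q0)); rewrite -/s.
  have -> : q * (L + c ^+ 2) * (0 ^+ 2 + s) - q * (0 ^+ 4 + 6 * 0 ^+ 2 * s + 3 * s ^+ 2) - q * (c ^+ 2 * L)
     = q * (3 * s ^+ 2 - 5 * c ^+ 2 * s) by rewrite /L; ring.
  have h1 : (L - c ^+ 2) ^+ 2 <= 36 * s ^+ 2.
    rewrite (_ : 36 * s ^+ 2 = L ^+ 2); last by rewrite /L; ring.
    by rewrite lerXn2r ?nnegrE ?(ltW Lc)//; rewrite /L; lra.
  have h2 : 7 / 4 * s ^+ 2 <= 3 * s ^+ 2 - 5 * c ^+ 2 * s.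
    have : 0 <= (s - 4 * c ^+ 2) * s by rewrite mulr_ge0// ?subr_ge0// ltW.
    nra.
  have h3 : 4 <= q * (36 * s ^+ 2) by rewrite -qL ler_wpM2l// ltW.
  have h4 : q * (7 / 4 * s ^+ 2) <= q * (3 * s ^+ 2 - 5 * c ^+ 2 * s) by rewrite ler_wpM2l// ltW.
  lra.
apply: avgS_le => z.
have E : q * (L + c ^+ 2) * z ^+ 2 - q * z ^+ 4 - q * (c ^+ 2 * L) = q * ((z ^+ 2 - c ^+ 2) * (L - z ^+ 2)) by ring.
rewrite E; case: ifPn => [cz|].
  have h : (z ^+ 2 - c ^+ 2) * (L - z ^+ 2) <= (L - c ^+ 2) ^+ 2 / 4.
    have := sqr_ge0 (z ^+ 2 - c ^+ 2 - (L - z ^+ 2)); nra.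
  have := ler_wpM2l (ltW q0) h; lra.
rewrite -leNgt => zc; have zc2 : z ^+ 2 <= c ^+ 2.
  by rewrite -(real_normK (num_real z)) lerXn2r ?nnegrE// ltW.
rewrite pmulr_rle0//; apply: mulr_le0_ge0; rewrite ?subr_le0// subr_ge0 /L; lra.
Qed.

End RandomSigns.

(** * Exhaustivity of good processes *)

Section Exhaustive.
Context {d : measure_display} {Omega : measurableType d} {R : realType}.
Variables (P : probability Omega R) (F : R -> set (set Omega)) (T : R).
Hypotheses (T_gt0 : 0 < T) (Ffil : filtration F T).
Implicit Types (k : simple_integrand F T) (Y : R -> Omega -> R).

Let T_ge0 : 0 <= T := ltW T_gt0.
Let ind (c z : R) : R := if c < `|z| then 1 else 0.

Lemma measurable_ind c : measurable_fun setT (ind c).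
Proof.
apply: measurable_fun_ifT => //; apply: measurable_fun_ltr => //.
Qed.

Lemma measurable_avgS (f : Omega -> R) (gs : nat -> Omega -> R) c (s : seq nat) :
  measurable_fun setT f -> (forall i, measurable_fun setT (gs i)) ->
  measurable_fun setT (fun w => avgS (ind c) (f w) [seq gs i w | i <- s]).
Proof.
move=> mf mg; elim: s f mf => [|i s IH] f mf /=.
  by apply: (measurableT_comp (measurable_ind c)).
apply: measurable_funM => //; apply: measurable_funD.
  by apply: (IH (fun w => f w + gs i w)); exact: measurable_funD.
by apply: (IH (fun w => f w - gs i w)); exact: measurable_funB.
Qed.

(** Every choice of signs gives a simple integrand bounded by 1, so each term of the average obeys
    the same bound [e]. In the induction [k] holds the signed sum already formed. *)
Lemma integral_avgS Y c e (ks : nat -> simple_integrand F T) (s : seq nat) k :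
  adapted F T Y -> unit_bd P F T Y c e ->
  (forall (x : R) w, 0 < x <= T ->
    `|simple_val k x w| + \sum_(i <- s) `|simple_val (ks i) x w| <= 1) ->
  (\int[P]_w (avgS (ind c) (simple_int k Y T w) [seq simple_int (ks i) Y T w | i <- s])%:E <= e%:E)%E.
Proof.
move=> aY bY; have TT : 0 <= T <= T by rewrite T_ge0 lexx.
have mI k' : measurable_fun setT (simple_int k' Y T) by exact: (simple_int_meas Ffil).
have ind0 z : 0 <= ind c z by rewrite /ind; case: ifP.
elim: s k => [|i s IH] k k1 /=.
  have mg : measurable (gtset (simple_int k Y T) c) by exact: gtset_measurable.
  have /(outer_meas _ _ mg) : outer_prob_le P (gtset (simple_int k Y T) c) e.
    by apply: bY => x w xT; have := k1 x w xT; rewrite big_nil addr0.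
  apply: le_trans; rewrite -[gtset _ _]setIT -integral_indic//.
  rewrite le_eqVlt; apply/orP; left; apply/eqP; apply: eq_integral => w _; rewrite indicE /ind.
  have [cw|cw] := boolP (c < _); first by rewrite mem_set.
  by rewrite memNset// => h; rewrite h in cw.
have [kp hp] := simple_add T_gt0 Ffil k (ks i) 1 1.
have [km hm] := simple_add T_gt0 Ffil k (ks i) 1 (- 1).
have hI x y w : 0 < x <= T -> `|simple_val y x w| <= `|simple_val k x w| + `|simple_val (ks i) x w| ->
   `|simple_val y x w| + \sum_(i <- s) `|simple_val (ks i) x w| <= 1.
  by move=> xT h; have := k1 x w xT; rewrite big_cons; lra.
have Hp := IH kp; have Hm := IH km.
have ep w : simple_int k Y T w + simple_int (ks i) Y T w = simple_int kp Y T w.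
  by rewrite (simple_int_lin T_ge0 hp) !mul1r.
have em w : simple_int k Y T w - simple_int (ks i) Y T w = simple_int km Y T w.
  by rewrite (simple_int_lin T_ge0 hm) mul1r mulN1r.
under eq_integral do rewrite ep em EFinM EFinD.
have a0 k' w : (0 <= (avgS (ind c) (simple_int k' Y T w) [seq simple_int (ks i) Y T w | i <- s])%:E)%E.
  by rewrite lee_fin; exact: avgS_ge0.
have ma k' : measurable_fun setT (fun w => (avgS (ind c) (simple_int k' Y T w) [seq simple_int (ks i) Y T w | i <- s])%:E).
  by apply/measurable_EFinP; apply: measurable_avgS.
rewrite ge0_integralZr//; last first.
  - by move=> w _; exact: adde_ge0.
  - exact: emeasurable_funD.
rewrite ge0_integralD//.
have -> : e = (e + e) * 2^-1 by field.
rewrite EFinM EFinD; apply: lee_wpmul2r => //; apply: leeD.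
  apply: Hp => x w xT; apply: hI => //; rewrite hp//.
  by rewrite !mul1r ler_normD.
apply: Hm => x w xT; apply: hI => //; rewrite hm//.
by rewrite mul1r mulN1r ler_normB.
Qed.

(** If all [m] integrals were large with probability at least [dl], their sum of squares would often
    be large, and random signs would produce a unit-bounded integrand with too large an integral. *)
Lemma good_exhaustive Y dl : good P F T Y -> 0 < dl -> exists m,
  forall ks : nat -> simple_integrand F T,
  (forall (x : R) w, 0 < x <= T -> \sum_(i <- iota 0 m) `|simple_val (ks i) x w| <= 1) ->
  exists2 i, (i < m)%N & outer_prob_le P (gtset (simple_int (ks i) Y T) dl) dl.
Proof.
move=> [[aY _] bY] d0; have TT : 0 <= T <= T by rewrite T_ge0 lexx.
(* With the factor 6 from [avgS_large], the signed average costs [dl / 4]; adding [dl / 2] for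
   points with few large integrals stays below [dl]. *)
have [c c0 hc] := bY (dl / 24) ltac:(lra).
(* Large enough that [m * dl / 2] integrals above [dl] force a sum of squares of at least
   [4 * c ^+ 2]. *)
pose m := (Num.truncn (8 * c ^+ 2 / dl ^+ 3)).+1.
have m0 : 0 < m%:R :> R by [].
have mc : 4 * c ^+ 2 <= dl ^+ 2 * (m%:R * dl / 2).
  have h := truncnS_gt (8 * c ^+ 2 / dl ^+ 3); rewrite -/m in h.
  rewrite ltr_pdivrMr ?exprn_gt0// in h.
  rewrite (_ : dl ^+ 2 * (m%:R * dl / 2) = m%:R * dl ^+ 3 / 2); last by field.
  lra.
exists m => ks k1; apply: contrapT => nex.
have mI k' : measurable_fun setT (simple_int k' Y T) by exact: (simple_int_meas Ffil).
have mg i : measurable (gtset (simple_int (ks i) Y T) dl) by exact: gtset_measurable.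
have Pgt i : (i < m)%N -> (dl%:E <= P (gtset (simple_int (ks i) Y T) dl))%E.
  move=> im; rewrite leNgt; apply/negP => h; apply: nex; exists i => //.
  by apply/outer_meas => //; exact: ltW.
have [k0 hk0] := simple_add T_gt0 Ffil (ks 0%N) (ks 0%N) 0 0.
have k00 (x : R) w : 0 < x <= T -> simple_val k0 x w = 0 by move=> xT; rewrite hk0// !mul0r addr0.
have I0 w : simple_int k0 Y T w = 0 by rewrite (simple_int_lin T_ge0 hk0) !mul0r addr0.
pose av w := avgS (ind c) 0 [seq simple_int (ks i) Y T w | i <- iota 0 m].
have ind0 z : 0 <= ind c z by rewrite /ind; case: ifP.
have av0 w : 0 <= av w by exact: avgS_ge0.
have mav : measurable_fun setT av by apply: measurable_avgS => //; exact: measurable_cst.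
have iav : (\int[P]_w (av w)%:E <= (dl / 24)%:E)%E.
  have := @integral_avgS Y c (dl / 24) ks (iota 0 m) k0 aY hc.
  rewrite (_ : (fun w => _) = (fun w => (av w)%:E)); last by apply/funext => w; rewrite I0.
  by apply=> x w xT; rewrite k00// normr0 add0r; exact: k1.
pose N w : R := \sum_(i < m) \1_(gtset (simple_int (ks i) Y T) dl) w.
have N0 w : 0 <= N w by apply: sumr_ge0 => i _; rewrite indicE.
have Nm w : N w <= m%:R.
  rewrite (_ : m%:R = \sum_(i < m) 1); last by rewrite sumr_const card_ord.
  by apply: ler_sum => i _; rewrite indicE; case: (_ \in _).
(* Either few integrals are large at [w], or the Rademacher bound gives [1 <= 6 * av w]. *)
have pw w : N w <= m%:R * (6 * av w + dl / 2).
  have [Nle|Ngt] := leP (N w) (m%:R * dl / 2).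
    rewrite (le_trans Nle)// -mulrA ler_wpM2l// ?(ltW m0)// lerDr mulr_ge0//.
  have ss : 4 * c ^+ 2 <= sum_sq [seq simple_int (ks i) Y T w | i <- iota 0 m].
    apply: (le_trans mc); apply: (@le_trans _ _ (dl ^+ 2 * N w)).
      by rewrite ler_wpM2l ?sqr_ge0 ?(ltW Ngt).
    rewrite /sum_sq big_map (_ : iota 0 m = index_iota 0 m); last by rewrite /index_iota subn0.
    rewrite big_mkord /N mulr_sumr.
    apply: ler_sum => i _; rewrite indicE.
    have [/set_mem gi|_] := boolP (w \in _); last by rewrite mulr0 sqr_ge0.
    rewrite mulr1 -(real_normK (num_real (simple_int _ _ _ _))) lerXn2r ?nnegrE ?(ltW d0)//.
    exact: ltW.
  have := avgS_large c0 ss; rewrite -/(av w) => h.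
  have : N w <= m%:R by [].
  move=> /le_trans; apply; rewrite -{1}[m%:R]mulr1 ler_wpM2l ?(ltW m0)//; lra.
have : (\int[P]_w (N w)%:E <= \int[P]_w (m%:R * (6 * av w + dl / 2))%:E)%E.
  apply: ge0_le_integral => //.
  - by move=> w _; rewrite lee_fin.
  - by apply/measurable_EFinP; apply: measurable_sum => i; exact: measurable_indic.
  - apply/measurable_EFinP; apply: measurable_funM => //; apply: measurable_funD => //.
    exact: measurable_funM.
  - by move=> w _; rewrite lee_fin.
rewrite leNgt => /negP; apply.
have -> : (\int[P]_w (m%:R * (6 * av w + dl / 2))%:E = (m%:R)%:E * (6%:E * \int[P]_w (av w)%:E + (dl / 2)%:E))%E.
  under eq_integral do rewrite EFinM EFinD EFinM.
  rewrite ge0_integralZl//; last 2 first.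
  - apply: emeasurable_funD => //; apply: measurable_funeM; exact/measurable_EFinP.
  - by move=> w _; rewrite -EFinM -EFinD lee_fin; have := av0 w; lra.
  rewrite ge0_integralD//; last 3 first.
  - by move=> w _; rewrite -EFinM lee_fin; have := av0 w; lra.
  - apply: measurable_funeM; exact/measurable_EFinP.
  - by move=> w _; rewrite lee_fin; lra.
  rewrite ge0_integralZl//; last 2 first.
  - exact/measurable_EFinP.
  - by move=> w _; rewrite lee_fin av0.
  congr (_ * (_ + _))%E; have := integral_cst P measurableT (dl / 2)%:E.
  move=> h; apply: (etrans h); rewrite -[RHS]mule1; congr (_ * _)%E.
  exact: probability_setT.
apply: (@lt_le_trans _ _ (\sum_(i < m) dl%:E)%E); last first.
  rewrite (_ : (\int[P]_w (N w)%:E = \sum_(i < m) P (gtset (simple_int (ks i) Y T) dl))%E).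
    by apply: lee_sum => i _; exact: Pgt.
  under eq_integral do rewrite /N -sumEFin.
  rewrite ge0_integral_sum//; last first.
    by move=> i; apply/measurable_EFinP; exact: measurable_indic.
  by apply: eq_bigr => i _; rewrite integral_indic// setIT.
rewrite sumEFin sumr_const card_ord -[(dl *+ m)]mulr_natl.
apply: (@le_lt_trans _ _ ((m%:R)%:E * (6%:E * (dl / 24)%:E + (dl / 2)%:E))%E).
  by apply: lee_wpmul2l => //; apply: leeD => //; apply: lee_wpmul2l.
rewrite -[(6%:E * _)%E]EFinM -EFinD -EFinM lte_fin ltr_pM2l//; lra.
Qed.

End Exhaustive.

(** * The submeasure of a family of good processes *)

Section ControlFamily.
Context {d : measure_display} {Omega : measurableType d} {R : realType}.
Variables (P : probability Omega R) (F : R -> set (set Omega)) (T : R).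
Hypotheses (T_gt0 : 0 < T) (Ffil : filtration F T).
Variables (ix : finType) (Ys : ix -> R -> Omega -> R).
Hypothesis Ys_good : forall i, good P F T (Ys i).
Implicit Types (k : simple_integrand F T) (D E : set (R * Omega)).

Let T_ge0 : 0 <= T := ltW T_gt0.

Definition Pi : set (R * Omega) := [set x | 0 < x.1 <= T].

Definition elem D : Prop := D `<=` Pi /\ exists k, forall (x : R) w, 0 < x <= T ->
  simple_val k x w = \1_D (x, w).

(** Quantifying over all integrands below the indicator makes the size monotone in [D]. The level
    [a] and the probability [e] are separate because an exceptional event charges only the
    latter. *)
Definition phi2 D (a e : R) : Prop := forall i k, le_val k (fun x w => \1_D (x, w)) ->
  outer_prob_le P (gtset (simple_int k (Ys i) T) a) e.

Definition phi D (a : R) : Prop := phi2 D a a.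

Lemma indic01 D (x : R * Omega) : 0 <= (\1_D x : R) <= 1.
Proof. by rewrite indicE; case: (_ \in _); rewrite lexx ler01. Qed.

Lemma elem0 : elem set0.
Proof.
split=> //; have [k1 _] := one_simple T_gt0 Ffil.
have [k hk] := simple_scale T_gt0 Ffil 0 k1; exists k => x w xT.
by rewrite hk// mul0r indic0.
Qed.

Lemma elem_Pi : elem Pi.
Proof.
split=> //; have [k1 hk1] := one_simple T_gt0 Ffil; exists k1 => x w xT.
by rewrite hk1// indicE mem_set.
Qed.

Lemma elemU D E : elem D -> elem E -> elem (D `|` E).
Proof.
move=> [DP [k hk]] [EP [k' hk']]; split; first by rewrite subUset.
have [k1 hk1] := simple_mul T_gt0 Ffil k k'.
have [k2 hk2] := simple_add T_gt0 Ffil k k' 1 1.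
have [k3 hk3] := simple_add T_gt0 Ffil k2 k1 1 (-1).
exists k3 => x w xT; rewrite hk3// hk2// hk1// hk// hk'// !indicE.
rewrite in_setU; case: (_ \in D); case: (_ \in E) => /=; ring.
Qed.

Lemma elemD D E : elem D -> elem E -> elem (D `\` E).
Proof.
move=> [DP [k hk]] [EP [k' hk']]; split; first by move=> x [/DP].
have [k1 hk1] := simple_mul T_gt0 Ffil k k'.
have [k3 hk3] := simple_add T_gt0 Ffil k k1 1 (-1).
exists k3 => x w xT; rewrite hk3// hk1// hk// hk'// !indicE.
rewrite in_setD; case: (_ \in D); case: (_ \in E) => /=; ring.
Qed.

Lemma elem_gt k a : 0 <= a -> elem [set x | Pi x /\ a < `|simple_val k x.1 x.2|].
Proof.
move=> a0; split; first by move=> x [].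
have [k' hk'] := simple_gt_ind T_gt0 Ffil k a0; exists k' => x w xT.
rewrite hk'// indicE; case: ifPn => ak; first by rewrite mem_set.
by rewrite memNset//= => -[_ h]; rewrite h in ak.
Qed.

Definition itv (a b : R) : set (R * Omega) := [set x | a < x.1 <= b].

Lemma elem_itv a b : 0 <= a -> b <= T -> elem (itv a b).
Proof.
move=> a0 bT; split.
  by move=> x /andP[ax xb]; rewrite /Pi/= (le_lt_trans a0 ax) (le_trans xb).
have [ab|ba] := leP a b; last first.
  have [_ [k hk]] := elem0; exists k => x w xT; rewrite hk//.
  rewrite !indicE !memNset//= => /andP[ax xb].
  by have := lt_le_trans ax xb; rewrite ltNge (ltW ba).
have h1 (i : 'I_1) : [/\ 0 <= a, a <= b & b <= T] by [].
have h2 (i : 'I_1) (B : set R) : measurable B -> F a ((fun _ : Omega => 1) @^-1` B).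
  by apply: (Fmeas_cst (Fsigma Ffil _)); rewrite a0 (le_trans ab).
have h3 (i : 'I_1) : exists C : R, forall w : Omega, `|1 : R| <= C.
  by exists 1 => _; rewrite normr1.
exists (@SimpleIntegrand _ _ _ F T 1 (fun=> a) (fun=> b) (fun _ _ => 1) h1 h2 h3).
move=> x w xT; rewrite /simple_val big_ord_recl big_ord0 addr0/= indicE.
by case: ifPn => h; [rewrite mem_set|rewrite memNset//=; apply/negP].
Qed.

Lemma phi2_sub D E a e : D `<=` E -> phi2 E a e -> phi2 D a e.
Proof.
move=> DE h i k kD; apply: h; apply: le_val_trans kD _ => x w _.
rewrite !indicE; have [/set_mem/DE h|_] := boolP ((x, w) \in D); first by rewrite mem_set.
by rewrite ler0n.
Qed.

Lemma phi2_le D a b e f : a <= b -> e <= f -> phi2 D a e -> phi2 D b f.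
Proof.
move=> ab ef h i k kD; apply: outer_le ef _.
by apply: outer_sub (h i k kD); exact: gtset_le.
Qed.

Lemma simple_int_path0 k Y w s : 0 <= s <= T ->
  (forall x, 0 < x <= s -> simple_val k x w = 0) -> simple_int k Y s w = 0.
Proof.
move=> /andP[s0 sT] h.
have [|t [r [tg tp]]] := @grid_exists _ T T_ge0 (s :: ends k).
  by move=> x; rewrite inE => /orP[/eqP->|]; [rewrite s0|exact: ends_in].
have kc : compat k t r by apply: compat_ends => x xe; apply: tp; rewrite inE xe orbT.
have [t0 tr tm] := tg.
have [j jr sE] : on_grid t r s by apply: tp; rewrite inE eqxx.
rewrite -sE (simple_int_pt tg _ _ kc jr) big1// => l _.
have [lp|ln] := ltP 0 (t l.+1); last by rewrite (grid_degen tg ln) subrr mulr0.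
by rewrite h ?mul0r// lp -sE tm.
Qed.

Lemma phi2_0 a e : 0 <= a -> 0 <= e -> phi2 set0 a e.
Proof.
move=> a0 e0 i k k0; apply: outer_negl => //.
apply: negligibleS (negligible_set0 P) => w; rewrite /gtset/= simple_int_path0.
- by rewrite normr0 ltNge a0.
- by rewrite T_ge0 lexx.
- by move=> x xT; have := k0 x w xT; rewrite indic0 normr_le0 => /eqP.
Qed.

Lemma simple_cut k D : elem D -> exists k1 k2, [/\
  forall (x : R) w, 0 < x <= T -> simple_val k1 x w = simple_val k x w * \1_D (x, w),
  forall (x : R) w, 0 < x <= T -> simple_val k2 x w = simple_val k x w * (1 - \1_D (x, w)) &
  forall Y t w, simple_int k Y t w = simple_int k1 Y t w + simple_int k2 Y t w].
Proof.
move=> [_ [kD hD]]; have [k1 h1] := simple_mul T_gt0 Ffil k kD.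
have [k2 h2] := simple_add T_gt0 Ffil k k1 1 (-1).
exists k1, k2; split.
- by move=> x w xT; rewrite h1// hD.
- by move=> x w xT; rewrite h2// h1// hD//; ring.
- move=> Y t w; rewrite (@simple_int_lin _ _ _ F T T_ge0 k k1 k2 1 1) ?mul1r// => x w' xT.
  by rewrite h2// !mul1r; ring.
Qed.

Lemma phi2U D E a b e f : elem D -> elem E -> phi2 D a e -> phi2 E b f ->
  phi2 (D `|` E) (a + b) (e + f).
Proof.
move=> eD eE hD hE i k kDE; have [k1 [k2 [h1 h2 h3]]] := simple_cut k eD.
apply: (@gtset_add _ _ _ P (simple_int k1 (Ys i) T) (simple_int k2 (Ys i) T)).
- by move=> w; rewrite h3 ler_normD.
- apply: hD => x w xT; rewrite h1// normrM; have /andP[i0 i1] := indic01 D (x, w).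
  have := kDE x w xT; have /andP[j0 j1] := indic01 (D `|` E) (x, w) => h.
  by rewrite (ger0_norm i0) ler_piMl// (le_trans h).
- apply: hE => x w xT; rewrite h2// normrM; have h := kDE x w xT; move: h.
  rewrite !indicE in_setU; case: (_ \in D) => /=; first by rewrite subrr normr0 mulr0 ler0n.
  by rewrite subr0 normr1 mulr1.
Qed.

Lemma phi_sub D E a : D `<=` E -> phi E a -> phi D a.
Proof. exact: phi2_sub. Qed.
Lemma phi_le D a b : a <= b -> phi D a -> phi D b.
Proof. by move=> ab; exact: phi2_le. Qed.
Lemma phi_0 a : 0 <= a -> phi set0 a.
Proof. by move=> a0; exact: phi2_0. Qed.
Lemma phi_U D E a b : elem D -> elem E -> phi D a -> phi E b -> phi (D `|` E) (a + b).
Proof. exact: phi2U. Qed.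

Lemma sum_disj_indic (D : nat -> set (R * Omega)) (s : nat -> nat) m x :
  trivIset setT D -> injective s -> \sum_(i <- iota 0 m) (\1_(D (s i)) x : R) <= 1.
Proof.
move=> tD sinj; rewrite (_ : iota 0 m = index_iota 0 m); last by rewrite /index_iota subn0.
rewrite big_mkord; have [[i Di]|nex] := pselect (exists i : 'I_m, D (s i) x); last first.
  rewrite big1 ?ler01// => i _; rewrite indicE memNset// => h; by apply: nex; exists i.
rewrite (bigD1 i)//= big1 ?addr0; first by have /andP[] := indic01 (D (s i)) x.
move=> j ji; rewrite indicE memNset// => Dj.
have /eqP := ji; apply; apply/val_inj/sinj.
by apply: (tD (s j) (s i) I I); exists x.
Qed.

Lemma phi_exh1 i (D : nat -> set (R * Omega)) a : trivIset setT D -> 0 < a ->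
  exists N, forall n, (N <= n)%N -> forall k, le_val k (fun x w => \1_(D n) (x, w)) ->
    outer_prob_le P (gtset (simple_int k (Ys i) T) a) a.
Proof.
move=> tD a0; apply: contrapT => nex.
have /choice[f hf] : forall N, exists nk : nat * simple_integrand F T, [/\ (N <= nk.1)%N,
    le_val nk.2 (fun x w => \1_(D nk.1) (x, w)) &
    ~ outer_prob_le P (gtset (simple_int nk.2 (Ys i) T) a) a].
  move=> N; apply: contrapT => h; apply: nex; exists N => n Nn k kD.
  by apply: contrapT => h'; apply: h; exists (n, k).
(* Strictly increasing indices select distinct, hence disjoint, sets, so the chosen integrands have
   absolute values summing to at most 1. *)
have [t tinc] := @increasing_subseq (fun N => (f N).1) (fun N => let: And3 h _ _ := hf N in h).
pose s j := (f (t j)).1.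
have sinj : injective s.
  move=> j l e; have [jl|lj|//] := ltngtP j l.
    by have := tinc _ _ jl; rewrite -/(s j) -/(s l) [in X in (X < _)%N]e ltnn.
  by have := tinc _ _ lj; rewrite -/(s j) -/(s l) -[in X in (X < _)%N]e ltnn.
have [m hm] := good_exhaustive T_gt0 Ffil (Ys_good i) a0.
have [|j jm hj] := hm (fun j => (f (t j)).2); last by have [_ _] := hf (t j).
move=> x w xT; apply: le_trans (sum_disj_indic m (x, w) tD sinj).
by apply: ler_sum => j _; have [_ h _] := hf (t j); exact: h.
Qed.

Lemma phi_exhaustive (D : nat -> set (R * Omega)) : (forall n, elem (D n)) ->
  trivIset setT D -> forall a, 0 < a -> exists n, phi (D n) a.
Proof.
move=> _ tD a a0; have /choice[N hN] := fun i => phi_exh1 i tD a0.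
exists (\max_i N i) => i k kD; apply: (hN i) kD.
exact: (leq_bigmax (F := N) i).
Qed.

Lemma simple_after k s : 0 <= s <= T -> exists2 k' : simple_integrand F T,
  (forall (x : R) w, 0 < x <= T -> simple_val k' x w = if s < x then simple_val k x w else 0) &
  forall Y w, simple_int k' Y T w = simple_int k Y T w - simple_int k Y s w.
Proof.
move=> /andP[s0 sT]; have [k1 [k2 [h1 h2 h3]]] := simple_cut k (elem_itv s0 (lexx T)).
have hk1 (x : R) w : 0 < x <= T -> simple_val k1 x w = if s < x then simple_val k x w else 0.
  move=> xT; rewrite h1// indicE; case: ifPn => sx.
    by rewrite mem_set ?mulr1//= /itv/= sx; case/andP: xT.
  by rewrite memNset ?mulr0//= /itv/= => /andP[]; rewrite (negbTE sx).
exists k1 => // Y w.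
have [|t [r [tg tp]]] := @grid_exists _ T T_ge0 (s :: ends k ++ ends k1).
  move=> x; rewrite inE mem_cat => /or3P[/eqP->||]; [by rewrite s0|exact: ends_in|exact: ends_in].
have kc : compat k t r by apply: compat_ends => x xe; apply: tp; rewrite inE mem_cat xe orbT.
have kc1 : compat k1 t r by apply: compat_ends => x xe; apply: tp; rewrite inE mem_cat xe !orbT.
have [t0 tr tm] := tg.
have sg : on_grid t r s by apply: tp; rewrite inE eqxx.
suff H m : (m <= r)%N ->
    simple_int k1 Y (t m) w = simple_int k Y (t m) w - simple_int k Y (Num.min (t m) s) w.
  by have := H r (leqnn _); rewrite tr (min_r sT).
elim: m => [|m IH] mr; first by rewrite t0 (min_l s0) !simple_int0 subrr.
have S k' : compat k' t r -> simple_int k' Y (t m.+1) w = simple_int k' Y (t m) w +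
    simple_val k' (t m.+1) w * (Y (t m.+1) w - Y (t m) w).
  move=> kc'; rewrite -(simple_int_incr tg _ _ kc' mr (lexx _) (grid_step tg _) (lexx _)).
  by rewrite addrC subrK.
rewrite (S _ kc1) (S _ kc) IH ?(ltnW mr)//.
have [mp|mn] := ltP 0 (t m.+1); last by rewrite (grid_degen tg mn) subrr !mulr0 !addr0.
have mT : t m.+1 <= T by case/andP: (grid_in tg mr).
rewrite hk1 ?mp//; case: ifPn => [sm|].
  have sm' := grid_le tg sg sm.
  by rewrite (min_r sm') (min_r (ltW sm)); ring.
rewrite -leNgt => ms; rewrite (min_l ms) (min_l (le_trans (grid_step tg m) ms)).
by rewrite (S _ kc); ring.
Qed.

(** The intervals [(s n, T]] increase, so exhaustivity makes the pieces from [s n] to [s N] small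
    uniformly in [n]. Right-continuity of the integral at [a] lets [s n] decrease to [a]. *)
Lemma phi_small_itv a b : 0 <= a -> a < T -> 0 < b ->
  exists2 h : R, 0 < h & phi (itv a (a + h)) b.
Proof.
move=> a0 aT b0; have Ta : 0 < T - a by rewrite subr_gt0.
pose s n : R := a + (T - a) / n.+1%:R.
have as' n : a < s n by rewrite ltrDl divr_gt0.
have sT n : s n <= T.
  rewrite /s -lerBrDl ler_pdivrMr// ler_peMr ?(ltW Ta)//.
  by rewrite ler1n.
have sd n : s n.+1 <= s n.
  by rewrite lerD2l ler_pM2l// lef_pV2 ?posrE// ler_nat.
have [||N hN] := @exh_incr _ R elem phi elemD phi_exhaustive (fun n => itv (s n) T) b _ _ b0.
- by move=> n; apply: elem_itv => //; exact: le_trans (ltW (as' n)).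
- by move=> n x /andP[h1 h2]; rewrite /itv/= h2 andbT; exact: le_lt_trans h1.
exists (s N - a); first by rewrite subr_gt0.
rewrite addrC subrK => i k kD; have [rY _] := Ys_good i.
have st n : 0 <= s n <= T by rewrite sT (le_trans a0 (ltW (as' n))).
have aT' : 0 <= a <= T by rewrite a0 ltW.
have /choice[ks hks] : forall n, exists k' : simple_integrand F T,
  (forall (x : R) w, 0 < x <= T -> simple_val k' x w = if s n < x then simple_val k x w else 0) /\
  forall Y w, simple_int k' Y T w = simple_int k Y T w - simple_int k Y (s n) w.
  by move=> n; have [k' h1 h2] := simple_after k (st n); exists k'.
have k0 w : simple_int k (Ys i) a w = 0.
  apply: simple_int_path0 => // x /andP[x0 xa].
  have := kD x w; rewrite x0 (le_trans xa (ltW aT)) => /(_ erefl).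
  rewrite indicE memNset ?normr_le0; first by move/eqP.
  by rewrite /itv/= ltNge xa.
pose A := [set w | rcont T ((Ys i) ^~ w)].
have Aae : {ae P, forall w, A w} by apply: filterS rY.2 => w [].
apply: (@outer_aesub _ _ _ _ (gtset (simple_int k (Ys i) T) b `&` A)).
  by apply: filterS Aae => w Aw h; split.
apply: (@outer_liminf _ _ _ P (fun n => gtset (simple_int (ks (n + N)%N) (Ys i) T) b)).
  move=> n; apply: (hN (n + N)%N (leq_addl _ _)) => x w xT; rewrite (hks _).1//.
  case: ifPn => [sx|_]; last by rewrite normr0 indicE ler0n.
  have := kD x w xT; rewrite indicE; have [/set_mem hx|_] := boolP (_ \in _).
    move=> h; rewrite indicE mem_set//; split.
      by rewrite /itv/= sx; case/andP: xT.
    by rewrite /itv/= => /andP[]; move: hx => /andP[_]; rewrite leNgt => /negbTE ->.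
  by rewrite normr_le0 => /eqP ->; rewrite normr0 indicE ler0n.
move=> w [gw Aw].
have [||h h0 hh] := (rcont_simple_int k Aw) a _ (`|simple_int k (Ys i) T w| - b) _.
- by rewrite a0.
- by rewrite subr_gt0.
exists (Num.truncn ((T - a) / h)) => m hm; rewrite /gtset/= (hks _).2.
have : `|simple_int k (Ys i) (s (m + N)%N) w - simple_int k (Ys i) a w| < `|simple_int k (Ys i) T w| - b.
  apply: hh; rewrite (ltW (as' _))/= ltrD2l ltr_pdivrMr// mulrC -ltr_pdivrMr//.
  apply: (lt_le_trans (truncnS_gt _)); rewrite ler_nat ltnS.
  by apply: (leq_trans hm); exact: leq_addr.
rewrite k0 subr0 => h2.
by have := ler_distD (simple_int k (Ys i) (s (m + N)%N) w) (simple_int k (Ys i) T w) 0; rewrite !subr0; lra.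
Qed.

Lemma elem_cst D : elem D -> exists t r, is_grid T t r /\
  forall j (x : R) w, (j < r)%N -> t j < x <= t j.+1 -> D (x, w) <-> D (t j.+1, w).
Proof.
move=> [DP [k hk]].
have [|t [r [tg tp]]] := @grid_exists _ T T_ge0 (ends k); first exact: ends_in.
have kc : compat k t r by exact: compat_ends.
exists t, r; split=> // j x w jr jx.
have /andP[j0 jT] := grid_in tg (ltnW jr); have /andP[_ j1T] := grid_in tg jr.
have /andP[h1 h2] := jx.
have xT : 0 < x <= T by rewrite (le_lt_trans j0 h1) (le_trans h2).
have yT : 0 < t j.+1 <= T by rewrite (lt_le_trans (le_lt_trans j0 h1) h2) j1T.
have := simple_val_cst tg w kc jr jx; rewrite !hk// !indicE.
have [/set_mem hx|hx] := boolP (_ \in D); have [/set_mem hy|hy] := boolP (_ \in D) => // /eqP.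
- by rewrite oner_eq0.
- by rewrite eq_sym oner_eq0.
by move=> _; split=> /mem_set h; rewrite h in hx hy.
Qed.

(** Inner regularity: cutting a short piece at the left end of each cell leaves time sections inside
    closed subsets of the original sections, at small cost by [phi_small_itv]. It prepares a
    compactness argument. *)
Lemma phi_shrink D b : elem D -> 0 < b -> exists D' : set (R * Omega), exists C : Omega -> set R,
  [/\ elem D', D' `<=` D, phi (D `\` D') b &
   forall w, [/\ closed (C w), forall t, D' (t, w) -> C w t & forall t, C w t -> D (t, w)]].
Proof.
move=> eD b0; have [t [r [tg tD]]] := elem_cst eD; have [t0 tr tm] := tg.
have r0 : 0 < r.+1%:R :> R by [].
have /choice[h hh] : forall j : nat, exists h : R, 0 < h /\
    ((j < r)%N -> t j < t j.+1 -> phi (itv (t j) (t j + h) `&` Pi) (b / r.+1%:R)).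
  move=> j; have [jr|jr] := boolP ((j < r)%N && (t j < t j.+1)); last first.
    by exists 1; split=> // h1 h2; rewrite h1 h2 in jr.
  have /andP[jr' jlt] := jr.
  have /andP[j0 _] := grid_in tg (ltnW jr'); have /andP[_ jT] := grid_in tg jr'.
  have [|h h0 hp] := phi_small_itv j0 (lt_le_trans jlt jT) (b := b / r.+1%:R).
    by rewrite divr_gt0.
  by exists h; split=> // _ _; apply: phi_sub hp => x [].
pose B j := if (j < r)%N && (t j < t j.+1) then itv (t j) (t j + h j) `&` Pi else set0.
have eB j : elem (B j).
  rewrite /B; case: ifPn => [/andP[jr jlt]|_]; last exact: elem0.
  have /andP[j0 _] := grid_in tg (ltnW jr).
  have -> : itv (t j) (t j + h j) `&` Pi = itv (t j) (Num.min (t j + h j) T).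
    apply/seteqP; split => x.
      by move=> [/andP[h1 h2] /andP[h3 h4]]; rewrite /itv/= h1 le_min h2.
    move=> /andP[h1]; rewrite le_min => /andP[h2 h3]; split; first by rewrite /itv/= h1.
    by rewrite /Pi/= h3 (le_lt_trans j0).
  by apply: elem_itv => //; rewrite ge_min lexx orbT.
have pB j : phi (B j) (b / r.+1%:R).
  rewrite /B; case: ifPn => [/andP[jr jlt]|_]; first exact: (hh j).2.
  by apply: phi_0; rewrite divr_ge0// ltW.
have eU : elem (ubig B r) by exact: (A_ubig elem0 elemU).
pose Cj w j : set R := if (t j < t j.+1) && `[< D (t j.+1, w) >] then `[t j + h j, t j.+1]%classic else set0.
exists (D `\` ubig B r), (fun w => ubig (Cj w) r); split.
- exact: elemD.
- by move=> x [].
- apply: (@phi_sub _ (ubig B r)); first by move=> x [Dx nD]; apply: contrapT => nB; apply: nD.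
  apply: (@phi_le _ (\sum_(j < r) b / r.+1%:R)).
    rewrite sumr_const card_ord -[(b / r.+1%:R) *+ r]mulr_natr mulrAC ler_pdivrMr//.
    by rewrite ler_pM2l// ler_nat.
  exact: (phi_ubig elem0 elemU phi_0 phi_U r eB pB).
move=> w; split.
- have H n : closed (ubig (Cj w) n).
    elim: n => [|n IH]; first by rewrite ubig0; exact: closed0.
    rewrite ubigS; apply: closedU => //; rewrite /Cj; case: ifP => _; last exact: closed0.
    exact: interval_closed.
  exact: H.
- move=> x [Dx nB]; have xT := eD.1 _ Dx.
  have [j jr jx] := grid_locate tg xT; have /andP[h1 h2] := jx.
  have jlt := lt_le_trans h1 h2.
  exists j => //; rewrite /Cj jlt asboolT/=; last by apply/(tD j x w).
  rewrite in_itv/= h2 andbT leNgt; apply/negP => h3; apply: nB; exists j => //.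
  rewrite /B jr jlt/=; split=> //; by rewrite /itv/= h1 ltW.
- move=> x [j /= jr]; rewrite /Cj; case: ifPn => // /andP[jlt /asboolP Dj].
  rewrite /= in_itv/= => /andP[h1 h2]; apply/(tD j x w) => //.
  by rewrite h2 andbT; apply: lt_le_trans h1; rewrite ltrDl (hh j).1.
Qed.

Lemma closed_cluster (C : nat -> set R) (x : nat -> R) :
  (forall n, 0 <= x n <= T) -> (forall k : nat, closed (C k)) ->
  (forall k n : nat, (k <= n)%N -> C k (x n)) -> exists p, forall k : nat, C k p.
Proof.
move=> xT cC Cx.
have [|p [_ hp]] := @segment_compact R 0 T (x n @[n --> \oo]) _ _.
  by exists 0%N => // n _; rewrite /= in_itv/=; exact: xT.
exists p => k; apply: cC => B Bp; apply: hp => //.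
by exists k => // n /= kn; exact: Cx.
Qed.

(** Sections are constant on grid cells, so the projection is a finite union over right end points;
    no analytic-set theorem enters. *)
Lemma proj_measurable D : elem D -> measurable [set w | exists t, D (t, w)].
Proof.
move=> eD; have [t [r [tg tD]]] := elem_cst eD; have [DP [k hk]] := eD.
rewrite (_ : [set w | _] = ubig (fun j => if 0 < t j.+1 then
    [set w | (j < r)%N /\ D (t j.+1, w)] else set0) r).
  have H n : (n <= r)%N -> measurable (ubig (fun j => if 0 < t j.+1 then
    [set w | (j < r)%N /\ D (t j.+1, w)] else set0) n).
    elim: n => [|n IH] nr; first by rewrite ubig0; exact: measurable0.
    rewrite ubigS; apply: measurableU; first by apply: IH; exact: ltnW.
    case: ifPn => [n0|_]; last exact: measurable0.
    have /andP[n1 nT] := grid_in tg nr.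
    have mk : measurable_fun setT (simple_val k (t n.+1)).
      rewrite /simple_val; apply: measurable_sum => i.
      case: (boolP (lft i < t n.+1 <= rgt i)) => _; last exact: measurable_cst.
      have [l0 lr rT] := simple_times i.
      apply: (Fmeas_meas Ffil (s := lft i)); first by rewrite l0 (le_trans lr).
      by move=> B mB; exact: simple_meas.
    rewrite (_ : [set w | _] = gtset (simple_val k (t n.+1)) 0).
      exact: gtset_measurable.
    apply/seteqP; split => w; rewrite /gtset/= hk ?n0 ?nT// indicE.
      by move=> [_ h]; rewrite mem_set// normr1.
    by case: (boolP (_ \in D)) => [/set_mem//|]; rewrite normr0 ltxx.
  exact: H.
apply/seteqP; split => w.
  move=> [x Dx]; have xT := DP _ Dx; have [j jr jx] := grid_locate tg xT.
  exists j => //; have /andP[h1 h2] := jx; have /andP[x0 _] := xT.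
  by rewrite (lt_le_trans x0 h2); split=> //; apply/(tD j x w).
by move=> [j /= jr]; case: ifPn => // _ [_ h]; exists (t j.+1).
Qed.

(** Compactness as in the sigma-additivity of Lebesgue measure: if the shrunken sets keep nonempty
    sections at [w], a cluster time lies in every [D n], so [w] is in [A]. The projections thus
    decrease into [A]. *)
Lemma phi2_cont (D : nat -> set (R * Omega)) (A : set Omega) p b :
  (forall n, elem (D n)) -> (forall n, D n.+1 `<=` D n) ->
  (forall x, (\bigcap_n D n) x -> A x.2) -> outer_prob_le P A p -> 0 < b ->
  exists n, phi2 (D n) b (p + b).
Proof.
move=> eD Dd DA Ap b0; have b20 : 0 < b / 2 by lra.
have /choice[D' hD'] : forall n, exists D' : set (R * Omega), exists C : Omega -> set R,
  [/\ elem D', D' `<=` D n, phi (D n `\` D') (b / 2 / 2 ^+ n.+1) &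
   forall w, [/\ closed (C w), forall t, D' (t, w) -> C w t & forall t, C w t -> D n (t, w)]].
  by move=> n; apply: phi_shrink => //; rewrite divr_gt0// exprn_gt0.
have /choice[C hC] := hD'.
(* This is the intersection of [D' 0] to [D' n], written with differences so that it stays
   elementary. *)
pose E n := D' 0%N `\` ubig (fun l : nat => D' 0%N `\` D' l) n.+1.
have eD' n : elem (D' n) by case: (hC n).
have eE n : elem (E n) by apply: elemD => //; apply: (A_ubig elem0 elemU) => k; exact: elemD.
have ED' n (l : nat) x : (l <= n)%N -> E n x -> D' l x.
  by move=> ln [h1 h2]; apply: contrapT => h3; apply: h2; exists l.
pose G n := [set w | exists t, E n (t, w)].
have Gd n : G n.+1 `<=` G n.
  move=> w [t [h1 h2]]; exists t; split=> // -[k /= kn h3]; apply: h2; exists k => //=.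
  exact: ltnW.
have [] := @outer_cont _ _ _ P G A p (b / 2) b20 _ Gd _ Ap.
- by move=> n; exact: proj_measurable.
- move=> w Gw.
  have /choice[x hx] : forall n, exists t, E n (t, w) by move=> n; exact: Gw.
  have xT n : 0 <= x n <= T by have /andP[/ltW -> ->] := (eE n).1 _ (hx n).
  have [||q hq] := @closed_cluster (fun l : nat => C l w) x xT.
  + by move=> k; have [_ _ _ /(_ w)[]] := hC k.
  + move=> k n kn; have [_ _ _ /(_ w)[_ + _]] := hC k; apply; exact: ED' (hx n).
  apply: (DA (q, w)) => k _; have [_ _ _ /(_ w)[_ _]] := hC k; apply; exact: hq.
move=> n hG; exists n.
have Dsub : D n `<=` ubig (fun l : nat => D l `\` D' l) n.+1 `|` E n.
  move=> x Dx; have [h|h] := pselect (ubig (fun l : nat => D l `\` D' l) n.+1 x); [by left|right].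
  have Dk (l : nat) : (l <= n)%N -> D l x.
    by move=> /subnK ln; rewrite -ln in Dx; elim: (n - l)%N Dx => // m IH; rewrite addSn => /Dd; exact: IH.
  have D'k (l : nat) : (l <= n)%N -> D' l x.
    by move=> ln; apply: contrapT => h1; apply: h; exists l => //; split=> //; exact: Dk.
  by split; [exact: D'k|move=> [k /= kn [_]]; apply; exact: D'k].
apply: phi2_sub Dsub _.
have eB : forall l : nat, elem (D l `\` D' l) by move=> l; exact: elemD.
have pB (l : nat) : phi (D l `\` D' l) (b / 2 / 2 ^+ l.+1) by case: (hC l).
have h1 := phi_ubig elem0 elemU phi_0 phi_U n.+1 eB pB.
have {}h1 := phi_le (sum_geo_le n.+1 (ltW b20)) h1.
(* Off the projection of [E n] an integrand carried by it vanishes along the whole path, so its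
   integral is zero; only the probability is charged. *)
have h2 : phi2 (E n) (b / 2) (p + b / 2).
  move=> i k kE; apply: outer_sub hG => w; apply: contraPP => nG.
  rewrite /gtset/= simple_int_path0 ?normr0; first by apply/negP; rewrite -leNgt ltW.
    by rewrite T_ge0 lexx.
  move=> x xT; have := kE x w xT; rewrite indicE memNset ?normr_le0; first by move/eqP.
  by move=> h; apply: nG; exists x.
apply: (@phi2_le _ (b / 2 + b / 2) _ (b / 2 + (p + b / 2))); [lra|lra|].
apply: phi2U => //; exact: (A_ubig elem0 elemU).
Qed.

End ControlFamily.

(** * Uniform and Emery convergence *)

Section UniformConvergence.
Context {d : measure_display} {Omega : measurableType d} {R : realType}.
Variables (P : probability Omega R) (F : R -> set (set Omega)) (T : R).
Implicit Types (k : simple_integrand F T) (U V W : R -> Omega -> R).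

Lemma half_pow_small (e : R) : 0 < e -> exists n : nat, 1 / 2 ^+ n <= e.
Proof.
move=> e0; exists (Num.truncn (1 / e)).+1.
rewrite ler_pdivrMr ?exprn_gt0// -ler_pdivrMl// mulrC.
apply: (le_trans (ltW (truncnS_gt _))).
by rewrite -natrX ler_nat ltnW// ltn_expl.
Qed.

Lemma geo_split (K l : nat) : 1 / 2 ^+ K / 2 ^+ l.+1 = 1 / 2 ^+ (l + K).+1 :> R.
Proof. by rewrite -addSn exprD; field; rewrite !expf_neq0. Qed.

Lemma outer_bigcup (A : nat -> set Omega) (a : R) : 0 <= a ->
  (forall l, outer_prob_le P (A l) (a / 2 ^+ l.+1)) -> outer_prob_le P (\bigcup_l A l) a.
Proof.
move=> a0 h; apply: (@outer_liminf _ _ _ P (fun n => [set w | exists2 i, (i < n)%N & A i w])).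
  move=> n; apply: outer_le (outer_sum (fun i _ => h i)).
  elim: n => [|n IH]; first by rewrite big_ord0.
  suff -> : \sum_(i < n.+1) a / 2 ^+ i.+1 = a - a / 2 ^+ n.+1.
    by rewrite gerBl divr_ge0// exprn_ge0.
  elim: n.+1 => [|m IHm]; first by rewrite big_ord0 expr0 divr1 subrr.
  by rewrite big_ord_recr/= IHm exprS; field; rewrite expf_neq0.
by move=> w [l _ Aw]; exists l.+1 => m lm; exists l.
Qed.

Lemma outer0_negligible (A : set Omega) :
  (forall e, 0 < e -> outer_prob_le P A e) -> P.-negligible A.
Proof.
move=> h; have /choice[B hB] : forall n, exists B, [/\ measurable B, A `<=` B & (P B <= (1 / 2 ^+ n)%:E)%E].
  by move=> n; apply: h; rewrite divr_gt0// exprn_gt0.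
have mB : measurable (\bigcap_n B n).
  by apply: bigcapT_measurable => n; have [] := hB n.
exists (\bigcap_n B n); split=> //; last by move=> w Aw n _; have [_ + _] := hB n; apply.
apply/eqP; rewrite eq_le measure_ge0 andbT; apply/lee_addgt0Pr => e e0; rewrite add0e.
have [n hn] := half_pow_small e0; have [mBn _ PB] := hB n.
apply: (@le_trans _ _ (P (B n))).
  by apply: le_measure; rewrite ?inE// => w; apply.
by apply: le_trans PB _; rewrite lee_fin.
Qed.

Lemma supgt_sym U V c : supgt T (fun t w => U t w - V t w) c = supgt T (fun t w => V t w - U t w) c.
Proof. by apply/seteqP; split => w [t tT h]; exists t => //; rewrite distrC. Qed.

Lemma supgt_tri U V W a b x y :
  outer_prob_le P (supgt T (fun t w => U t w - V t w) a) x ->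
  outer_prob_le P (supgt T (fun t w => V t w - W t w) b) y ->
  outer_prob_le P (supgt T (fun t w => U t w - W t w) (a + b)) (x + y).
Proof.
by apply: supgt_add => t w _; have := ler_distD (V t w) (U t w) (W t w).
Qed.

Lemma ucp_cvgP (Un : nat -> R -> Omega -> R) U : ucp_cvg P T Un U <->
  forall e, 0 < e -> exists N, forall m, (N <= m)%N ->
    outer_prob_le P (supgt T (fun t w => Un m t w - U t w) e) e.
Proof.
split=> [h e e0|h c e c0 e0]; first exact: h.
have [|N hN] := h (Num.min c e); first by rewrite lt_min c0 e0.
exists N => m /hN/outer_le h1; have {}h1 := h1 e.
apply: outer_sub (h1 _); last by rewrite ge_min lexx orbT.
by apply: supgt_le; rewrite ge_min lexx.
Qed.

Lemma ucp_subseq (Un : nat -> R -> Omega -> R) :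
  (forall e, 0 < e -> exists N, forall m l, (N <= m)%N -> (N <= l)%N ->
    outer_prob_le P (supgt T (fun t w => Un m t w - Un l t w) e) e) ->
  exists s : nat -> nat, (forall n, (n <= s n)%N) /\ (forall n, (s n <= s n.+1)%N) /\
  forall n m, (s n <= m)%N -> outer_prob_le P
    (supgt T (fun t w => Un (s n) t w - Un m t w) (1 / 2 ^+ n.+1)) (1 / 2 ^+ n.+1).
Proof.
move=> h; have /choice[g hg] : forall n, exists N, forall m l, (N <= m)%N -> (N <= l)%N ->
    outer_prob_le P (supgt T (fun t w => Un m t w - Un l t w) (1 / 2 ^+ n.+1)) (1 / 2 ^+ n.+1).
  by move=> n; apply: h; rewrite divr_gt0// exprn_gt0.
pose s := fix s n := if n is n'.+1 then maxn (maxn (s n') n) (g n) else g 0%N.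
have gs n : (g n <= s n)%N by case: n => //= n; rewrite leq_maxr.
exists s; split; first by case=> //= n; rewrite !leq_max leqnn orbT.
split; first by move=> n /=; rewrite !leq_max leqnn.
by move=> n m sm; apply: hg; rewrite ?gs// (leq_trans (gs n)).
Qed.

Lemma geo_dist (u : nat -> R) (K : nat) : (forall n, (K <= n)%N -> `|u n - u n.+1| <= 1 / 2 ^+ n.+1) ->
  cvgn u /\ forall n, (K <= n)%N -> `|u n - limn u| <= 1 / 2 ^+ n.
Proof.
move=> h; have H n m : (K <= n)%N -> `|u n - u (m + n)%N| <= 1 / 2 ^+ n - 1 / 2 ^+ (m + n).
  move=> Kn; elim: m => [|m IH]; first by rewrite add0n !subrr normr0.
  have := ler_distD (u (m + n)%N) (u n) (u (m.+1 + n)%N).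
  have := h (m + n)%N (leq_trans Kn (leq_addl _ _)).
  rewrite addSn; move: IH; rewrite [2 ^+ (m + n).+1]exprS.
  have -> : 1 / (2 * 2 ^+ (m + n)) = 1 / 2 ^+ (m + n) / 2 :> R by field; rewrite expf_neq0.
  lra.
have H1 n m : (K <= n)%N -> (n <= m)%N -> `|u n - u m| <= 1 / 2 ^+ n.
  move=> Kn /subnK <-; apply: le_trans (H n _ Kn) _.
  by rewrite gerBl divr_ge0// exprn_ge0.
have cu : cvgn u.
  apply/cauchy_cvgP/cauchy_exP => e e0.
  have [|n hn] := @half_pow_small (e / 2); first by rewrite divr_gt0.
  exists (u (maxn K n)); exists (maxn K n) => // m /= Nm; rewrite /ball/=.
  apply: (le_lt_trans (H1 _ _ (leq_maxl K n) Nm)).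
  have e1 : 1 / 2 ^+ maxn K n <= e / 2.
    apply: le_trans hn; rewrite ler_pM2l// lef_pV2 ?posrE ?exprn_gt0//.
    by rewrite ler_eXn2l ?ltr1n// leq_maxr.
  by apply: (le_lt_trans e1); lra.
split=> // n Kn; have cv : `|u n - u m| @[m --> \oo] --> `|u n - limn u|.
  by apply: cvg_norm; apply: cvgB => //; exact: cvg_cst.
rewrite -(cvg_lim _ cv)//; apply: limr_le; first by apply/cvg_ex; eexists; exact: cv.
by exists n => // m /=; exact: H1.
Qed.

Lemma ucp_complete (Un : nat -> R -> Omega -> R) :
  (forall e, 0 < e -> exists N, forall m l, (N <= m)%N -> (N <= l)%N ->
    outer_prob_le P (supgt T (fun t w => Un m t w - Un l t w) e) e) ->
  exists U, ucp_cvg P T Un U.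
Proof.
move=> /ucp_subseq[s [sn [si hs]]].
pose B n := supgt T (fun t w => Un (s n) t w - Un (s n.+1) t w) (1 / 2 ^+ n.+1).
pose U t w := limn (fun n => Un (s n) t w).
have HB K : outer_prob_le P (\bigcup_n B (n + K)%N) (1 / 2 ^+ K).
  apply: outer_bigcup; first by rewrite divr_ge0// exprn_ge0.
  move=> l; rewrite geo_split; exact: hs.
have HU K w t : ~ (\bigcup_n B (n + K)%N) w -> 0 <= t <= T -> `|Un (s K) t w - U t w| <= 1 / 2 ^+ K.
  move=> nB tT; apply: (geo_dist (K := K) _).2 => // n Kn.
  rewrite leNgt; apply/negP => h; apply: nB; exists (n - K)%N => //; rewrite subnK//.
  by exists t.
exists U; apply/ucp_cvgP => e e0; have [|K hK] := @half_pow_small (e / 2); first lra.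
have hK1 : 1 / 2 ^+ K.+1 <= e / 2.
  apply: le_trans hK; rewrite ler_pM2l// lef_pV2 ?posrE ?exprn_gt0//.
  by rewrite ler_eXn2l ?ltr1n.
exists (s K) => m sm; have h1 := hs K m sm.
have h2 : outer_prob_le P (supgt T (fun t w => Un (s K) t w - U t w) (1 / 2 ^+ K)) (1 / 2 ^+ K).
  apply: outer_sub (HB K) => w [t tT h]; apply: contrapT => nB.
  by have := HU K w t nB tT; rewrite leNgt h.
rewrite supgt_sym in h1; have h3 := supgt_tri h1 h2.
apply: (@outer_le _ _ _ _ _ (1 / 2 ^+ K.+1 + 1 / 2 ^+ K)); first lra.
by apply: outer_sub h3; apply: supgt_le; lra.
Qed.

Lemma ucp_ae (Un : nat -> R -> Omega -> R) U : ucp_cvg P T Un U ->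
  exists s : nat -> nat, (forall n, (n <= s n)%N) /\ {ae P, forall w, forall e, 0 < e -> exists N, forall n t,
    (N <= n)%N -> 0 <= t <= T -> `|Un (s n) t w - U t w| <= e}.
Proof.
move=> /ucp_cvgP h.
have /choice[s hs'] : forall n, exists m, (n <= m)%N /\ outer_prob_le P
    (supgt T (fun t w => Un m t w - U t w) (1 / 2 ^+ n.+1)) (1 / 2 ^+ n.+1).
  move=> n; have [|N hN] := h (1 / 2 ^+ n.+1); first by rewrite divr_gt0// exprn_gt0.
  by exists (maxn n N); rewrite leq_maxl; split=> //; apply: hN; exact: leq_maxr.
have hs n := (hs' n).2.
exists s; split; first by move=> n; exact: (hs' n).1.
 pose B n := supgt T (fun t w => Un (s n) t w - U t w) (1 / 2 ^+ n.+1).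
have HB K : outer_prob_le P (\bigcup_n B (n + K)%N) (1 / 2 ^+ K).
  apply: outer_bigcup; first by rewrite divr_ge0// exprn_ge0.
  move=> l; rewrite geo_split; exact: hs.
apply: outer0_negligible => e e0; have [K hK] := half_pow_small e0.
apply: outer_le hK _; apply: outer_sub (HB K) => w; apply: contra_notP => nB a a0.
have [K' hK'] := half_pow_small a0; exists (maxn K K') => n t; rewrite geq_max => /andP[Kn Kn'] tT.
apply: (@le_trans _ _ (1 / 2 ^+ n.+1)); last first.
  apply: le_trans hK'; rewrite ler_pM2l// lef_pV2 ?posrE ?exprn_gt0//.
  by rewrite ler_eXn2l ?ltr1n// ltnW.
rewrite leNgt; apply/negP => h1; apply: nB; exists (n - K)%N => //; rewrite subnK//.
by exists t.
Qed.

Lemma simple_int_bound k : 0 <= T -> exists2 B : R, 0 < B & forall V w (c : R), 0 <= c ->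
  (forall t, 0 <= t <= T -> `|V t w| <= c) -> forall t, 0 <= t <= T -> `|simple_int k V t w| <= B * c.
Proof.
move=> T0; have /choice[C hC] := fun i => @Defs.simple_bounded _ _ _ _ _ k i.
exists (\sum_i (2 * `|C i|) + 1); first by rewrite ltr_wpDl// sumr_ge0// => i _; rewrite mulr_ge0.
move=> V w c c0 hV t /andP[t0 tT]; rewrite mulrDl mul1r ler_wpDr// mulr_suml.
apply: le_trans (ler_norm_sum _ _ _) _; apply: ler_sum => i _; rewrite normrM.
have [l0 lr rT] := simple_times i.
rewrite (_ : 2 * `|C i| * c = `|C i| * (c + c)); last by ring.
apply: ler_pM => //; first exact: le_trans (hC i w) (ler_norm _).
have h1 : `|V (Num.min t (rgt i)) w| <= c.
  by apply: hV; rewrite le_min t0 ge_min tT (le_trans l0 lr).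
have h2 : `|V (Num.min t (lft i)) w| <= c by apply: hV; rewrite le_min t0 ge_min tT l0.
by apply: (le_trans (ler_normB _ _)); exact: lerD.
Qed.

(** Balls of Emery's topology as a relation, with one number for size and probability, so that the
    triangle inequality is additive. *)
Definition small V (e : R) : Prop := outer_prob_le P (supgt T V e) e /\
  forall k, le_val k (fun _ _ => 1) -> outer_prob_le P (supgt T (simple_int k V) e) e.

Definition eclose U V (e : R) : Prop := small (fun t w => U t w - V t w) e.

Lemma small_add U V a b : small U a -> small V b -> small (fun t w => U t w + V t w) (a + b).
Proof.
move=> [h1 h2] [h3 h4]; split; first by apply: supgt_add h1 h3 => t w _; exact: ler_normD.
move=> k kle; apply: supgt_add (h2 k kle) (h4 k kle) => t w _.
by rewrite simple_intD ler_normD.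
Qed.

Lemma small_ae U V e : {ae P, forall w, forall t, 0 <= t <= T -> U t w = V t w} ->
  small U e -> small V e.
Proof.
move=> UV [h1 h2]; split.
  apply: outer_aesub h1; apply: filterS UV => w UV [t tT h]; exists t => //.
  by rewrite UV.
move=> k kle; apply: outer_aesub (h2 k kle); apply: filterS UV => w UV [t tT h]; exists t => //.
have /andP[t0 _] := tT; by rewrite (simple_intY _ UV t0).
Qed.

Lemma eclose_le U V a b : a <= b -> eclose U V a -> eclose U V b.
Proof.
move=> ab [h1 h2]; split; first by apply: (outer_le ab); apply: outer_sub h1; exact: supgt_le.
by move=> k /h2 h; apply: (outer_le ab); apply: outer_sub h; exact: supgt_le.
Qed.

Lemma eclose_refl U e : 0 < e -> eclose U U e.
Proof.
move=> e0; have h V : (forall t w, V t w = 0) -> outer_prob_le P (supgt T V e) e.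
  move=> V0; apply: outer_negl (ltW e0) _; apply: negligibleS (negligible_set0 P) => w [t _].
  by rewrite V0 normr0 ltNge (ltW e0).
split; first by apply: h => t w; rewrite subrr.
move=> k _; apply: h => t w; rewrite /simple_int big1// => i _.
by rewrite !subrr mulr0.
Qed.

Lemma eclose_sym U V e : eclose U V e -> eclose V U e.
Proof.
move=> [h1 h2]; split; first by rewrite supgt_sym.
move=> k /h2; apply: outer_sub => w [t tT h]; exists t => //.
by rewrite simple_intB distrC -simple_intB.
Qed.

Lemma eclose_tri U V W a b : eclose U V a -> eclose V W b -> eclose U W (a + b).
Proof.
move=> [h1 h2] [h3 h4]; split; first exact: supgt_tri h1 h3.
move=> k kle; apply: supgt_add (h2 k kle) (h4 k kle) => t w _.
by rewrite !simple_intB (le_trans _ (ler_normD _ _))// addrA subrK.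
Qed.

(** Emery balls are closed under u.c.p. limits. For a fixed [k] the integral is continuous in the
    uniform norm with a constant depending on [k], and the index [l] may be chosen after [k]. *)
Lemma eclose_lim (Un : nat -> R -> Omega -> R) U e m : 0 <= T ->
  0 < e -> ucp_cvg P T Un U ->
  (exists N, forall l, (N <= l)%N -> eclose (Un m) (Un l) (e / 2)) -> eclose (Un m) U e.
Proof.
move=> T0 e0 /ucp_cvgP hU [N hN]; have e20 : 0 < e / 2 by lra.
split.
  have [N' hN'] := hU _ e20; pose l := maxn N N'.
  have [h1 _] := hN l (leq_maxl _ _); rewrite (splitr e).
  by apply: supgt_tri h1 _; apply: hN'; exact: leq_maxr.
move=> k kle; have [B B0 hB] := simple_int_bound k T0.
have d0 : 0 < Num.min (e / 2 / B) (e / 2) by rewrite lt_min e20 divr_gt0.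
have [N' hN'] := hU _ d0; pose l := maxn N N'.
have [_ /(_ k kle) h1] := hN l (leq_maxl _ _).
have h2 := hN' l (leq_maxr _ _).
rewrite (splitr e).
apply: (@supgt_add _ _ _ P T (simple_int k (fun t w => Un m t w - Un l t w)) (simple_int k (fun t w => Un l t w - U t w))) => //.
  by move=> t w _; rewrite !simple_intB (le_trans _ (ler_normD _ _))// addrA subrK.
apply: (@outer_le _ _ _ _ _ (Num.min (e / 2 / B) (e / 2))); first by rewrite ge_min lexx orbT.
apply: outer_sub h2 => w; apply: contraPP => /supgtC h [t tT].
apply/negP; rewrite -leNgt.
apply: (le_trans (hB _ w (Num.min (e / 2 / B) (e / 2)) (ltW d0) h t tT)).
by rewrite mulrC -ler_pdivlMr// ge_min lexx.
Qed.

Lemma emery_cvgP (Un : nat -> R -> Omega -> R) U : 0 <= T -> emery_cvg P F T Un U <->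
  forall e, 0 < e -> exists N, forall m, (N <= m)%N -> eclose (Un m) U e.
Proof.
move=> T0; split=> [[/ucp_cvgP h1 h2] e e0|h].
  have [N hN] := h1 e e0; have [N' hN'] := h2 e e e0 e0.
  exists (maxn N N') => m; rewrite geq_max => /andP[Nm Nm']; split; first exact: hN.
  by move=> k kle; apply: hN' => //.
split; first by apply/ucp_cvgP => e /h[N hN]; exists N => m /hN[].
move=> c e c0 e0; have [|N hN] := h (Num.min c e); first by rewrite lt_min c0 e0.
exists N => m /hN[_ h2] k kle; have {}h2 := h2 k kle.
apply: (@outer_le _ _ _ _ _ (Num.min c e)); first by rewrite ge_min lexx orbT.
by apply: outer_sub h2; apply: supgt_le; rewrite ge_min lexx.
Qed.

End UniformConvergence.

(** * Approximation of bounded integrands *)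

Section Approximation.
Context {d : measure_display} {Omega : measurableType d} {R : realType}.
Variables (P : probability Omega R) (F : R -> set (set Omega)) (T : R).
Hypotheses (T_gt0 : 0 < T) (Ffil : filtration F T).
Variables (ix : finType) (Ys : ix -> R -> Omega -> R).
Hypothesis Ys_good : forall i, good P F T (Ys i).
Implicit Types (k : simple_integrand F T) (D E : set (R * Omega)) (K : R -> Omega -> R) (J : ix -> R -> Omega -> R).

Let T_ge0 : 0 <= T := ltW T_gt0.
Notation Pi := (Pi T).
Notation elem := (elem F T).
Notation Cov := (cov elem (phi P F T Ys)).
Notation Meas := (meas elem (phi P F T Ys)).

Let elU := @elemU _ _ _ F T T_gt0 Ffil.
Let elD := @elemD _ _ _ F T T_gt0 Ffil.
Let pl D a b := @phi_le _ _ _ P F T ix Ys D a b.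
Let p0 a := @phi_0 _ _ _ P F T T_gt0 ix Ys a.
Let pU D E a b := @phi_U _ _ _ P F T T_gt0 Ffil ix Ys D E a b.

(** A cover by increasing elementary sets becomes a genuine size bound on an elementary set: the
    uncovered remainders decrease to points above [A], where [phi2_cont] applies. *)
Lemma abs_cov D E A (a p e : R) : elem D -> Cov E a -> outer_prob_le P A p ->
  (forall x, D x -> E x \/ A x.2) -> 0 < e -> phi2 P F T Ys D (a + e) (a + p + e).
Proof.
move=> eD [Dn [h1 h2 h3 h4]] Ap DE e0.
have [|||n hn] := @phi2_cont _ _ _ P F T T_gt0 Ffil _ Ys Ys_good (fun n => D `\` Dn n) A p e _ _ _ Ap e0.
- by move=> n; exact: elemD.
- by move=> n x [Dx nD]; split=> // /h2.
- move=> x h; have [Dx _] := h 0%N I.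
  have [/h4[n _ Dnx]|//] := DE x Dx.
  by have [_] := h n I.
apply: (@phi2_sub _ _ _ _ _ _ _ _ _ (Dn n `|` (D `\` Dn n))).
  by move=> x Dx; have [?|?] := pselect (Dn n x); [left|right].
rewrite -(addrA a p).
exact: (phi2U T_gt0 Ffil (h1 n) (elD eD (h1 n)) (h3 n) hn).
Qed.

Definition est k (b e : R) : Prop := forall i k', le_val k' (fun x w => `|simple_val k x w|) ->
  outer_prob_le P (gtset (simple_int k' (Ys i) T) b) e.

(* Split at the level c': the part of k above c' lives on E off the event A, where it is at most c. *)
Lemma est_layer k (c c' : R) E A (a p b e eta : R) : 0 < c -> 0 <= c' -> 0 < eta ->
  Cov E a -> outer_prob_le P A p ->
  (forall (x : R) w, 0 < x <= T -> A w \/ (`|simple_val k x w| <= c /\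
     (`|simple_val k x w| <= c' \/ E (x, w)))) ->
  (forall i k', le_val k' (fun x w => `|simple_val k x w|) -> le_val k' (fun _ _ => c') ->
    outer_prob_le P (gtset (simple_int k' (Ys i) T) b) e) ->
  est k (b + c * (a + eta)) (e + (p + (a + p + eta))).
Proof.
move=> c0 c'0 eta0 cE Ap kA hb i k' kk'.
pose D1 := [set x | Pi x /\ c' < `|simple_val k x.1 x.2|].
pose D2 := [set x | Pi x /\ c < `|simple_val k x.1 x.2|].
have eD1 : elem D1 by exact: elem_gt.
have eD2 : elem D2 by apply: elem_gt => //; exact: ltW.
have [k1 [k2 [h1 h2 h3]]] := simple_cut T_gt0 Ffil k' eD1.
have [k3 [k4 [h4 h5 h6]]] := simple_cut T_gt0 Ffil k1 eD2.
have [k5 h7] := simple_scale T_gt0 Ffil c^-1 k4.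
have cn : c != 0 by rewrite gt_eqF.
have h8 Y t w : simple_int k4 Y t w = c * simple_int k5 Y t w.
  rewrite (@simple_int_lin _ _ _ F T T_ge0 k4 k5 k5 c 0) ?mul0r ?addr0// => x w' xT.
  by rewrite h7// mulrA divff// mul1r mul0r addr0.
have p1 : outer_prob_le P (gtset (simple_int k2 (Ys i) T) b) e.
  have hk2 (x : R) w : 0 < x <= T -> `|simple_val k2 x w| = if c' < `|simple_val k x w| then 0 else `|simple_val k' x w|.
    move=> xT; rewrite h2// indicE; case: ifPn => cx; first by rewrite mem_set// subrr mulr0 normr0.
    by rewrite memNset ?subr0 ?mulr1//= => -[_] /=; apply/negP.
  apply: hb => x w xT; rewrite hk2//; case: ifPn => // cx; first exact: kk'.
  by apply: (le_trans (kk' x w xT)); rewrite leNgt.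
have p2 : outer_prob_le P (gtset (simple_int k3 (Ys i) T) 0) p.
  apply: outer_sub Ap => w; apply: contraPP => nA; rewrite /gtset/= simple_int_path0 ?normr0 ?ltxx//.
    by rewrite T_ge0 lexx.
  move=> x xT; rewrite h4// indicE memNset ?mulr0// => -[_ /=].
  by have [//|[h _]] := kA x w xT; rewrite ltNge h.
have p3 : outer_prob_le P (gtset (simple_int k4 (Ys i) T) (c * (a + eta))) (a + p + eta).
  have DE : forall x, (D1 `\` D2) x -> E x \/ A x.2.
    move=> [x w] [[xT /= h] nD2]; have [|[_ []]] := kA x w xT; [by right| |by left].
    by rewrite leNgt h.
  have ph := abs_cov (elemD T_gt0 Ffil eD1 eD2) cE Ap DE eta0.
  have : outer_prob_le P (gtset (simple_int k5 (Ys i) T) (a + eta)) (a + p + eta).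
    apply: ph => x w xT; rewrite h7// h5// h1// normrM (ger0_norm (x := c^-1)) ?invr_ge0 ?(ltW c0)//.
    rewrite !indicE in_setD; have [/set_mem m1|_] := boolP ((x, w) \in D1); last by rewrite mulr0 mul0r normr0 mulr0.
    have [_|m2] := boolP ((x, w) \in D2) => /=; first by rewrite subrr mulr0 normr0 mulr0.
    rewrite mulr1 subr0 mulr1 ler_pdivrMl// mulr1 (le_trans (kk' x w xT))//.
    by rewrite leNgt; apply/negP => h; move: m2; rewrite mem_set.
  apply: outer_sub => w; rewrite /gtset/= h8 normrM (gtr0_norm c0).
  by rewrite ltr_pM2l.
have p4 : outer_prob_le P (gtset (simple_int k1 (Ys i) T) (0 + c * (a + eta))) (p + (a + p + eta)).
  by apply: gtset_add p2 p3 => w; rewrite h6 ler_normD.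
rewrite -[c * _]add0r; apply: (@gtset_add _ _ _ P (simple_int k2 (Ys i) T) (simple_int k1 (Ys i) T)) => //.
  by move=> w; rewrite h3 addrC ler_normD.
Qed.

(** The larger height [c1] is charged only to [E1]; [E2] is charged only at height [c2]. This
    separation lets [c1] grow while [a1] shrinks in proportion. *)
Lemma est_two_layers k (c1 c2 eps r p a1 a2 eta : R) E1 E2 A :
  0 < c1 -> 0 < c2 -> 0 <= eps -> 0 < eta -> Cov E1 a1 -> Cov E2 a2 -> outer_prob_le P A p ->
  (forall (x : R) w, 0 < x <= T -> A w \/ [/\ `|simple_val k x w| <= c1,
     `|simple_val k x w| <= c2 \/ E1 (x, w) &
     `|simple_val k x w| <= eps \/ (E1 (x, w) \/ E2 (x, w))]) ->
  (forall i k', le_val k' (fun _ _ => eps) -> outer_prob_le P (gtset (simple_int k' (Ys i) T) r) r) ->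
  est k (r + c2 * (a1 + a2 + eta) + c1 * (a1 + eta))
    (r + (p + (a1 + a2 + p + eta)) + (p + (a1 + p + eta))).
Proof.
move=> c10 c20 eps0 eta0 cE1 cE2 Ap kA hr.
apply: (est_layer c10 (ltW c20) eta0 cE1 Ap).
  by move=> x w xT; have [|[h1 h2 _]] := kA x w xT; [left|right].
move=> i k' kk' k'c2.
have h : est k' (r + c2 * (a1 + a2 + eta)) (r + (p + (a1 + a2 + p + eta))).
  apply: (est_layer c20 eps0 eta0 (covU elU pU cE1 cE2) Ap).
    move=> x w xT; have [|[_ _ h3]] := kA x w xT; [by left|right; split; first exact: k'c2].
    by case: h3 => h3; [left; exact: le_trans (kk' x w xT) h3|right].
  by move=> l k1 _ k1e; exact: hr.
by apply: h => x w xT.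
Qed.

Lemma rho_family (a : R) : 0 < a -> exists2 e : R, 0 < e & forall i k,
  le_val k (fun _ _ => e) -> outer_prob_le P (gtset (simple_int k (Ys i) T) a) a.
Proof.
move=> a0; have /choice[e he] : forall i, exists e : R, 0 < e /\ forall k,
    le_val k (fun _ _ => e) -> outer_prob_le P (gtset (simple_int k (Ys i) T) a) a.
  by move=> i; have [e e0 h] := good_rho T_gt0 Ffil (Ys_good i) a0; exists e.
exists (\big[Num.min/1]_i e i).
  by apply: lt_bigmin => // i _; exact: (he i).1.
move=> i k kle; apply: (he i).2; apply: le_val_trans kle _ => x w _.
exact: bigmin_le_cond.
Qed.

(** The threshold [del] has two tasks: as a height it is harmless by [rho_family], and as the size
    of the bad set it remains small after multiplication by the bound [C]. *)
Lemma simple_small (C e : R) : 0 < e -> exists2 del : R, 0 < del & forall k,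
  le_val k (fun _ _ => C) -> Cov [set x | Pi x /\ del < `|simple_val k x.1 x.2|] del -> est k e e.
Proof.
move=> e0; have e20 : 0 < e / 2 by lra.
have [r r0 hr] := rho_family e20.
have C0 : 0 < `|C| + 1 by rewrite ltr_wpDl.
(* Then [(|C| + 1) * (q + q) = e / 2], the allowance left for the bad set. *)
pose q := e / (4 * (`|C| + 1)).
have q0 : 0 < q by rewrite divr_gt0// mulr_gt0.
have qe : q <= e / 4.
  rewrite /q ler_pdivrMr ?mulr_gt0// mulrA divfK ?gt_eqF// ler_peMr ?(ltW e0)//.
  by rewrite lerDr.
have d0 : 0 < Num.min r q by rewrite lt_min r0.
exists (Num.min r q) => // k kC cE i k' kk'.
have N0 : outer_prob_le P (@set0 Omega) 0 by apply: outer_negl => //; exact: negligible_set0.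
have H : est k (e / 2 + (`|C| + 1) * (Num.min r q + Num.min r q)) (e / 2 + (0 + (Num.min r q + 0 + Num.min r q))).
  apply: (@est_layer k (`|C| + 1) (Num.min r q) _ set0 (Num.min r q) 0 _ _ (Num.min r q) C0 (ltW d0) d0 cE N0).
    move=> x w xT; right; split.
      by apply: (le_trans (kC x w xT)); apply: (le_trans (ler_norm _)); rewrite lerDl.
    by have [h|h] := leP `|simple_val k x w| (Num.min r q); [left|right].
  move=> l k1 _ k1r; apply: hr; apply: le_val_trans k1r _ => x w _.
  by rewrite ge_min lexx.
have h1 : Num.min r q <= q by rewrite ge_min lexx orbT.
apply: (@outer_le _ _ _ _ _ (e / 2 + (0 + (Num.min r q + 0 + Num.min r q)))); first lra.
apply: outer_sub (H i k' kk'); apply: gtset_le.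
have h2 : (`|C| + 1) * (Num.min r q + Num.min r q) <= (`|C| + 1) * (q + q).
  by rewrite ler_wpM2l ?(ltW C0)// lerD.
have h3 : (`|C| + 1) * (q + q) = e / 2 by rewrite /q; field; rewrite gt_eqF.
lra.
Qed.

(** Stopping, and multiplication by a test integrand bounded by 1, stay among integrands dominated
    by [|k|], so terminal bounds give the full Emery bound. *)
Lemma est_small k (e : R) i : est k e e -> small P F T (simple_int k (Ys i)) e.
Proof.
move=> he; split.
  by apply: (stop T_gt0 Ffil (Ys_good i).1) => k' kk'; exact: he.
move=> k1 k1le; have [kk hkk] := simple_mul T_gt0 Ffil k1 k.
rewrite (_ : simple_int k1 (simple_int k (Ys i)) = simple_int kk (Ys i)); last first.
  by apply/funext => t; apply/funext => w; rewrite (simple_int_comp T_ge0 _ _ _ hkk).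
apply: (stop T_gt0 Ffil (Ys_good i).1) => k' kk'; apply: he; apply: le_val_trans kk' _ => x w xT.
by rewrite hkk// normrM ler_piMl// k1le.
Qed.

Lemma est_eclose k1 k2 kd (e : R) i : (forall (x : R) w, 0 < x <= T ->
    simple_val kd x w = simple_val k1 x w - simple_val k2 x w) ->
  est kd e e -> eclose P F T (simple_int k1 (Ys i)) (simple_int k2 (Ys i)) e.
Proof.
move=> hkd he; rewrite /eclose (_ : (fun t w => _) = simple_int kd (Ys i)); first exact: est_small.
apply/funext => t; apply/funext => w.
rewrite (@simple_int_lin _ _ _ F T T_ge0 kd k1 k2 1 (-1)) ?mul1r ?mulN1r// => x w' xT.
by rewrite hkd// mul1r mulN1r.
Qed.

(** One simple integrand must serve every member of the family; the common bound [C] keeps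
    [simple_small] applicable to differences of approximants. *)
Definition capprox K (J : ix -> R -> Omega -> R) (C : R) : Prop := forall del : R, 0 < del ->
  exists k, [/\ le_val k (fun _ _ => C),
    Cov [set x | Pi x /\ del < `|K x.1 x.2 - simple_val k x.1 x.2|] del &
    forall j, eclose P F T (simple_int k (Ys j)) (J j) del].

Lemma cov_dist K K1 K2 (a b : R) : Cov [set x | Pi x /\ a < `|K x.1 x.2 - K1 x.1 x.2|] a ->
  Cov [set x | Pi x /\ b < `|K x.1 x.2 - K2 x.1 x.2|] b ->
  Cov [set x | Pi x /\ a + b < `|K1 x.1 x.2 - K2 x.1 x.2|] (a + b).
Proof.
move=> h1 h2; have := covU elU pU h1 h2.
apply: cov_sub => x [xP h].
have [g|g] := ltP a `|K x.1 x.2 - K1 x.1 x.2|; [by left|right; split=> //].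
have := ler_distD (K x.1 x.2) (K1 x.1 x.2) (K2 x.1 x.2); rewrite (distrC (K1 _ _) (K _ _)); lra.
Qed.

Lemma cov_mono K (a b : R) : a <= b -> Cov [set x | Pi x /\ a < `|K x.1 x.2|] a ->
  Cov [set x | Pi x /\ b < `|K x.1 x.2|] b.
Proof.
move=> ab h; apply: (cov_le pl ab); apply: cov_sub h => x [xP h]; split=> //.
exact: le_lt_trans h.
Qed.

(** [del] depends only on the bound and on [e]. This uniformity makes the integrals of a convergent
    sequence Cauchy against every process of the family. *)
Lemma approx_close (C e : R) : 0 < e -> exists2 del : R, 0 < del & forall K J K' J',
  capprox K J C -> capprox K' J' C -> Cov [set x | Pi x /\ del < `|K x.1 x.2 - K' x.1 x.2|] del ->
  forall j, eclose P F T (J j) (J' j) e.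
Proof.
move=> e0; have e30 : 0 < e / 3 by lra.
have [d0 d00 hd] := simple_small (C + C) e30.
pose q := Num.min (d0 / 3) (e / 3).
have q0 : 0 < q by rewrite lt_min e30 divr_gt0.
have [q1 q2] : q <= d0 / 3 /\ q <= e / 3 by rewrite !ge_min !lexx orbT.
exists q => // K J K' J' hK hK' cKK j.
have [k [kC kcov kJ]] := hK q q0; have [k' [k'C k'cov k'J]] := hK' q q0.
have [kd hkd] := simple_add T_gt0 Ffil k k' 1 (-1).
have {}hkd (x : R) w : 0 < x <= T -> simple_val kd x w = simple_val k x w - simple_val k' x w.
  by move=> xT; rewrite hkd// mul1r mulN1r.
have c1 := cov_dist kcov cKK.
have c2 : Cov [set x | Pi x /\ q + (q + q) < `|simple_val kd x.1 x.2|] (q + (q + q)).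
  have h3 : Cov [set x | Pi x /\ q + q < `|K' x.1 x.2 - simple_val k x.1 x.2|] (q + q).
    by apply: cov_sub c1 => x [xP h]; split=> //; rewrite distrC.
  have h4 := cov_dist k'cov h3; apply: cov_sub h4 => x [xP h]; split=> //.
  by rewrite distrC -hkd.
have c3 : est kd (e / 3) (e / 3).
  apply: hd; last by apply: cov_mono c2; lra.
  by move=> x w xT; rewrite hkd// (le_trans (ler_normB _ _))// lerD ?kC ?k'C.
have h1 := est_eclose j hkd c3.
have h2 := eclose_sym (kJ j); have h3 := k'J j.
apply: eclose_le (eclose_tri (eclose_tri h2 h1) h3); lra.
Qed.

Lemma approx_simple k (C : R) : le_val k (fun _ _ => C) ->
  capprox (simple_val k) (fun j => simple_int k (Ys j)) C.
Proof.
move=> kC del d0; exists k; split=> //; last by move=> j; exact: eclose_refl.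
exists (fun=> set0); split.
- by move=> n; exact: elem0.
- by move=> n.
- by move=> n; apply: phi_0 => //; exact: ltW.
- by move=> x [_]; rewrite subrr normr0 ltNge (ltW d0).
Qed.

(** Each stage of the induction on [bounded_int] yields its own bound, while the passage to the
    limit needs a common one; clipping at a bound of [K] brings the approximants no farther from
    [K]. *)
Lemma approx_clip K J (C C' : R) : capprox K J C -> 0 <= C' ->
  (forall x w, 0 < x <= T -> `|K x w| <= C') -> capprox K J C'.
Proof.
move=> hK C'0 KC del d0; have d20 : 0 < del / 2 by lra.
have [d1 d10 hd] := simple_small (C' + C) d20.
pose q := Num.min d1 (del / 2).
have q0 : 0 < q by rewrite lt_min d20 d10.
have [q1 q2] : q <= d1 /\ q <= del / 2 by rewrite !ge_min !lexx orbT.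
have [k [kC kcov kJ]] := hK q q0.
pose cl (y : R) : R := Num.max (- C') (Num.min C' y).
have clC y : `|cl y| <= C' by rewrite ler_norml /cl le_max lexx/= ge_max ge_min lexx/= andbT; lra.
have clD y z : `|z| <= C' -> `|z - cl y| <= `|z - y| /\ `|cl y - y| <= `|z - y|.
  rewrite ler_norml => /andP[z1 z2]; rewrite /cl.
  have [h|h] := leP C' y.
    by rewrite max_r ?(ler0_norm (x := z - C')) ?(ler0_norm (x := C' - y)) ?(ler0_norm (x := z - y)); try split; lra.
  have [h'|h'] := leP (- C') y; first by rewrite subrr normr0 lexx normr_ge0.
  by rewrite (ger0_norm (x := z - - C')) ?(ger0_norm (x := - C' - y)) ?(ger0_norm (x := z - y)); try split; lra.
have [||kc hkc] := @simple_map2 _ _ _ F T T_ge0 Ffil (fun p => cl p.1) k k.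
- apply: measurable_maxr => //; apply: measurable_minr => //; exact: measurable_fst.
- by move=> C0; exists C' => x y _ _; exact: clC.
have [kd hkd] := simple_add T_gt0 Ffil kc k 1 (-1).
have {}hkd (x : R) w : 0 < x <= T -> simple_val kd x w = simple_val kc x w - simple_val k x w.
  by move=> xT; rewrite hkd// mul1r mulN1r.
exists kc; split.
- by move=> x w xT; rewrite hkc.
- apply: (cov_mono (K := fun x w => K x w - simple_val kc x w) (a := q)); first lra.
  apply: cov_sub kcov => -[x w] [xP /= h]; split=> //=; apply: (lt_le_trans h).
  by rewrite hkc//; apply: (clD _ _ _).1; exact: KC.
have c3 : est kd (del / 2) (del / 2).
  apply: hd.
    by move=> x w xT; rewrite hkd// (le_trans (ler_normB _ _))// lerD ?kC// hkc.
  apply: (cov_mono q1); apply: cov_sub kcov => -[x w] [xP /= h]; split=> //=; apply: (lt_le_trans h).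
  by rewrite hkd// hkc//; apply: (clD _ _ _).2; exact: KC.
move=> j; have h1 := est_eclose j hkd c3; have h2 := kJ j.
by apply: eclose_le (eclose_tri h1 h2); lra.
Qed.

(** Only the trace on [Pi] is tested, so that this is a sigma-algebra on the whole product space. *)
Definition mG : set (set (R * Omega)) := [set E | Meas (Pi `&` E)].

Lemma Meas_elem D : elem D -> Meas D.
Proof. exact: (meas_A (elem0 T_gt0 Ffil) p0). Qed.

Lemma mG_sigma : sigma_algebra setT mG.
Proof.
split.
- by rewrite /mG/= setI0; apply: Meas_elem; exact: elem0.
- move=> E hE; rewrite /mG/= setTD (_ : Pi `&` ~` E = Pi `\` (Pi `&` E)).
    apply: (measD elU elD pl pU) => //.
    by apply: Meas_elem; exact: elem_Pi.
  by rewrite setDIr setDv set0U setDE.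
- move=> E hE; rewrite /mG/= setI_bigcupr.
  exact: (meas_bigcup (elem0 T_gt0 Ffil) elU elD pl p0 pU (phi_exhaustive T_gt0 Ffil Ys_good)).
Qed.

Definition cmeas K : Prop := Fmeas mG (fun x : R * Omega => K x.1 x.2).

Lemma mG_ext (E E' : set (R * Omega)) : (forall x, Pi x -> E x <-> E' x) -> mG E -> mG E'.
Proof.
by move=> h; rewrite /mG/= (_ : Pi `&` E = Pi `&` E')//; apply/seteqP; split => x [xP Ex]; split=> //; exact/(h x xP).
Qed.

Lemma cmeas_gt K (a : R) : cmeas K -> Meas [set x | Pi x /\ a < `|K x.1 x.2|].
Proof.
move=> mK; have -> : [set x | Pi x /\ a < `|K x.1 x.2|] = Pi `&` ((fun x => K x.1 x.2) @^-1` [set y : R | a < `|y|]).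
  by [].
exact: (mK _ (gtset_measurable (f := fun y : R => y) a (@measurable_id _ _ _))).
Qed.

Lemma cmeas_ext K K' : (forall x w, 0 < x <= T -> K x w = K' x w) -> cmeas K -> cmeas K'.
Proof.
move=> h mK B mB; apply: mG_ext (mK B mB) => -[x w] /= xP.
by rewrite /preimage/= h.
Qed.

Lemma cmeas_simple k : cmeas (simple_val k).
Proof.
move=> B mB; rewrite /mG/=; apply: Meas_elem; split; first by move=> x [].
have [||k' hk'] := @simple_map2 _ _ _ F T T_ge0 Ffil (fun p => \1_B p.1) k k.
- by apply: measurableT_comp => //; exact: measurable_fst.
- by move=> C; exists 1 => x y _ _ /=; rewrite indicE; case: (_ \in _); rewrite ?normr1 ?normr0.
exists k' => x w xT; rewrite hk'// !indicE; congr (_%:R); congr nat_of_bool.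
by apply/idP/idP => /set_mem h; apply/mem_set => //; case: h.
Qed.

Lemma cmeasB K K' : cmeas K -> cmeas K' -> cmeas (fun x w => K x w - K' x w).
Proof. exact: (FmeasB mG_sigma). Qed.

Lemma cmeas_cvg (Kn : nat -> R -> Omega -> R) K : (forall m, cmeas (Kn m)) ->
  (forall t w, 0 < t <= T -> Kn m t w @[m --> \oo] --> K t w) -> cmeas K.
Proof.
(* Convergence is assumed only for times in [(0, T]]; cutting to 0 elsewhere makes it hold at every
   point without changing [cmeas]. *)
move=> mK cK; pose cut K' (x : R) (w : Omega) : R := if 0 < x <= T then K' x w else 0.
have E K' : cmeas K' <-> cmeas (cut K').
  by split; apply: cmeas_ext => x w xT; rewrite /cut xT.
apply/E/(FmeasP mG_sigma).
apply: (measurable_fun_cvg (h := fun m (x : g_sigma_algebraType mG) => cut (Kn m) x.1 x.2)).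
- move=> m; apply: (FmeasP mG_sigma _).1; exact: (E (Kn m)).1 (mK m).
- move=> [x w] _ /=; rewrite /cut; case: ifPn => xT; first exact: cK.
  exact: cvg_cst.
Qed.

Lemma bounded_int_cmeas Y K I : bounded_int P F T Y K I -> cmeas K.
Proof.
elim=> [k|Kn In K' I' C _ IH _ cK _]; first exact: cmeas_simple.
exact: cmeas_cvg IH cK.
Qed.

Lemma cov_decr (E : nat -> set (R * Omega)) (a : R) : (forall n, Meas (E n)) ->
  (forall n, E n.+1 `<=` E n) -> \bigcap_n E n = set0 -> 0 < a ->
  exists N, forall m, (N <= m)%N -> Cov (E m) a.
Proof.
move=> mE Ed E0 a0.
have [N hN] := meas_cont (elem0 T_gt0 Ffil) elU elD pl p0 pU (phi_exhaustive T_gt0 Ffil Ys_good) mE Ed E0 a0.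
exists N => m Nm; apply: cov_sub hN; rewrite -(subnK Nm).
elim: (m - N)%N => [//|l IH]; rewrite addSn; exact: subset_trans (Ed _) IH.
Qed.

(** Egorov's argument for the submeasure: the sets of points with a deviation after stage [n]
    decrease to the empty set. *)
Lemma cov_cvg (Kn : nat -> R -> Omega -> R) K (a : R) : (forall m, cmeas (Kn m)) ->
  (forall t w, 0 < t <= T -> Kn m t w @[m --> \oo] --> K t w) -> 0 < a ->
  exists N, forall m, (N <= m)%N -> Cov [set x | Pi x /\ a < `|Kn m x.1 x.2 - K x.1 x.2|] a.
Proof.
move=> mK cK a0; have mKl := cmeas_cvg mK cK.
pose E n := \bigcup_l [set x | Pi x /\ a < `|Kn (l + n)%N x.1 x.2 - K x.1 x.2|].
have [|||N hN] := @cov_decr E a _ _ _ a0.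
- move=> n; apply: (meas_bigcup (elem0 T_gt0 Ffil) elU elD pl p0 pU (phi_exhaustive T_gt0 Ffil Ys_good)) => l.
  apply: (cmeas_gt (K := fun x w => Kn (l + n)%N x w - K x w)); exact: cmeasB.
- by move=> n x [l _]; rewrite -addSnnS => h; exists l.+1.
- apply/seteqP; split => // x h; have xP : Pi x by have [l _ []] := h 0%N I.
  have /cvgrPdist_lt/(_ a a0)[n _ hn] := cK x.1 x.2 xP.
  have [l _ [_]] := h n I; rewrite distrC ltNge ltW//; apply: hn => /=.
  exact: leq_addl.
exists N => m /hN; apply: cov_sub => x h; by exists 0%N.
Qed.

Lemma cov_fin (I : eqType) (s : seq I) (E : I -> set (R * Omega)) (a : R) :
  (forall i, Cov (E i) a) -> Cov [set x | exists2 i, i \in s & E i x] ((size s)%:R * a).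
Proof.
move=> h; elim: s => [|i s IH].
  rewrite mul0r; apply: cov_sub (phi_cov (elem0 T_gt0 Ffil) (p0 (lexx 0))).
  by move=> x [].
rewrite /= -nat1r mulrDl mul1r; apply: cov_sub (covU elU pU (h i) IH) => x [j].
by rewrite inE => /orP[/eqP->|js] Ex; [left|right; exists j].
Qed.

(* The same limit procedure defines the integrals of K against all processes of the family. *)
Lemma bounded_int_approx i K (I : R -> Omega -> R) : bounded_int P F T (Ys i) K I ->
  exists J (C : R), [/\ J i = I, forall j, bounded_int P F T (Ys j) K (J j),
    forall x w, 0 < x <= T -> `|K x w| <= C & capprox K J C].
Proof.
elim=> {K I} [k|Kn In K I C Kint IH KC cK cI].
  have [C C0 hC] := simple_val_bounded k.
  exists (fun j => simple_int k (Ys j)), C; split=> //; first by move=> j; exact: bounded_int_simple.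
  by apply: approx_simple => x w _; exact: hC.
have {}IH m : exists J, [/\ J i = In m, forall j, bounded_int P F T (Ys j) (Kn m) (J j) &
    capprox (Kn m) J `|C|].
  have [J [C' [h1 h2 h3 h4]]] := IH m; exists J; split=> //.
  apply: approx_clip h4 _ _ => // x w xT; exact: le_trans (KC m x w xT) (ler_norm _).
have /choice[Jn hJn] := IH.
have mK m : cmeas (Kn m) by exact: bounded_int_cmeas (Kint m).
have Jcauchy e : 0 < e -> exists N, forall m l, (N <= m)%N -> (N <= l)%N ->
    forall j, eclose P F T (Jn m j) (Jn l j) e.
  move=> e0; have [del d0 hd] := approx_close `|C| e0.
  have [|N hN] := cov_cvg mK cK (a := del / 2); first lra.
  exists N => m l Nm Nl j; have [_ _ am] := hJn m; have [_ _ al] := hJn l.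
  apply: (hd _ _ _ _ am al).
  rewrite [del]splitr; apply: (cov_dist (K := K)).
    by apply: cov_sub (hN m Nm) => x [xP h]; split=> //; rewrite distrC.
  by apply: cov_sub (hN l Nl) => x [xP h]; split=> //; rewrite distrC.
have /choice[J0 hJ0] : forall j, exists U, ucp_cvg P T (fun m => Jn m j) U.
  move=> j; apply: ucp_complete => e /Jcauchy[N hN]; exists N => m l Nm Nl.
  by have [] := hN m l Nm Nl j.
(* A u.c.p. limit is only a version; at index [i] the prescribed version [I] is kept. *)
pose J j := if j == i then I else J0 j.
have hJ j : ucp_cvg P T (fun m => Jn m j) (J j).
  rewrite /J; case: eqP => [->|_]; last exact: hJ0.
  by rewrite (_ : (fun m => Jn m i) = In)//; apply/funext => m; have [] := hJn m.
have KC' x w : 0 < x <= T -> `|K x w| <= `|C|.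
  move=> xT; have cv : `|Kn m x w| @[m --> \oo] --> `|K x w| by apply: cvg_norm; exact: cK.
  rewrite -(cvg_lim _ cv)//; apply: limr_le; first by apply/cvg_ex; eexists; exact: cv.
  by apply: nearW => m; exact: le_trans (KC m x w xT) (ler_norm _).
exists J, `|C|; split=> //; first by rewrite /J eqxx.
- move=> j; apply: (@bounded_int_lim _ _ _ P F T (Ys j) Kn (fun m => Jn m j) K (J j) C) => //.
  by move=> m; have [_ h _] := hJn m.
- move=> del d0; have d20 : 0 < del / 2 by lra. 
  have [N hN] := Jcauchy (del / 2 / 2) (divr_gt0 d20 (ltr0n _ 2)).
  have [N' hN'] := cov_cvg mK cK d20; pose m := maxn N N'.
  have [_ _ am] := hJn m; have [k [k1 k2 k3]] := am _ d20.
  exists k; split=> //.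
    rewrite [del]splitr; apply: (cov_dist (K := Kn m)) => //.
    by apply: hN'; exact: leq_maxr.
  move=> j; rewrite [del]splitr; apply: eclose_tri (k3 j) _.
  apply: (eclose_lim T_ge0 d20 (hJ j)); exists N => l Nl; apply: hN => //; exact: leq_maxl.
Qed.

End Approximation.

(** * Jumps of stochastic integrals *)

Section Sections.
Context {d : measure_display} {Omega : measurableType d} {R : realType}.
Variables (F : R -> set (set Omega)) (T : R).
Hypotheses (Ffil : filtration F T).

Lemma predictable_section K t : predictable F T K -> 0 <= t <= T -> Fmeas (F t) (K t).
Proof.
move=> pK tT B mB; have := pK B mB.
pose H := [set D : set (R * Omega) | F t [set w | D (t, w)]].
have st := Fsigma Ffil tT; have [F0 FC FU] := st; have /andP[t0 t1] := tT.
suff : <<s `[0, T] `*` setT, predictable_rectangles F T >> `<=` H.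
  move=> /[apply]; rewrite /H/= (_ : [set w | _] = K t @^-1` B)//.
  apply/seteqP; split => w /=; first by move=> [].
  by move=> h; split=> //; rewrite in_itv/= tT.
have FT : F t setT by rewrite -(setC0 ) -setTD; exact: FC.
apply: smallest_sub.
  split; first by rewrite /H/= (_ : [set w | _] = set0).
    move=> D hD; rewrite /H/= (_ : [set w | _] = setT `\` [set w | D (t, w)]); first exact: FC.
    apply/seteqP; split => w /=; first by move=> [_].
    by move=> [_ h]; split=> //; rewrite in_itv/= tT.
  move=> D hD; rewrite /H/= (_ : [set w | _] = \bigcup_l [set w | D l (t, w)]); first exact: FU.
  by apply/seteqP; split => w [l _ h]; exists l.
move=> D [[A FA ->]|[s [u [A [s0 su uT FA ->]]]]]; rewrite /H/=.
  have [->|tn] := eqVneq t 0.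
    rewrite (_ : [set w | _] = A)//.
    by apply/seteqP; split => w /=; [case|].
  rewrite (_ : [set w | _] = set0)//; apply/seteqP; split => w //= -[h _].
  by rewrite h eqxx in tn.
have [/andP[st' tu]|ns] := boolP (s < t <= u).
  rewrite (_ : [set w | _] = A); first by apply: Ffil.2 FA => //; exact: ltW.
  by apply/seteqP; split => w /=; [case|rewrite in_itv/= st' tu].
rewrite (_ : [set w | _] = set0)//; apply/seteqP; split => w //= -[].
by rewrite in_itv/= (negbTE ns).
Qed.

Lemma wealth_adapted n (S : R -> Omega -> 'cV[R]_n) theta :
  (forall i, adapted F T (fun t w => S t w i ord0)) -> predictable_vec F T theta ->
  adapted F T (wealth S theta).
Proof.
move=> aS pth t tT; rewrite (_ : wealth S theta t = fun w => \sum_i theta t w ord0 i * S t w i ord0).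
  apply: (Fmeas_sum (Fsigma Ffil tT)) => i; apply: (FmeasM (Fsigma Ffil tT)); last exact: aS.
  exact: (predictable_section (pth i)).
by apply/funext => w; rewrite /wealth mxE.
Qed.

End Sections.

Section Jumps.
Context {R : realType} (T : R).

(* D s t stands for the increment over [s, t] that I must asymptotically reproduce as s increases to t. *)
Definition jumps (I : R -> R) (D : R -> R -> R) : Prop := forall t, 0 < t <= T -> forall e, 0 < e ->
  exists2 h : R, 0 < h & forall s, 0 <= s -> t - h < s < t -> `|I t - I s - D s t| < e.

Lemma jumps_lim (In : nat -> R -> R) Dn I D : (forall n, jumps (In n) (Dn n)) ->
  (forall e, 0 < e -> exists N, forall n t, (N <= n)%N -> 0 <= t <= T -> `|In n t - I t| <= e) ->
  (forall t e, 0 < t <= T -> 0 < e -> exists N, forall n s, (N <= n)%N -> 0 <= s <= T ->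
     `|Dn n s t - D s t| <= e) -> jumps I D.
Proof.
move=> hj hI hD t tT e e0; have e40 : 0 < e / 4 by lra.
have [N hN] := hI _ e40; have [N' hN'] := hD t _ tT e40.
have [h h0 H] := hj (maxn N N') t tT _ e40; exists h => // s s0 st.
have /andP[_ st'] := st; have /andP[t0 t1] := tT.
have sT : 0 <= s <= T by rewrite s0 (le_trans (ltW st')).
have h1 := H s s0 st; have h2 := hN (maxn N N') t (leq_maxl _ _).
have {}h2 : `|In (maxn N N') t - I t| <= e / 4 by apply: h2; rewrite (ltW t0).
have h3 := hN (maxn N N') s (leq_maxl _ _) sT; have h4 := hN' (maxn N N') s (leq_maxr _ _) sT.
move: h1 h2 h3 h4; rewrite !ltr_norml !ler_norml => /andP[? ?] /andP[? ?] /andP[? ?] /andP[? ?].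
by apply/andP; split; lra.
Qed.

Lemma jumps_sum (ix : Type) (s : seq ix) (Is : ix -> R -> R) (Ds : ix -> R -> R -> R) :
  (forall i, jumps (Is i) (Ds i)) ->
  jumps (fun t => \sum_(i <- s) Is i t) (fun u t => \sum_(i <- s) Ds i u t).
Proof.
move=> hj; elim: s => [|i s IH] t tT e e0.
  by exists 1 => // u _ _; rewrite !big_nil !subrr normr0.
have e20 : 0 < e / 2 by lra.
have [h h0 H] := hj i t tT _ e20; have [h' h'0 H'] := IH t tT _ e20.
exists (Num.min h h'); first by rewrite lt_min h0.
move=> u u0 /andP[u1 u2].
have [m1 m2] : Num.min h h' <= h /\ Num.min h h' <= h' by rewrite !ge_min !lexx orbT.
have h1 : `|Is i t - Is i u - Ds i u t| < e / 2 by apply: H => //; rewrite u2 andbT; lra.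
have {}H' := H' u u0; have h2 := H' _; have {}h2 : t - h' < u < t by rewrite u2 andbT; lra.
have {}H' := H' h2; rewrite !big_cons.
move: h1 H'; rewrite !ltr_norml => /andP[? ?] /andP[? ?].
by apply/andP; split; lra.
Qed.

Lemma rcont_bound_lim (In : nat -> R -> R) I : (forall n, rcont T (In n) /\ bounded01 T (In n)) ->
  (forall e, 0 < e -> exists N, forall n t, (N <= n)%N -> 0 <= t <= T -> `|In n t - I t| <= e) ->
  rcont T I /\ bounded01 T I.
Proof.
move=> hI hU; split.
  apply: (unif_rcont (fn := In)); first by move=> n; exact: (hI n).1.
  by move=> e /hU[N hN]; exists N => t; exact: hN.
have [N hN] := hU 1 ltr01; have [_ [c hc]] := hI N; exists (c + 1) => t tT.
have := hN N t (leqnn _) tT; have := hc t tT.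
by rewrite !ler_norml => /andP[? ?] /andP[? ?]; apply/andP; split; lra.
Qed.

End Jumps.

Section IntegralPaths.
Context {d : measure_display} {Omega : measurableType d} {R : realType}.
Variables (P : probability Omega R) (F : R -> set (set Omega)) (T : R).
Hypotheses (T_gt0 : 0 < T) (Ffil : filtration F T).
Let T_ge0 : 0 <= T := ltW T_gt0.

Lemma ae_all (Q : nat -> Omega -> Prop) : (forall n, {ae P, forall w, Q n w}) ->
  {ae P, forall w, forall n, Q n w}.
Proof.
move=> h; have : P.-negligible (\bigcup_n ~` [set w | Q n w]).
  by apply: negligible_bigcup => n; exact: h.
apply: negligibleS => w /= /existsNP[n hn]; by exists n.
Qed.

Lemma ae_fin (ix : finType) (Q : ix -> Omega -> Prop) : (forall i, {ae P, forall w, Q i w}) ->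
  {ae P, forall w, forall i, Q i w}.
Proof.
move=> h; have H : {ae P, forall w, forall (n : nat) i, n = enum_rank i -> Q i w}.
  apply: ae_all => n; have [hn|hn] := boolP (n < #|ix|)%N; last first.
    by apply: aeW => w i ni; move: hn; rewrite ni ltn_ord.
  apply: filterS (h (enum_val (Ordinal hn))) => w hw i ni.
  have <- : enum_val (Ordinal hn) = i by rewrite -[RHS]enum_rankK; congr enum_val; exact/val_inj.
  exact: hw.
apply: filterS H => w hw i; exact: (hw (enum_rank i)).
Qed.

Definition int_path (Y K I : R -> Omega -> R) (w : Omega) : Prop :=
  [/\ rcont T (I ^~ w), bounded01 T (I ^~ w) &
    jumps T (I ^~ w) (fun s t => K t w * (Y t w - Y s w))].

(** On a cell a simple integral moves exactly by the integrand times the increment of [Y]. The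
    relation survives limits because increments of a bounded path are uniformly bounded, so
    convergence of [Kn] at the single time [t] suffices. *)
Lemma bounded_int_path Y K I : regular P F T Y -> bounded_int P F T Y K I ->
  {ae P, forall w, int_path Y K I w}.
Proof.
move=> [_ rY]; elim=> {K I} [k|Kn In K I C _ IH KC cK cI].
  apply: filterS rY => w [rc bd]; split; first exact: rcont_simple_int.
    exact: bounded01_simple_int.
  have [|t [r [tg tp]]] := @grid_exists _ T T_ge0 (ends k); first exact: ends_in.
  have kc : compat k t r by exact: compat_ends.
  move=> u uT e e0; have [j jr jx] := grid_locate tg uT; have /andP[h1 h2] := jx.
  exists (u - t j); first by rewrite subr_gt0.
  move=> s s0 /andP[s1 s2].
  rewrite (simple_int_incr tg _ _ kc jr _ (ltW s2) h2); last lra.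
  by rewrite (simple_val_cst tg w kc jr jx) subrr normr0.
have [s [sn hs]] := ucp_ae cI; have {}IH := ae_all IH.
apply: filterS3 rY IH hs => w [rc [c bd]] hI hU.
have [h1 h2] : rcont T (I ^~ w) /\ bounded01 T (I ^~ w).
  apply: (rcont_bound_lim (In := fun n => (In (s n)) ^~ w)) => // n.
  by have [? ? _] := hI (s n).
split=> //; apply: (jumps_lim (In := fun n => (In (s n)) ^~ w)
   (Dn := fun n u t => Kn (s n) t w * (Y t w - Y u w))) => //.
  by move=> n; have [] := hI (s n).
move=> t e tT e0; have c0 : 0 <= c by apply: le_trans (bd 0 _); rewrite ?lexx.
have q0 : 0 < e / (2 * c + 1) by rewrite divr_gt0//; lra.
have /cvgrPdist_lt/(_ _ q0)[N _ hN] := cK t w tT.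
exists N => n u Nn uT; have := hN (s n) (leq_trans Nn (sn n)).
rewrite distrC => /ltW h; rewrite -mulrBl normrM.
have tT' : 0 <= t <= T by case/andP: tT => /ltW -> ->.
have hd : `|Y t w - Y u w| <= 2 * c.
  by apply: (le_trans (ler_normB _ _)); have := bd t tT'; have := bd u uT; lra.
apply: (@le_trans _ _ (e / (2 * c + 1) * (2 * c))); first exact: ler_pM.
rewrite mulrAC ler_pdivrMr; last lra.
by rewrite ler_pM2l//; lra.
Qed.

Lemma truncateE n (theta : R -> Omega -> 'rV[R]_n) t w : exists M : nat, forall m, (M <= m)%N ->
  truncate theta m t w = theta t w.
Proof.
exists (Num.truncn (\sum_i `|theta t w ord0 i|)).+1 => m Mm.
rewrite /truncate; case: ifPn => // /forallPn[i]; rewrite -ltNge => h.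
exfalso; move: h; apply/negP; rewrite -leNgt.
apply: (@le_trans _ _ (\sum_i `|theta t w ord0 i|)).
  by rewrite (bigD1 i)//= lerDl sumr_ge0.
by apply: (le_trans (ltW (truncnS_gt _))); rewrite ler_nat.
Qed.

Definition stoch_path n (S : R -> Omega -> 'cV[R]_n) (theta : R -> Omega -> 'rV[R]_n) (I : R -> Omega -> R) w :=
  [/\ rcont T (I ^~ w), bounded01 T (I ^~ w) &
   jumps T (I ^~ w) (fun s t => \sum_i theta t w ord0 i * (S t w i ord0 - S s w i ord0))].

Lemma stoch_int_path n (S : R -> Omega -> 'cV[R]_n) theta I :
  (forall i, regular P F T (fun t w => S t w i ord0)) -> stoch_int P F T S theta I ->
  {ae P, forall w, stoch_path S theta I w}.
Proof.
move=> rS [_ [In [hIn [cI _]]]].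
have hm m : {ae P, forall w, stoch_path S (truncate theta m) (In m) w}.
  have [J [hJ IJ]] := hIn m.
  have H := ae_fin (fun i => bounded_int_path (rS i) (hJ i)).
  apply: filterS H => w hw.
  rewrite /stoch_path (_ : In m ^~ w = fun t => \sum_i J i t w); last by apply/funext => t; rewrite IJ.
  split; first by apply: rcont_sum => i; have [] := hw i.
    by apply: bounded01_sum => i; have [] := hw i.
  by apply: jumps_sum => i; have [] := hw i.
have [s [sn hs]] := ucp_ae cI.
apply: filterS2 (ae_all hm) hs => w hI hU.
have [h1 h2] : rcont T (I ^~ w) /\ bounded01 T (I ^~ w).
  apply: (rcont_bound_lim (In := fun n => (In (s n)) ^~ w)) => // l.
  by have [? ? _] := hI (s l).
split=> //; apply: (jumps_lim (In := fun n => (In (s n)) ^~ w)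
   (Dn := fun l u t => \sum_i truncate theta (s l) t w ord0 i * (S t w i ord0 - S u w i ord0))) => //.
  by move=> l; have [] := hI (s l).
move=> t e tT e0; have [M hM] := truncateE theta t w.
exists M => l u Ml uT; rewrite hM ?subrr ?normr0 ?(ltW e0)//.
exact: leq_trans (sn l).
Qed.

End IntegralPaths.

(** * Invariance of self-financing under a change of numeraire *)

Section ProductLimit.
Context {d : measure_display} {Omega : measurableType d} {R : realType}.
Variables (P : probability Omega R) (F : R -> set (set Omega)) (T : R).
Hypotheses (T_gt0 : 0 < T) (Ffil : filtration F T).
Implicit Types (k : simple_integrand F T) (U V Z : R -> Omega -> R).

Let T_ge0 : 0 <= T := ltW T_gt0.

Lemma small_off U V A (e p : R) : outer_prob_le P A p ->
  (forall w, A w \/ forall t, 0 <= t <= T -> U t w = V t w) -> 0 <= p -> small P F T V e ->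
  small P F T U (e + p).
Proof.
move=> Ap UV p0 [h1 h2]; have ep : e <= e + p by rewrite lerDl.
split.
  apply: outer_sub (outerU h1 Ap) => w [t tT h].
  have [|E] := UV w; [by right|left]; exists t => //.
  by rewrite -E//; exact: le_lt_trans h.
move=> k kle; apply: outer_sub (outerU (h2 k kle) Ap) => w [t tT h].
have [|E] := UV w; [by right|left]; exists t => //; have /andP[t0 _] := tT.
by rewrite -(simple_intY _ E t0); exact: le_lt_trans h.
Qed.

Lemma small_le V (a b : R) : a <= b -> small P F T V a -> small P F T V b.
Proof.
move=> ab [h1 h2]; split; first by apply: (outer_le ab); apply: outer_sub h1; exact: supgt_le.
by move=> k /h2 h; apply: (outer_le ab); apply: outer_sub h; exact: supgt_le.
Qed.

Lemma eclose_sum (I : Type) (s : seq I) (Us Vs : I -> R -> Omega -> R) (a : R) : 0 < a ->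
  (forall i, eclose P F T (Us i) (Vs i) a) ->
  eclose P F T (fun t w => \sum_(i <- s) Us i t w) (fun t w => \sum_(i <- s) Vs i t w) ((size s).+1%:R * a).
Proof.
move=> a0 h; elim: s => [|i s IH].
  rewrite mul1r (_ : (fun _ _ => _) = fun t w => \sum_(i <- [::]) Us i t w); first exact: eclose_refl.
  by apply/funext => t; apply/funext => w; rewrite !big_nil.
rewrite /= -nat1r mulrDl mul1r /eclose.
rewrite (_ : (fun t w => _) = fun t w => (Us i t w - Vs i t w) +
    (\sum_(i <- s) Us i t w - \sum_(i <- s) Vs i t w)); first exact: small_add (h i) IH.
by apply/funext => t; apply/funext => w; rewrite !big_cons; ring.
Qed.

(** Multiplication by a good process is continuous at zero in Emery's topology. *)
Lemma small_mul Z (e : R) : good P F T Z -> 0 < e -> exists2 del : R, 0 < del & forall U,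
  regular P F T U -> small P F T U del -> small P F T (fun t w => U t w * Z t w) e.
Proof.
move=> [rZ gZ] e0; have q0 : 0 < e / 8 by lra.
have [aZ aZ0 hZ] := regular_amp T_gt0 Ffil rZ q0; have [cZ cZ0 hcZ] := gZ _ q0.
pose B := aZ ^+ 2 + 2 * aZ * cZ.
have B0 : 0 < B by rewrite ltr_wpDl ?sqr_ge0// !mulr_gt0.
(* The quadratic variation of [Z] then enters as [B / l = e], which the factor [1 / 2] in [unit_bdM]
   reduces to [e / 2]; the remaining terms are small with [del]. *)
pose l := B / e; have l0 : 0 < l by rewrite divr_gt0.
pose M := cZ + aZ + 3 * l + 1; have M0 : 1 <= M by rewrite /M; lra.
pose del := Num.min 1 (e / 8 / M).
have M00 : 0 < M by lra.
have d0 : 0 < del by rewrite lt_min ltr01 divr_gt0.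
have d1 : del <= 1 by rewrite ge_min lexx.
have dM : del * M <= e / 8 by rewrite -ler_pdivlMr// ge_min lexx orbT.
have dcZ : 0 <= del * cZ by rewrite mulr_ge0 ?ltW.
have daZ : 0 <= del * aZ by rewrite mulr_ge0 ?ltW.
have dl : 0 <= del * l by rewrite mulr_ge0 ?ltW.
have dE : del * M = del * cZ + del * aZ + 3 * (del * l) + del by rewrite /M; ring.
have dd : del * (del * l) <= del * l by rewrite ler_piMl.
exists del => // U rU [hU hUk].
have bU : unit_bd P F T U del del.
  by move=> k /hUk; apply: outer_sub => w h; exists T => //; rewrite T_ge0 lexx.
have H := unit_bdM T_gt0 Ffil rU.1 rZ.1 d0 aZ0 l0 hU hZ bU hcZ.
have vle : del * cZ + aZ * del + (l * (del ^+ 2 + 2 * del * del) + (aZ ^+ 2 + 2 * aZ * cZ) / l) / 2 <= e.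
  have -> : (aZ ^+ 2 + 2 * aZ * cZ) / l = e.
    by rewrite -/B /l invf_div mulrCA divff ?mulr1// gt_eqF.
  have -> : l * (del ^+ 2 + 2 * del * del) = 3 * (del * (del * l)) by ring.
  have -> : aZ * del = del * aZ by rewrite mulrC.
  lra.
have ub : unit_bd P F T (fun t w => U t w * Z t w) e e.
  move=> k kle; apply: (@outer_le _ _ _ _ _ (del + e / 8 + (del + del) + (e / 8 + e / 8))); first lra.
  by apply: outer_sub (H k kle); exact: gtset_le.
split.
  apply: (@outer_le _ _ _ _ _ (del + e / 8)); first lra.
  apply: outer_sub (outerU hU hZ) => w; apply: contraPP => /not_orP[/supgtC h1 /supgtC h2] [t tT].
  apply/negP; rewrite -leNgt normrM.
  by apply: (le_trans (ler_pM _ _ (h1 t tT) (h2 t tT))) => //; lra.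
move=> k kle; apply: (stop T_gt0 Ffil (regularM Ffil rU rZ)) => k' kk'; apply: ub.
by apply: le_val_trans kk' _ => x w xT; exact: kle.
Qed.

End ProductLimit.

(** * Integration by parts on a grid *)

Section Cells.
Context {d : measure_display} {Omega : measurableType d} {R : realType}.
Variables (F : R -> set (set Omega)) (T : R).
Hypotheses (T_gt0 : 0 < T) (Ffil : filtration F T).
Variables (n : nat) (S : 'I_n -> R -> Omega -> R) (Z : R -> Omega -> R) (V0 : Omega -> R).
Variables (k : 'I_n -> simple_integrand F T) (t : nat -> R) (r : nat).
Hypotheses (tg : is_grid T t r) (kg : forall i, compat (k i) t r).

Definition gains s w := \sum_i simple_int (k i) (S i) s w.

Definition cell_weight j w := \sum_i simple_val (k i) (t j.+1) w * S i (t j) w - gains (t j) w - V0 w.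

Lemma gains_incr j a b w : (j < r)%N -> t j <= a -> a <= b -> b <= t j.+1 ->
  gains b w - gains a w = \sum_i simple_val (k i) (t j.+1) w * (S i b w - S i a w).
Proof.
move=> jr ja ab bj; rewrite /gains -sumrB; apply: eq_bigr => i _.
by rewrite (simple_int_incr tg _ _ (@kg i) jr).
Qed.

(** Within a cell the position is constant, so its value and the gains move by the same amount. The
    weight can therefore be evaluated at any time of the cell, in particular just before a jump. *)
Lemma cell_weight_at j s w : (j < r)%N -> t j <= s <= t j.+1 ->
  cell_weight j w = \sum_i simple_val (k i) (t j.+1) w * S i s w - gains s w - V0 w.
Proof.
move=> jr /andP[js sj]; have := gains_incr w jr (lexx _) js sj.
under [RHS]eq_bigr do rewrite mulrBr.
by rewrite sumrB /cell_weight; lra.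
Qed.

(* Integration by parts on the grid: the integral against S Z is (gains) Z plus the integral of the cell weights against Z. *)
Lemma cell_identity (kc : simple_integrand F T) w : compat kc t r ->
  (forall j, (j < r)%N -> t j < t j.+1 -> simple_val kc (t j.+1) w = cell_weight j w) ->
  forall s, 0 <= s <= T ->
  \sum_i simple_int (k i) (fun u v => S i u v * Z u v) s w - gains s w * Z s w
    - V0 w * (Z s w - Z 0 w) = simple_int kc Z s w.
Proof.
move=> kcg hkc; pose W s := \sum_i simple_int (k i) (fun u v => S i u v * Z u v) s w - gains s w * Z s w
    - V0 w * (Z s w - Z 0 w).
have cell j s : (j < r)%N -> t j <= s -> s <= t j.+1 ->
    W s - W (t j) = simple_int kc Z s w - simple_int kc Z (t j) w.
  move=> jr js sj; have [jlt|jge] := ltP (t j) (t j.+1); last first.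
    suff -> : s = t j by rewrite !subrr.
    by apply/eqP; rewrite eq_le js (le_trans sj jge).
  rewrite (simple_int_incr tg _ _ kcg jr (lexx _) js sj) hkc//.
  have h1 := gains_incr w jr (lexx _) js sj.
  have h2 : \sum_i simple_int (k i) (fun u v => S i u v * Z u v) s w -
     \sum_i simple_int (k i) (fun u v => S i u v * Z u v) (t j) w =
     (\sum_i simple_val (k i) (t j.+1) w * S i s w) * Z s w -
     (\sum_i simple_val (k i) (t j.+1) w * S i (t j) w) * Z (t j) w.
    rewrite -sumrB !mulr_suml -sumrB; apply: eq_bigr => i _.
    by rewrite (simple_int_incr tg _ _ (@kg i) jr)//; ring.
  have h3 : \sum_i simple_val (k i) (t j.+1) w * (S i s w - S i (t j) w) =
     \sum_i simple_val (k i) (t j.+1) w * S i s w - \sum_i simple_val (k i) (t j.+1) w * S i (t j) w.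
    by rewrite -sumrB; apply: eq_bigr => i _; rewrite mulrBr.
  rewrite h3 in h1; rewrite /W /cell_weight.
  set a := \sum_i _ in h2 *; set b := \sum_i _ in h2 *.
  have -> : a = b + ((\sum_i simple_val (k i) (t j.+1) w * S i s w) * Z s w -
     (\sum_i simple_val (k i) (t j.+1) w * S i (t j) w) * Z (t j) w) by rewrite -h2 addrC subrK.
  have -> : gains s w = gains (t j) w + (\sum_i simple_val (k i) (t j.+1) w * S i s w - \sum_i simple_val (k i) (t j.+1) w * S i (t j) w) by rewrite -h1 addrC subrK.
  ring.
have [t0 tr tm] := tg.
have W0 : W 0 = simple_int kc Z 0 w.
  rewrite simple_int0 /W /gains !big1 ?mul0r ?subrr ?mulr0 ?subrr//.
    by move=> i _; rewrite simple_int0.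
  by move=> i _; rewrite simple_int0.
have Wt j : (j <= r)%N -> W (t j) = simple_int kc Z (t j) w.
  elim: j => [|j IH] jr; first by rewrite t0.
  have := cell j (t j.+1) jr (grid_step tg j) (lexx _); rewrite IH ?(ltnW jr)//.
  by move=> h; apply/eqP; rewrite -subr_eq0 -(subr_eq0 (W _ - _)) in h *; lra.
move=> s /andP[]; rewrite le_eqVlt => /predU1P[<- _|s0 sT]; first exact: W0.
have [|j jr /andP[js sj]] := grid_locate tg (x := s); first by rewrite s0.
have := cell j s jr (ltW js) sj; rewrite Wt ?(ltnW jr)// /W; lra.
Qed.

(** A cell weight may be unbounded in [w], whereas simple integrands are bounded; clipping at a
    level exceeded only on a small event repairs this. *)
Lemma cell_weight_simple (L : R) : (forall i, adapted F T (S i)) -> Fmeas (F 0) V0 -> 0 < L ->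
  exists kc : simple_integrand F T, compat kc t r /\ forall j (x : R) w, (j < r)%N -> t j < x <= t j.+1 ->
    simple_val kc x w = L * clip1 (cell_weight j w / L).
Proof.
move=> aS mV0 L0; have [||kc [h1 h2 _]] := @gsimple_ex _ _ _ F T t r tg (fun j w => L * clip1 (cell_weight j w / L)).
- move=> j jr; have tj := grid_in tg (ltnW jr); have sj := Fsigma Ffil tj.
  apply: (FmeasM sj); first exact: Fmeas_cst.
  apply: (Fmeas_comp sj (measurable_clip1)); apply: (FmeasM sj); last exact: Fmeas_cst.
  have /andP[j0 jT] := tj.
  apply: (FmeasB sj); last exact: (Fmeas_mono Ffil (lexx _) j0 jT mV0).
  apply: (FmeasB sj); apply: (Fmeas_sum sj) => i; last exact: simple_int_Fmeas.
  by apply: (FmeasM sj); [exact: (simple_val_Fmeas Ffil tg (@kg i) jr)|exact: aS].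
- by move=> j _; exists L => w; rewrite normrM (gtr0_norm L0) ler_piMr ?clip1_le ?ltW.
by exists kc.
Qed.

Variables (V : R -> Omega -> R) (w : Omega) (a aV a' : R).
Hypotheses (a0 : 0 <= a) (Sa : forall i s, 0 <= s <= T -> `|S i s w| <= a)
  (Va : forall s, 0 <= s <= T -> `|V s w| <= aV)
  (ga : forall s, 0 <= s <= T -> `|gains s w - (V s w - V0 w)| <= a').

Lemma cell_weight_bound j (b : R) : (j < r)%N -> 0 <= b ->
  (forall i, `|simple_val (k i) (t j.+1) w| <= b) -> `|cell_weight j w| <= n%:R * b * a + aV + a'.
Proof.
move=> jr b0 hb; have tj := grid_in tg (ltnW jr).
have h1 : `|\sum_i simple_val (k i) (t j.+1) w * S i (t j) w| <= n%:R * b * a.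
  apply: (le_trans (ler_norm_sum _ _ _)).
  apply: (@le_trans _ _ (\sum_(i < n) b * a)).
    by apply: ler_sum => i _; rewrite normrM ler_pM// Sa.
  by rewrite sumr_const card_ord -[(b * a) *+ n]mulr_natl mulrA.
have := Va tj; have := ga tj; move: h1; rewrite /cell_weight !ler_norml.
by move=> /andP[? ?] /andP[? ?] /andP[? ?]; apply/andP; split; lra.
Qed.

(** At a time [s] just before [x], the jump relation and [V x = th x * S x] give that [V s] is
    nearly [th x * S s]. Since [k] is close to [th x] and the gains to [V - V0], the terms of the
    weight cancel. *)
Lemma cell_weight_close j x (th : R -> 'I_n -> R) (del : R) : (j < r)%N -> t j < x <= t j.+1 -> 0 <= del -> 0 < a' ->
  (forall s, 0 <= s <= T -> V s w = \sum_i th s i * S i s w) ->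
  jumps T (V ^~ w) (fun s u => \sum_i th u i * (S i u w - S i s w)) ->
  (forall i, `|simple_val (k i) (t j.+1) w - th x i| <= del) -> `|cell_weight j w| <= n%:R * del * a + a' + a'.
Proof.
move=> jr /andP[jx xj] del0 a'0 VE hj hd.
have /andP[j0 _] := grid_in tg (ltnW jr); have /andP[_ j1T] := grid_in tg jr.
have xT : 0 < x <= T by rewrite (le_lt_trans j0 jx) (le_trans xj).
have [h h0 H] := hj x xT _ a'0.
(* Inside the cell and strictly inside the window of the jump estimate. *)
pose s := Num.max (t j) (x - h / 2).
have [s1 s2] : t j <= s /\ x - h / 2 <= s by rewrite !le_max !lexx orbT.
have sx : s < x by rewrite gt_max jx/=; lra.
have sT : 0 <= s <= T by rewrite (le_trans j0 s1) (le_trans (ltW sx))//; case/andP: xT.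
have /andP[s0 _] := sT.
have {}H : `|V x w - V s w - \sum_i th x i * (S i x w - S i s w)| < a' by apply: H => //; rewrite sx andbT; lra.
rewrite (cell_weight_at w jr (s := s)); last by rewrite s1 (le_trans (ltW sx)).
have h1 : `|\sum_i (simple_val (k i) (t j.+1) w - th x i) * S i s w| <= n%:R * del * a.
  apply: (le_trans (ler_norm_sum _ _ _)).
  apply: (@le_trans _ _ (\sum_(i < n) del * a)).
    by apply: ler_sum => i _; rewrite normrM ler_pM// Sa.
  by rewrite sumr_const card_ord -[(del * a) *+ n]mulr_natl mulrA.
have h2 : \sum_i (simple_val (k i) (t j.+1) w - th x i) * S i s w =
   \sum_i simple_val (k i) (t j.+1) w * S i s w - \sum_i th x i * S i s w.
  by rewrite -sumrB; apply: eq_bigr => i _; rewrite mulrBl.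
have h3 : \sum_i th x i * (S i x w - S i s w) = \sum_i th x i * S i x w - \sum_i th x i * S i s w.
  by rewrite -sumrB; apply: eq_bigr => i _; rewrite mulrBr.
have xT' : 0 <= x <= T by case/andP: xT => /ltW -> ->.
rewrite h3 -VE// in H; rewrite h2 in h1; have := ga sT; move: h1 H.
rewrite !ler_norml !ltr_norml => /andP[? ?] /andP[? ?] /andP[? ?].
by apply/andP; split; lra.
Qed.

End Cells.

Section LayerArithmetic.
Context {R : realFieldType}.
Implicit Types e q v B x y : R.

(** Budget of the two-layer estimate in [parts_small]: [v] is [u m / CC m], and
    [e / 64 + e / 64 + (q + 0)] is the probability of the exceptional event. *)
Lemma layer_arith1 e q v : v <= e / 64 -> q <= e / 64 -> 0 < e ->
  e / 8 + ((e / 64 + e / 64 + (q + 0)) + (v + q + (e / 64 + e / 64 + (q + 0)) + v)) +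
      ((e / 64 + e / 64 + (q + 0)) + (v + (e / 64 + e / 64 + (q + 0)) + v)) <= e / 2.
Proof. lra. Qed.

Lemma layer_arith2 e q B x y : x <= B * (q + q + q) -> y <= B * q -> B * q <= e / 64 ->
  0 < e -> e / 8 + x + 2 * y <= e / 2.
Proof. lra. Qed.

Lemma layer_arith3 e q : q <= e / 64 -> 0 < e -> e / 2 + (e / 64 + e / 64 + (q + 0)) <= e.
Proof. lra. Qed.

Lemma layer_arith4 e q : 0 < q -> 0 < e -> 0 <= e / 64 + e / 64 + (q + 0).
Proof. lra. Qed.

End LayerArithmetic.

Section NumeraireChange.
Context {d : measure_display} {Omega : measurableType d} {R : realType}.
Variables (P : probability Omega R) (F : R -> set (set Omega)) (T : R).
Hypotheses (T_gt0 : 0 < T) (Ffil : filtration F T).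
Let T_ge0 : 0 <= T := ltW T_gt0.

Variables (n : nat) (S S' : R -> Omega -> 'cV[R]_n) (Z : R -> Omega -> R).

Definition asset (S : R -> Omega -> 'cV[R]_n) (i : 'I_n) (t : R) (w : Omega) : R := S t w i ord0.

(** Old assets, new assets and the factor [Z] form one finite family, so that the same simple
    integrands and the same small sets serve all of them. *)
Definition market (x : option ('I_n + 'I_n)) : R -> Omega -> R :=
  match x with Some (inl i) => asset S i | Some (inr i) => asset S' i | None => Z end.

Hypotheses (S_good : forall i, good P F T (asset S i)) (S'_good : forall i, good P F T (asset S' i))
  (Z_good : good P F T Z).

Lemma market_good x : good P F T (market x).
Proof. by case: x => [[i|i]|] /=. Qed.

Variable theta : R -> Omega -> 'rV[R]_n.
Notation V := (wealth S theta).
Notation V0 := (fun w => wealth S theta 0 w).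
Notation Cov := (cov (elem F T) (phi P F T market)).
Notation Pi := (Pi T).

Let u (m : nat) : R := 1 / m.+1%:R.
Let u0 m : 0 < u m. Proof. by rewrite divr_gt0. Qed.
Let u1 m : u m <= 1. Proof. by rewrite ler_pdivrMr// mul1r ler1n. Qed.

Lemma u_small (e : R) : 0 < e -> exists N, forall m, (N <= m)%N -> u m <= e.
Proof.
move=> e0; exists (Num.truncn (1 / e)) => m Nm; rewrite /u ler_pdivrMr// -ler_pdivrMl// mulrC.
by apply: (le_trans (ltW (truncnS_gt _))); rewrite ler_nat ltnS.
Qed.

Lemma large_cov (e : R) : (forall m i, cmeas P F T market (fun t w => truncate theta m t w ord0 i)) -> 0 < e ->
  exists N, forall m, (N <= m)%N -> Cov [set x | Pi x /\ exists i, m%:R < `|theta x.1 x.2 ord0 i|] e.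
Proof.
move=> mth e0; have mtheta i : cmeas P F T market (fun t w => theta t w ord0 i).
  apply: (cmeas_cvg T_gt0 Ffil market_good (fun m => mth m i)) => t w _.
  have [M hM] := truncateE theta t w; apply: cvg_near_cst.
  by exists M => // m /hM ->.
pose E i m := [set x | Pi x /\ m%:R < `|theta x.1 x.2 ord0 i|].
have q0 : 0 < e / n.+1%:R by rewrite divr_gt0.
have /choice[N hN] : forall i, exists N, forall m, (N <= m)%N -> Cov (E i m) (e / n.+1%:R).
  move=> i; apply: (cov_decr T_gt0 Ffil market_good) => //.
  - move=> m; exact: (cmeas_gt (K := fun t w => theta t w ord0 i)).
  - by move=> m x [xP h]; split=> //; apply: lt_trans h; rewrite ltr_nat.
  - apply/seteqP; split => // x h; have [_] := h (Num.truncn `|theta x.1 x.2 ord0 i|).+1 I.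
    by rewrite ltNge ltW// truncnS_gt.
exists (\max_i N i) => m Nm.
have h : Cov [set x | exists2 i, i \in enum 'I_n & E i m x] ((size (enum 'I_n))%:R * (e / n.+1%:R)).
  by apply: cov_fin => // i; apply: hN; apply: leq_trans Nm; exact: (leq_bigmax (F := N) i).
rewrite size_enum_ord in h.
have {}h : Cov [set x | exists2 i, i \in enum 'I_n & E i m x] e.
  apply: cov_le h; first by move=> D a b; exact: phi_le.
  by rewrite mulrCA ler_piMr ?(ltW e0)// ler_pdivrMr// mul1r ler_nat.
by apply: cov_sub h => x [xP [i hi]]; exists i; rewrite ?mem_enum.
Qed.

Variables (k : nat -> 'I_n -> simple_integrand F T) (CC : nat -> R).
Notation g m := (gains (asset S) (k m)).
(** Precision relative to the bound [CC m] of the approximants: the union of the [n] bad sets has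
    size at most [u m / CC m], which compensates a weight of order [CC m] there. *)
Let del m := u m / (CC m * n.+1%:R).
Hypotheses (CC1 : forall m, 1 <= CC m) (kC : forall m i, le_val (k m i) (fun _ _ => CC m))
  (kcov : forall m i, Cov [set x | Pi x /\
     del m < `|truncate theta m x.1 x.2 ord0 i - simple_val (k m i) x.1 x.2|] (del m))
  (mth : forall m i, cmeas P F T market (fun t w => truncate theta m t w ord0 i))
  (rV : regular P F T V) (mV0 : Fmeas (F 0) V0)
  (jV : {ae P, forall w, jumps T (V ^~ w)
     (fun s t => \sum_i theta t w ord0 i * (S t w i ord0 - S s w i ord0))})
  (gV : forall e, 0 < e -> exists N, forall m, (N <= m)%N ->
     small P F T (fun t w => g m t w - (V t w - V0 w)) e).

Let CC0 m : 0 < CC m. Proof. exact: lt_le_trans (CC1 m). Qed.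
Let del0 m : 0 < del m. Proof. by rewrite divr_gt0// mulr_gt0. Qed.
Let ndel m : n%:R * del m <= u m / CC m.
Proof.
have -> : n%:R * del m = u m / CC m * (n%:R / n.+1%:R).
  by rewrite /del; field; rewrite gt_eqF//= gt_eqF.
apply: ler_piMr; first by rewrite ltW// divr_gt0.
by rewrite ler_pdivrMr// mul1r ler_nat leqnSn.
Qed.
Let uC m : u m / CC m <= u m.
Proof. by rewrite ler_pdivrMr//; apply: ler_peMr => //; exact: ltW. Qed.

(** The sum of squares is a single regular process dominating all assets at once. *)
Lemma assets_amp (e : R) : 0 < e -> exists2 a : R, 0 < a & exists2 A, outer_prob_le P A e &
  forall w, A w \/ forall i s, 0 <= s <= T -> `|S s w i ord0| <= a.
Proof.
move=> e0; have rQ : regular P F T (fun t w => \sum_i asset S i t w * asset S i t w).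
  apply: (@regular_sum _ _ _ P F T T_gt0 Ffil 'I_n (index_enum _) (fun i t w => asset S i t w * asset S i t w)) => i.
  by apply: (regularM Ffil); exact: (S_good i).1.
have [c c0 hc] := regular_amp T_gt0 Ffil rQ e0.
exists (c + 1); first lra.
exists (supgt T (fun t w => \sum_i asset S i t w * asset S i t w) c) => // w.
have [|/supgtC h] := pselect (supgt T (fun t w => \sum_i asset S i t w * asset S i t w) c w); [by left|right].
move=> i s sT; have := h s sT; rewrite ger0_norm; last by rewrite sumr_ge0// => j _; rewrite -expr2 sqr_ge0.
move=> hs; rewrite leNgt; apply/negP => hi.
have h2 : asset S i s w * asset S i s w <= c.
  by apply: le_trans hs; rewrite (bigD1 i)//= lerDl sumr_ge0// => j _; rewrite -expr2 sqr_ge0.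
rewrite -expr2 -real_normK ?num_real// in h2.
have h3 : (c + 1) ^+ 2 <= `|asset S i s w| ^+ 2.
  by rewrite lerXn2r ?nnegrE ?normr_ge0 ?ltW//; lra.
have h4 : (c + 1) ^+ 2 = c ^+ 2 + 2 * c + 1 by ring.
have := sqr_ge0 c; lra.
Qed.

(** By [cell_identity] the expression is the integral of the cell weights against [Z]. Off a small
    event these are at most [CC m * B] on the bad approximation set, at most [B] where some
    component of [theta] exceeds [m], and below [rho] elsewhere. *)
Lemma parts_small (e : R) : 0 < e -> exists N, forall m, (N <= m)%N ->
  small P F T (fun t w => \sum_i simple_int (k m i) (fun s v => asset S i s v * Z s v) t w
    - g m t w * Z t w - V0 w * (Z t w - Z 0 w)) e.
Proof.
move=> e0; have r0 : 0 < e / 8 by lra.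
have [rho rho0 hrho] := rho_family T_gt0 Ffil market_good r0.
have p0 : 0 < e / 64 by lra.
have [a a0 [AS hAS SA]] := assets_amp p0.
have [aV aV0 hV] := regular_amp T_gt0 Ffil rV p0.
(* A bound of a cell weight per unit of [k]; the 2 absorbs the tolerances [q <= 1]. *)
pose B := n%:R * a + aV + 2.
have na0 : 0 <= n%:R * a by rewrite mulr_ge0// ltW.
have B0 : 0 < B by rewrite /B; lra.
(* One tolerance for three tasks: the middle entry pays for the layer of height [B], and the last
   keeps the generic weight, at most [q * (a + 2)], below [rho]. *)
pose q := Num.min 1 (Num.min (e / 64 / (B + 1)) (rho / (a + 2))).
have q0 : 0 < q by rewrite !lt_min ltr01 !divr_gt0//; lra.
have q1 : q <= 1 by rewrite ge_min lexx.
have q2 : q <= e / 64 / (B + 1) by rewrite /q !ge_min lexx !orbT.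
have q3 : q <= rho / (a + 2) by rewrite /q !ge_min lexx !orbT.
have qB : q * (B + 1) <= e / 64 by rewrite -ler_pdivlMr//; lra.
have qr : q * (a + 2) <= rho by rewrite -ler_pdivlMr//; lra.
have qB0 : 0 <= q * B by rewrite mulr_ge0 ?ltW.
have [q64 qB64] : q <= e / 64 /\ B * q <= e / 64 by lra.
have [N1 hN1] := gV q0; have [N2 hN2] := u_small q0; have [N3 hN3] := large_cov mth q0.
exists (maxn N1 (maxn N2 N3)) => m; rewrite !geq_max => /and3P[/hN1 Hg /hN2 Hu /hN3 HE].
have [Hg1 _] := Hg.
pose Jw := [set w | jumps T (V ^~ w) (fun s t => \sum_i theta t w ord0 i * (S t w i ord0 - S s w i ord0))].
pose A := (AS `|` supgt T V aV) `|` (supgt T (fun t w => g m t w - (V t w - V0 w)) q `|` ~` Jw).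
have HA : outer_prob_le P A (e / 64 + e / 64 + (q + 0)).
  apply: outerU; first exact: outerU.
  by apply: outerU => //; apply: outer_negl => //; exact: jV.
have [|t [r [tg tp]]] := @grid_exists _ T T_ge0 (flatten [seq ends (k m i) | i <- enum 'I_n]).
  by move=> x /flattenP[s /mapP[i _ ->]]; exact: ends_in.
have kg i : compat (k m i) t r.
  by apply: compat_ends => x xe; apply: tp; apply/flatten_mapP; exists i; rewrite ?mem_enum.
have L0 : 0 < CC m * B by rewrite mulr_gt0.
have [kc [kcg hkc]] := cell_weight_simple Ffil tg kg (fun i => (S_good i).1.1) mV0 L0.
have CB : n%:R * CC m * a + aV + q <= CC m * B.
  have h : (aV + 2) <= CC m * (aV + 2) by rewrite ler_peMl//; lra.
  have -> : CC m * B = n%:R * CC m * a + CC m * (aV + 2) by rewrite /B; ring.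
  lra.
have ndela : n%:R * del m * a <= u m * a by rewrite ler_wpM2r ?(ltW a0)// (le_trans (ndel m)).
have uqa : u m * a <= q * a by rewrite ler_wpM2r// (ltW a0).
have ndela1 : n%:R * del m * a <= n%:R * a.
  rewrite -mulrA ler_wpM2l// ler_piMl ?(ltW a0)// /del ler_pdivrMr ?mulr_gt0// mul1r.
  apply: (le_trans (u1 m)); apply: (le_trans (CC1 m)); apply: ler_peMr; last by rewrite ler1n.
  exact: ltW.
have hB1 : n%:R * del m * a + aV + q <= B by rewrite /B; lra.
have hB2 : n%:R * del m * a + q + q <= B by rewrite /B; lra.
have GA w : A w \/ [/\ forall i s, 0 <= s <= T -> `|asset S i s w| <= a,
    forall s, 0 <= s <= T -> `|V s w| <= aV,
    forall s, 0 <= s <= T -> `|g m s w - (V s w - V0 w)| <= q & Jw w].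
  have [|nA] := pselect (A w); [by left|right].
  move/not_orP: nA => [/not_orP[h1 /supgtC h2] /not_orP[/supgtC h3 /contrapT h4]].
  by split=> //; have [|] := SA w.
have kcw j (x : R) w : (j < r)%N -> t j < x <= t j.+1 -> ~ A w ->
    simple_val kc x w = cell_weight (asset S) V0 (k m) t j w.
  move=> jr jx nA; rewrite (hkc _ _ _ jr jx) clip1_div//.
  have [//|[h1 h2 h3 _]] := GA w; apply: le_trans CB.
  apply: (cell_weight_bound (V0 := V0) tg (V := V) (w := w) (a := a) (aV := aV) (a' := q)) => //.
  - by rewrite ltW.
  - move=> i; apply: kC; have /andP[l1 l2] := jx; have /andP[j0 _] := grid_in tg (ltnW jr).
    by have /andP[_ ->] := grid_in tg jr; rewrite andbT (lt_le_trans (le_lt_trans j0 l1)).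
pose E1 := [set x | exists2 i, i \in enum 'I_n & Pi x /\
     del m < `|truncate theta m x.1 x.2 ord0 i - simple_val (k m i) x.1 x.2|].
have HE1 : Cov E1 (u m / CC m).
  have := cov_fin T_gt0 Ffil (enum 'I_n) (kcov m); rewrite size_enum_ord.
  by apply: cov_le (ndel m) => D b c; exact: phi_le.
have nd0 : 0 <= n%:R * del m * a.
  by apply: mulr_ge0; [apply: mulr_ge0; [exact: ler0n|exact: ltW]|exact: ltW].
have eps0 : 0 <= n%:R * del m * a + q + q by rewrite !addr_ge0 ?(ltW q0).
(* The factor [CC m] of the upper layer cancels against the size [u m / CC m] of its set, leaving
   [2 * (B * u m)]. *)
have HK : est P market kc (e / 8 + B * (u m / CC m + q + u m / CC m) + CC m * B * (u m / CC m + u m / CC m))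
    (e / 8 + ((e / 64 + e / 64 + (q + 0)) + (u m / CC m + q + (e / 64 + e / 64 + (q + 0)) + u m / CC m)) +
      ((e / 64 + e / 64 + (q + 0)) + (u m / CC m + (e / 64 + e / 64 + (q + 0)) + u m / CC m))).
  apply: (est_two_layers T_gt0 Ffil market_good L0 B0 eps0 _ HE1 HE HA); first by rewrite divr_gt0.
  - move=> x w xT; have [|[h1 h2 h3 h4]] := GA w; [by left|].
    have [|nA] := pselect (A w); [by left|right].
    have [j jr jx] := grid_locate tg xT; rewrite (kcw _ _ _ jr jx nA).
    have kx i : simple_val (k m i) (t j.+1) w = simple_val (k m i) x w.
      by rewrite -(simple_val_cst tg w (@kg i) jr jx).
    have jT : 0 < t j.+1 <= T.
      have /andP[l1 l2] := jx; have /andP[j0 _] := grid_in tg (ltnW jr).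
      by have /andP[_ ->] := grid_in tg jr; rewrite andbT (lt_le_trans (le_lt_trans j0 l1)).
    have b1 : `|cell_weight (asset S) V0 (k m) t j w| <= CC m * B.
      apply: le_trans CB.
      apply: (cell_weight_bound (V0 := V0) tg (V := V) (w := w) (a := a) (aV := aV) (a' := q)) => //.
      + by rewrite ltW.
      + by move=> i; exact: kC.
    have [e1|ne1] := pselect (E1 (x, w)); first by split=> //; [right|right; left].
    have hk i : `|truncate theta m x w ord0 i - simple_val (k m i) x w| <= del m.
      rewrite leNgt; apply/negP => h; apply: ne1; exists i; rewrite ?mem_enum//.
    have [e2|ne2] := pselect (exists i, m%:R < `|theta x w ord0 i|).
      split=> //; last by right; right; split.
      left; have : `|cell_weight (asset S) V0 (k m) t j w| <= n%:R * del m * a + aV + q.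
        apply: (cell_weight_bound (V0 := V0) tg (V := V) (w := w) (a := a) (aV := aV) (a' := q)) => //; [exact: ltW|].
        (* One component above [m] makes the whole truncated vector 0, so every approximant is
           within [del m] of 0 here. *)
        move=> i; rewrite kx; have := hk i; rewrite /truncate ifF ?mxE ?sub0r ?normrN//.
        apply/negbTE/forallPn; have [l hl] := e2; exists l; by rewrite -ltNge.
      by move=> h; exact: le_trans h hB1.
    have b2 : `|cell_weight (asset S) V0 (k m) t j w| <= n%:R * del m * a + q + q.
      have VE s : 0 <= s <= T -> V s w = \sum_i theta s w ord0 i * asset S i s w by move=> _; rewrite /wealth mxE.
      apply: (cell_weight_close tg kg h1 h3 jr jx (ltW (del0 m)) q0 VE h4) => i.
      rewrite kx distrC; have := hk i; rewrite /truncate ifT//.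
      by apply/forallP => l; rewrite leNgt; apply/negP => h; apply: ne2; exists l.
    by split=> //; left=> //; exact: le_trans b2 hB2.
  - move=> x k' k'e; apply: hrho; apply: le_val_trans k'e _ => s w _; lra.
have h1 : B * (u m / CC m + q + u m / CC m) <= B * (q + q + q).
  by rewrite ler_wpM2l ?(ltW B0)// !lerD// (le_trans (uC m)).
have h2 : CC m * B * (u m / CC m + u m / CC m) = 2 * (B * u m).
  by field; rewrite gt_eqF.
have h3 : B * u m <= B * q by rewrite ler_wpM2l// (ltW B0).
have h4 := uC m.
have u64 : u m / CC m <= e / 64 by exact: le_trans h4 (le_trans Hu q64).
have HK2 : est P market kc (e / 2) (e / 2).
  move=> x k' k'k; have := HK x k' k'k => H.
  apply: (@outer_le _ _ _ _ _ _ _ _ (outer_sub _ H)); first exact: layer_arith1.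
  by apply: gtset_le; rewrite h2; exact: (layer_arith2 (x := B * (u m / CC m + q + u m / CC m)) (y := B * u m) h1 h3 qB64 e0).
have HZ := est_small T_gt0 Ffil market_good (None : option ('I_n + 'I_n)) HK2.
have := small_off HA _ _ HZ; move/(_ (fun t w => \sum_i simple_int (k m i) (fun s v => asset S i s v * Z s v) t w
    - g m t w * Z t w - V0 w * (Z t w - Z 0 w))) => H.
apply: small_le (H _ _); [exact: layer_arith3| |exact: layer_arith4].
move=> w; have [|nA] := pselect (A w); [by left|right=> s sT].
apply: (cell_identity Z (V0 := V0) tg kg kcg) => // j jr jlt.
by apply: kcw => //; rewrite jlt lexx.
Qed.

End NumeraireChange.

Section SelfFinancing.
Context {d : measure_display} {Omega : measurableType d} {R : realType}.
Variables (P : probability Omega R) (F : R -> set (set Omega)) (T : R).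
Hypotheses (T_gt0 : 0 < T) (Ffil : filtration F T).
Let T_ge0 : 0 <= T := ltW T_gt0.

Lemma eclose_ae (U V U' V' : R -> Omega -> R) (e : R) :
  {ae P, forall w, forall t, 0 <= t <= T -> U t w = U' t w} ->
  {ae P, forall w, forall t, 0 <= t <= T -> V t w = V' t w} ->
  eclose P F T U V e -> eclose P F T U' V' e.
Proof.
by move=> hU hV; apply: small_ae; apply: filterS2 hU hV => w h1 h2 t tT; rewrite h1// h2.
Qed.

Lemma self_financing_regular n (S : R -> Omega -> 'cV[R]_n) theta :
  (forall i, regular P F T (asset S i)) -> self_financing F T S P theta ->
  regular P F T (wealth S theta) /\
  {ae P, forall w, jumps T ((wealth S theta) ^~ w)
     (fun s t => \sum_i theta t w ord0 i * (S t w i ord0 - S s w i ord0))}.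
Proof.
move=> rS [I sI hV]; have pI := stoch_int_path T_gt0 rS sI.
have aV : adapted F T (wealth S theta).
  by apply: (wealth_adapted Ffil) => [i|]; [exact: (rS i).1|exact: sI.1].
split; first split=> //; apply: filterS2 pI hV => w [h1 h2 h3] hw.
  split.
    apply: (eq_rcont (f := fun t => wealth S theta 0 w + I t w)); first by move=> t tT; rewrite -hw.
    by apply: rcontD => //; exact: rcont_cst.
  have [c hc] := h2; exists (`|wealth S theta 0 w| + c) => t tT; rewrite hw//.
  by apply: (le_trans (ler_normD _ _)); rewrite lerD2l hc.
move=> t tT e e0; have [h h0 H] := h3 t tT e e0; exists h => // s s0 st.
have tT' : 0 <= t <= T by case/andP: tT => /ltW -> ->.
have sT : 0 <= s <= T.
  by have /andP[_ st'] := st; rewrite s0 (le_trans (ltW st'))//; case/andP: tT.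
have -> : wealth S theta t w - wealth S theta s w = I t w - I s w by rewrite (hw t tT') (hw s sT); lra.
exact: H.
Qed.

(** The integral against [S'] is forced to be the increment of the new wealth. What must be shown is
    that the integrals of the truncations against [S'] converge to it in Emery's topology, through
    simple integrands shared with [S]. *)
Theorem self_financing_numeraire n (S S' : R -> Omega -> 'cV[R]_n) (Z : R -> Omega -> R) theta :
  (forall i, good P F T (asset S i)) -> (forall i, good P F T (asset S' i)) -> good P F T Z ->
  {ae P, forall w, forall t, 0 <= t <= T -> S' t w = Z t w *: S t w} ->
  self_financing F T S P theta -> self_financing F T S' P theta.
Proof.
move=> gS gS' gZ SZ sf; have [rV jV] := self_financing_regular (fun i => (gS i).1) sf.
have [I [pth [In [hIn cI]]] hV] := sf.
have [J hJ] := choice hIn.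
have mg := market_good gS gS' gZ.
pose V0 w := wealth S theta 0 w.
have mV0 : Fmeas (F 0) V0 by apply: rV.1; rewrite lexx.
have rG : regular P F T (fun t w => wealth S theta t w - V0 w).
  by apply: regularB => //; exact: regular_cst.
have cG (e : R) : 0 < e -> exists N, forall m, (N <= m)%N ->
    eclose P F T (In m) (fun t w => wealth S theta t w - V0 w) e.
  move=> e0; have /(@emery_cvgP _ _ _ P F T _ _ T_ge0)/(_ e e0)[N hN] := cI.
  exists N => m /hN; apply: eclose_ae; first by apply: aeW.
  by apply: filterS hV => w hw t tT; rewrite hw// /V0 addrC addKr.
have /choice[A hA] : forall mi : nat * 'I_n, exists JC : (option ('I_n + 'I_n) -> R -> Omega -> R) * R,
    [/\ JC.1 (Some (inl mi.2)) = J mi.1 mi.2,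
     forall x, bounded_int P F T (market S S' Z x) (fun t w => truncate theta mi.1 t w ord0 mi.2) (JC.1 x) &
     capprox P F T (market S S' Z) (fun t w => truncate theta mi.1 t w ord0 mi.2) JC.1 JC.2].
  move=> [m i]; have [hb _] := hJ m.
  have [Jx [C [h1 h2 _ h4]]] := bounded_int_approx T_gt0 Ffil mg (i := Some (inl i)) (hb i).
  by exists (Jx, C).
(* A single bound for all coordinates; the summand 1 makes it at least 1, so that dividing by it
   never increases a tolerance. *)
pose CC m := 1 + \sum_i `|(A (m, i)).2|.
have CC1 m : 1 <= CC m by rewrite lerDl sumr_ge0.
have CC0 m : 0 < CC m := lt_le_trans ltr01 (CC1 m).
pose u (m : nat) : R := 1 / m.+1%:R.
pose del m := u m / (CC m * n.+1%:R).
have u0 m : 0 < u m by rewrite divr_gt0.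
have del0 m : 0 < del m by rewrite divr_gt0// mulr_gt0.
have ndel m : n.+1%:R * del m <= u m.
  have -> : n.+1%:R * del m = u m / CC m by rewrite /del; field; rewrite gt_eqF//= gt_eqF.
  by rewrite ler_pdivrMr//; apply: ler_peMr => //; exact: ltW.
have /choice[k hk] : forall mi : nat * 'I_n, exists k : simple_integrand F T,
    [/\ le_val k (fun _ _ => CC mi.1),
     cov (elem F T) (phi P F T (market S S' Z)) [set x | Pi T x /\
      del mi.1 < `|truncate theta mi.1 x.1 x.2 ord0 mi.2 - simple_val k x.1 x.2|] (del mi.1) &
     forall x, eclose P F T (simple_int k (market S S' Z x)) ((A mi).1 x) (del mi.1)].
  move=> [m i]; have [_ _ ap] := hA (m, i); have [k [k1 k2 k3]] := ap _ (del0 m).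
  exists k; split=> //; apply: le_val_trans k1 _ => x w _ /=.
  apply: (le_trans (ler_norm _)); rewrite /CC (bigD1 i)//= ler_wpDl// lerDl.
  by rewrite sumr_ge0.
pose km m i := k (m, i).
have mth m i : cmeas P F T (market S S' Z) (fun t w => truncate theta m t w ord0 i).
  have [hb _] := hJ m.
  exact: (bounded_int_cmeas T_gt0 Ffil mg (hb i)).
have gIn m : eclose P F T (gains (asset S) (km m)) (In m) (u m).
  have h i : eclose P F T (simple_int (km m i) (asset S i)) (J m i) (del m).
    by have [<- _ _] := hA (m, i); have [_ _ h] := hk (m, i); exact: (h (Some (inl i))).
  have := eclose_sum (enum 'I_n) (del0 m) h.
  rewrite size_enum_ord => /(eclose_le (ndel m)).
  apply: eclose_ae; first by apply: aeW => w t _; rewrite /gains [LHS]big_enum.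
  by apply: aeW => w t _; rewrite (hJ m).2 big_enum.
pose Ih m t w := \sum_i (A (m, i)).1 (Some (inr i)) t w.
have gIh m : eclose P F T (fun t w => \sum_i simple_int (km m i) (fun s v => asset S i s v * Z s v) t w) (Ih m) (u m).
  have h i : eclose P F T (simple_int (km m i) (asset S' i)) ((A (m, i)).1 (Some (inr i))) (del m).
    by have [_ _ h] := hk (m, i); exact: (h (Some (inr i))).
  have := eclose_sum (enum 'I_n) (del0 m) h.
  rewrite size_enum_ord => /(eclose_le (ndel m)).
  apply: eclose_ae; last by apply: aeW => w t _; rewrite /Ih big_enum.
  apply: filterS SZ => w hw t /andP[t0 _]; rewrite big_enum; apply: eq_bigr => i _.
  by apply: simple_intY => // x xT; rewrite /asset hw// mxE mulrC.
have gV (e : R) : 0 < e -> exists N, forall m, (N <= m)%N ->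
    small P F T (fun t w => gains (asset S) (km m) t w - (wealth S theta t w - V0 w)) e.
  move=> e0; have e20 : 0 < e / 2 by lra.
  have [N1 h1] := cG _ e20; have [N2 h2] := u_small e20.
  exists (maxn N1 N2) => m; rewrite geq_max => /andP[/h1 c1 /h2 c2].
  by rewrite [e]splitr; apply: eclose_tri c1; exact: eclose_le (gIn m).
pose Ihat t w := wealth S' theta t w - wealth S' theta 0 w.
exists Ihat; last by apply: aeW => w t _; rewrite /Ihat addrC subrK.
split=> //; exists Ih; split.
  move=> m; exists (fun i => (A (m, i)).1 (Some (inr i))); split=> // i.
  by have [_ h _] := hA (m, i); exact: (h (Some (inr i))).
apply/(@emery_cvgP _ _ _ P F T _ _ T_ge0) => e e0; have e40 : 0 < e / 4 by lra.
have [N1 h1] := parts_small T_gt0 Ffil gS gS' gZ CC1 (fun m i => let: And3 h _ _ := hk (m, i) in h)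
  (fun m i => let: And3 _ h _ := hk (m, i) in h) mth rV mV0 jV gV e40.
have [dl dl0 hdl] := small_mul T_gt0 Ffil gZ e40.
have [N2 h2] := gV _ dl0; have [N3 h3] := u_small e40.
exists (maxn N1 (maxn N2 N3)) => m; rewrite !geq_max => /and3P[/h1 c1 /h2 c2 /h3 c3].
have rU : regular P F T (fun t w => gains (asset S) (km m) t w - (wealth S theta t w - V0 w)).
  apply: regularB => //; apply: (@regular_sum _ _ _ P F T T_gt0 Ffil 'I_n (index_enum _) (fun i => simple_int (km m i) (asset S i))) => i.
  by apply: regular_simple_int => //; exact: (gS i).1.
(* The error of the gains times [Z] plus the integration-by-parts remainder telescopes to the
   integral against [S Z] minus the increment of [V Z]. *)
have c4 := small_add (hdl _ rU c2) c1.
have c5 : eclose P F T (fun t w => \sum_i simple_int (km m i) (fun s v => asset S i s v * Z s v) t w) Ihat (e / 4 + e / 4).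
  apply: small_ae c4; apply: filterS SZ => w hw t tT.
  have WE s : 0 <= s <= T -> wealth S' theta s w = Z s w * wealth S theta s w.
    move=> sT; rewrite /wealth !mxE mulr_sumr; apply: eq_bigr => i _.
    by rewrite hw// mxE mulrCA.
  by rewrite /Ihat !WE ?lexx// /V0; ring.
have c6 := eclose_sym (eclose_le c3 (gIh m)).
by apply: eclose_le (eclose_tri c6 c5); lra.
Qed.

End SelfFinancing.

(** * Equivalent measures *)

Section Layers.
Context {R : realType}.

Lemma layer_le (x dl : R) N : 0 <= x -> 0 < dl ->
  \sum_(l < N) (if l.+1%:R * dl <= x then dl else 0) <= x.
Proof.
move=> x0 d0; elim: N => [|N IH]; first by rewrite big_ord0.
rewrite big_ord_recr/=; case: ifPn => [h|_]; last by rewrite addr0.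
apply: le_trans h; rewrite -natr1 mulrDl mul1r lerD2r.
apply: (@le_trans _ _ (\sum_(l < N) dl)); first by apply: ler_sum => l _; case: ifP => // _; exact: ltW.
by rewrite sumr_const card_ord -[dl *+ N]mulr_natl.
Qed.

Lemma layer_ge (x dl : R) N : 0 < dl -> x <= N%:R * dl ->
  x - dl <= \sum_(l < N) (if l.+1%:R * dl <= x then dl else 0).
Proof.
move=> d0; elim: N => [|N IH]; first by rewrite big_ord0 mul0r => h; lra.
move=> hx; rewrite big_ord_recr/=; have [h|h] := leP x (N%:R * dl).
  apply: (le_trans (IH h)); rewrite lerDl; case: ifP => // _; exact: ltW.
have -> : \sum_(i < N) (if i.+1%:R * dl <= x then dl else 0) = N%:R * dl.
  rewrite (eq_bigr (fun=> dl)); first by rewrite sumr_const card_ord -[dl *+ N]mulr_natl.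
  move=> i _; rewrite ifT// (le_trans _ (ltW h))// ler_pM2r// ler_nat; exact: ltn_ord.
move: hx; rewrite -natr1 mulrDl mul1r => hx.
by apply: (@le_trans _ _ (N%:R * dl)); [lra|rewrite lerDl; case: ifP => // _; exact: ltW].
Qed.

End Layers.

Section Domination.
Context {d : measure_display} {Omega : measurableType d} {R : realType}.
Implicit Types (mu nu : {measure set Omega -> \bar R}).

Lemma fatou_bound mu (fn : nat -> Omega -> R) (f : Omega -> R) (C : \bar R) :
  (forall n, measurable_fun setT (fn n)) -> measurable_fun setT f ->
  (forall n w, 0 <= fn n w) -> (forall w, 0 <= f w) ->
  {ae mu, forall w, fn n w @[n --> \oo] --> f w} ->
  (forall n, (\int[mu]_w (fn n w)%:E <= C)%E) -> (\int[mu]_w (f w)%:E <= C)%E.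
Proof.
move=> mfn mf fn0 f0 cf hC.
have mE n : measurable_fun setT (EFin \o fn n) by exact/measurable_EFinP.
have mL : measurable_fun setT (fun w => limn_einf (fun n => (fn n w)%:E)).
  under eq_fun do rewrite -[limn_einf _]oppeK -limn_esupN.
  apply: measurableT_comp => //; apply: measurable_fun_limn_esup => n.
  by apply: measurableT_comp => //; exact: mE.
rewrite (ge0_ae_eq_integral (g := fun w => limn_einf (fun n => (fn n w)%:E)))//.
- apply: (le_trans (fatou mu measurableT mE _)).
    by move=> n w _; rewrite lee_fin.
  rewrite limn_einf_lim; apply: lime_le; first exact: is_cvg_einfs.
  apply: nearW => n; apply: ge_ereal_inf; exists (\int[mu]_w (fn n w)%:E)%E => //.
  by exists n => //=.
- exact/measurable_EFinP.
- by move=> w _; rewrite lee_fin.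
- move=> w _; rewrite limn_einf_lim; apply: lime_ge; first exact: is_cvg_einfs.
  by apply: nearW => n; apply: le_ereal_inf_tmp => _ [m /= nm <-]; rewrite lee_fin.
- apply: filterS cf => w cw _; rewrite is_cvg_limn_einfE.
    by apply/esym/cvg_lim => //; apply: cvg_comp cw _; exact: cvg_refl.
  apply/cvg_ex; exists (f w)%:E; apply: cvg_comp cw _; exact: cvg_refl.
Qed.

(* Approximate h from below by layers of level sets, on which the domination is assumed. *)
Lemma density_compare mu nu (G : set (set Omega)) (f g h : Omega -> R) :
  sigma_algebra setT G -> G `<=` measurable ->
  measurable_fun setT f -> measurable_fun setT g -> (forall w, 0 <= f w) -> (forall w, 0 <= g w) ->
  (forall B, G B -> (\int[mu]_(w in B) (f w)%:E <= \int[nu]_(w in B) (g w)%:E)%E) ->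
  Fmeas G h -> (forall w, 0 <= h w) ->
  (\int[mu]_w (h w * f w)%:E <= \int[nu]_w (h w * g w)%:E)%E.
Proof.
move=> sG Gm mf mg f0 g0 fg mh h0.
have mh' : measurable_fun setT h.
  by move=> _ B mB; rewrite setTI; apply: Gm; exact: mh.
pose dl n : R := n.+1%:R^-1.
have d0 n : 0 < dl n by rewrite invr_gt0.
pose B n l := [set w | l.+1%:R * dl n <= h w].
have GB n l : G (B n l).
  rewrite (_ : B n l = h @^-1` `[l.+1%:R * dl n, +oo[%classic); first exact: mh.
  by apply/seteqP; split => w; rewrite /B/= in_itv/= andbT.
have mB n l : measurable (B n l) by exact: Gm.
(* There are [n.+1 ^ 2] layers of thickness [1 / n.+1], reaching height [n.+1], so both the range
   and the resolution improve with [n]. *)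
pose hn n w : R := \sum_(l < n.+1 ^ 2) dl n * \1_(B n l) w.
have hnE n w : hn n w = \sum_(l < n.+1 ^ 2) (if l.+1%:R * dl n <= h w then dl n else 0).
  apply: eq_bigr => l _; rewrite indicE; case: ifPn => hl; first by rewrite mem_set ?mulr1.
  by rewrite memNset ?mulr0//; apply/negP.
have hn0 n w : 0 <= hn n w by apply: sumr_ge0 => l _; rewrite mulr_ge0// ltW.
have hnh n w : hn n w <= h w by rewrite hnE; exact: layer_le.
have mhn n : measurable_fun setT (hn n).
  apply: measurable_sum => l; apply: measurable_funM => //; exact: measurable_indic.
have chn w : hn n w @[n --> \oo] --> h w.
  apply/cvgrPdist_le => e e0; near=> n.
  have n1 : h w <= n.+1%:R.
    apply: (le_trans (ltW (truncnS_gt _))); rewrite ler_nat ltnS; near: n; exact: nbhs_infty_ge.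
  have n2 : dl n <= e.
    rewrite /dl -(invrK e) lef_pV2 ?posrE ?invr_gt0//.
    apply: (le_trans (ltW (truncnS_gt _))); rewrite ler_nat ltnS; near: n; exact: nbhs_infty_ge.
  rewrite ger0_norm ?subr_ge0// hnE lerBlDr.
  have := @layer_ge _ (h w) (dl n) (n.+1 ^ 2) (d0 n).
  rewrite natrX expr2 -mulrA mulfV ?gt_eqF// mulr1 => /(_ n1); lra.
have I (m0 : {measure set Omega -> \bar R}) (f1 : Omega -> R) n : measurable_fun setT f1 -> (forall w, 0 <= f1 w) ->
    (\int[m0]_w (hn n w * f1 w)%:E = \sum_(l < n.+1 ^ 2) (dl n)%:E * \int[m0]_(w in B n l) (f1 w)%:E)%E.
  move=> mf1 f10.
  have -> : (fun w => (hn n w * f1 w)%:E) = (fun w => \sum_(l < n.+1 ^ 2) (dl n)%:E * (\1_(B n l) w * f1 w)%:E)%E.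
    apply/funext => w; rewrite /hn mulr_suml -sumEFin; apply: eq_bigr => l _.
    by rewrite -mulrA EFinM.
  have mt l : measurable_fun setT (fun w => (\1_(B n l) w * f1 w)%:E).
    by apply/measurable_EFinP; apply: measurable_funM => //; exact: measurable_indic.
  have t0 l w : (0 <= (\1_(B n l) w * f1 w)%:E)%E by rewrite lee_fin mulr_ge0.
  rewrite ge0_integral_sum//; last 2 first.
  - by move=> l; apply: measurable_funeM.
  - by move=> l w _; rewrite mule_ge0// lee_fin ltW.
  apply: eq_bigr => l _; rewrite ge0_integralZl_EFin ?(ltW (d0 n))//; congr (_ * _)%E.
  rewrite [RHS]integral_mkcond; apply: eq_integral => w _; rewrite patchE indicE.
  by case: (w \in B n l); rewrite ?mul1r ?mul0r.
apply: (fatou_bound (fn := fun n w => hn n w * f w)) => //.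
- by move=> n; exact: measurable_funM.
- exact: measurable_funM.
- by move=> n w; rewrite mulr_ge0.
- by move=> w; rewrite mulr_ge0.
- by apply: aeW => w; apply: cvgMl; exact: chn.
move=> n; rewrite I//; apply: (@le_trans _ _ (\int[nu]_w (hn n w * g w)%:E)%E).
  rewrite I//; apply: lee_sum => l _; apply: lee_wpmul2l; last exact: fg.
  by rewrite lee_fin ltW.
apply: ge0_le_integral => //.
- by move=> w _; rewrite lee_fin mulr_ge0.
- by apply/measurable_EFinP; exact: measurable_funM.
- by apply/measurable_EFinP; exact: measurable_funM.
- by move=> w _; rewrite lee_fin ler_wpM2r.
Unshelve. all: by end_near. Qed.

End Domination.

(** * Transfer along absolute continuity *)

Section AbsoluteContinuity.
Context {d : measure_display} {Omega : measurableType d} {R : realType}.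
Variables (P Q : probability Omega R) (F : R -> set (set Omega)) (T : R).
Hypothesis PQ : forall A, measurable A -> P A = 0%E -> Q A = 0%E.

(** The quantitative form of absolute continuity, by a Borel-Cantelli argument. Emery convergence
    needs it because [del] must not depend on the test integrand. *)
Lemma outer_acont (e : R) : 0 < e -> exists2 del : R, 0 < del & forall A,
  outer_prob_le P A del -> outer_prob_le Q A e.
Proof.
move=> e0; apply: contrapT => nex.
have /choice[A hA] : forall n, exists A, outer_prob_le P A (1 / 2 ^+ n.+1) /\ ~ outer_prob_le Q A e.
  move=> n; apply: contrapT => h; apply: nex; exists (1 / 2 ^+ n.+1); first by rewrite divr_gt0// exprn_gt0.
  by move=> A PA; apply: contrapT => QA; apply: h; exists A.
have /choice[B hB] := fun n => (hA n).1.
pose C n := \bigcup_l B (l + n)%N.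
have mC n : measurable (C n) by apply: bigcup_measurable => l _; have [] := hB (l + n)%N.
have Cd n : C n.+1 `<=` C n by move=> w [l _ h]; exists l.+1 => //; rewrite addSnnS.
have PC n : outer_prob_le P (C n) (1 / 2 ^+ n).
  apply: outer_bigcup; first by rewrite divr_ge0// exprn_ge0.
  move=> l; rewrite geo_split; have [mB _ PB] := hB (l + n)%N; exact/outer_meas.
have mI : measurable (\bigcap_n C n) by exact: bigcapT_measurable.
have P0 : P (\bigcap_n C n) = 0%E.
  apply/eqP; rewrite eq_le measure_ge0 andbT; apply/lee_addgt0Pr => a a0; rewrite add0e.
  have [n hn] := half_pow_small a0.
  apply/outer_meas => //; apply: outer_le hn _; apply: outer_sub (PC n).
  by move=> w; apply.
have Q0 : outer_prob_le Q (\bigcap_n C n) 0 by apply/outer_meas => //; rewrite (PQ mI P0).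
have [n hn] := outer_cont e0 mC Cd (fun w h => h) Q0.
have [_] := hA n; apply; rewrite add0r in hn; apply: outer_sub hn => w Aw.
by exists 0%N => //; have [_ + _] := hB n; apply.
Qed.

Lemma ae_acont (A : Omega -> Prop) : {ae P, forall w, A w} -> {ae Q, forall w, A w}.
Proof. by move=> [N [mN PN AN]]; exists N; split=> //; exact: PQ. Qed.

Lemma ucp_acont (Un : nat -> R -> Omega -> R) U : ucp_cvg P T Un U -> ucp_cvg Q T Un U.
Proof.
move=> h c e c0 e0; have [dl d0 hd] := outer_acont e0.
by have [N hN] := h c dl c0 d0; exists N => m /hN/hd.
Qed.

Lemma emery_acont (Un : nat -> R -> Omega -> R) U : emery_cvg P F T Un U -> emery_cvg Q F T Un U.
Proof.
move=> [h1 h2]; split; first exact: ucp_acont.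
move=> c e c0 e0; have [dl d0 hd] := outer_acont e0.
by have [N hN] := h2 c dl c0 d0; exists N => m /hN h k k1; apply: hd; exact: h.
Qed.

Lemma bounded_int_acont Y K I : bounded_int P F T Y K I -> bounded_int Q F T Y K I.
Proof.
elim=> [k|Kn In K' I' C _ IH KC cK cI]; first exact: bounded_int_simple.
by apply: (@bounded_int_lim _ _ _ Q F T Y Kn In K' I' C) => //; exact: ucp_acont.
Qed.

Lemma self_financing_acont n (S : R -> Omega -> 'cV[R]_n) theta :
  self_financing F T S P theta -> self_financing F T S Q theta.
Proof.
move=> [I [pth [In [hIn cI]]] hV]; exists I; last exact: ae_acont.
split=> //; exists In; split; last exact: emery_acont.
move=> m; have [J [hJ IJ]] := hIn m; exists J; split=> // i.
exact: bounded_int_acont.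
Qed.

End AbsoluteContinuity.

Section ConvergenceInProbability.
Context {d : measure_display} {Omega : measurableType d} {R : realType}.

Lemma cvg_in_probabilityP (P : probability Omega R) (Zn : nat -> Omega -> R) Z :
  (forall m, measurable_fun setT (Zn m)) -> measurable_fun setT Z ->
  cvg_in_probability P Zn Z <-> forall c e, 0 < c -> 0 < e -> exists N, forall m, (N <= m)%N ->
    outer_prob_le P (gtset (fun w => Zn m w - Z w) c) e.
Proof.
move=> mZn mZ; have mA m c : measurable (gtset (fun w => Zn m w - Z w) c).
  by apply: gtset_measurable; exact: measurable_funB.
split=> [h c e c0 e0|h c c0].
  have e0' : (0 < e%:E)%E by rewrite lte_fin.
  have [N _ hN] := h c c0 _ (open_ereal_lt' e0').
  by exists N => m /hN hm; apply/outer_meas => //; exact: ltW.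
apply/fine_cvgP; split; first by apply: nearW => m; apply: fin_num_measure; exact: mA.
apply/cvgrPdist_le => e e0; have [N hN] := h c e c0 e0.
exists N => // m /= /hN/outer_meas => /(_ (mA m c)) hm.
rewrite sub0r normrN ger0_norm ?fine_ge0//.
rewrite -lee_fin fineK//; apply: fin_num_measure; exact: mA.
Qed.

Lemma cvg_in_probabilityM (P : probability Omega R) (Zn : nat -> Omega -> R) Z (f : Omega -> R) :
  (forall m, measurable_fun setT (Zn m)) -> measurable_fun setT Z -> measurable_fun setT f ->
  cvg_in_probability P Zn Z -> cvg_in_probability P (fun m w => f w * Zn m w) (fun w => f w * Z w).
Proof.
move=> mZn mZ mf /(cvg_in_probabilityP _ mZn mZ) h.
apply/cvg_in_probabilityP => [m||c e c0 e0]; [exact: measurable_funM|exact: measurable_funM|].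
have e20 : 0 < e / 2 by lra.
have [n hn] : exists n : nat, outer_prob_le P (gtset f n.+1%:R) (0 + e / 2).
  apply: (outer_cont (A := set0)) => //.
  - by move=> n; exact: gtset_measurable.
  - by move=> n w; apply: lt_trans; rewrite ltr_nat.
  - move=> w hw; have := hw (Num.truncn `|f w|) I.
    by rewrite /gtset/= ltNge (ltW (truncnS_gt _)).
  - by apply: outer_negl => //; exact: negligible_set0.
have [N hN] := h (c / n.+1%:R) (e / 2) (divr_gt0 c0 (ltr0Sn _ _)) e20.
exists N => m /hN hm; rewrite add0r in hn; rewrite [e]splitr.
apply: outer_sub (outerU hn hm) => w; apply: contraPP => /not_orP[/gtsetC h1 /gtsetC h2].
apply/negP; rewrite -leNgt -mulrBr normrM.
apply: (le_trans (ler_pM _ _ h1 h2)) => //.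
by rewrite mulrC divfK.
Qed.

Lemma cvg_in_probability_ae (P : probability Omega R) (Zn Zn' : nat -> Omega -> R) Z Z' :
  (forall m, measurable_fun setT (Zn m)) -> measurable_fun setT Z ->
  (forall m, measurable_fun setT (Zn' m)) -> measurable_fun setT Z' ->
  {ae P, forall w, (forall m, Zn m w = Zn' m w) /\ Z w = Z' w} ->
  cvg_in_probability P Zn Z -> cvg_in_probability P Zn' Z'.
Proof.
move=> mZn mZ mZn' mZ' hae /(cvg_in_probabilityP _ mZn mZ) h.
apply/cvg_in_probabilityP => // c e c0 e0; have [N hN] := h c e c0 e0.
exists N => m /hN; apply: outer_aesub; apply: filterS hae => w [h1 h2].
by rewrite /gtset/= h1 h2.
Qed.

Lemma cvg_in_probability_acont (P Q : probability Omega R) (Zn : nat -> Omega -> R) Z :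
  (forall A, measurable A -> P A = 0%E -> Q A = 0%E) ->
  (forall m, measurable_fun setT (Zn m)) -> measurable_fun setT Z ->
  cvg_in_probability P Zn Z -> cvg_in_probability Q Zn Z.
Proof.
move=> PQ mZn mZ /(cvg_in_probabilityP _ mZn mZ) h.
apply/cvg_in_probabilityP => // c e c0 e0; have [dl d0 hd] := outer_acont PQ e0.
by have [N hN] := h c dl c0 d0; exists N => m /hN/hd.
Qed.

End ConvergenceInProbability.

(** * Stopping times *)

(** The continuous functions [x / (x ^+ 2 + 1 / n.+1)] converge everywhere to the inverse, with the
    limit 0 at 0 matching the convention for [0^-1]. *)
Lemma measurable_inv {R : realType} : measurable_fun setT (fun x : R => x^-1).
Proof.
apply: (measurable_fun_cvg (h := fun (n : nat) (x : measurableTypeR R) => (x : R) / ((x : R) ^+ 2 + n.+1%:R^-1) : R)) => [n|x _].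
  apply: continuous_measurable_fun => x; apply: cvgM; first exact: cvg_id.
  apply: cvgV; last by apply: cvgD; [exact: exprn_continuous|exact: cvg_cst].
  by rewrite gt_eqF// ltr_wpDl ?sqr_ge0// invr_gt0.
have [->|x0] := eqVneq x 0.
  by under eq_fun do rewrite mul0r; rewrite invr0; exact: cvg_cst.
rewrite [x^-1](_ : _ = x / (x ^+ 2 + 0)); last by rewrite addr0 expr2 invfM mulrA divff// mul1r.
apply: cvgM; first exact: cvg_cst.
apply: cvgV; first by rewrite addr0 expf_neq0.
by apply: cvgD; [exact: cvg_cst|exact: cvg_harmonic].
Qed.

Lemma sigma_setD {Omega : pointedType} (G : set (set Omega)) A B :
  sigma_algebra setT G -> G A -> G B -> G (A `\` B).
Proof.
move=> sG; have E : @measurable _ (g_sigma_algebraType G) = G.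
  by rewrite /measurable/= sigma_algebra_id.
rewrite -E; exact: measurableD.
Qed.

Section StoppingTimes.
Context {d : measure_display} {Omega : measurableType d} {R : realType}.
Variables (F : R -> set (set Omega)) (T : R).
Hypotheses (T_gt0 : 0 < T) (Ffil : filtration F T).
Implicit Types (Y : R -> Omega -> R) (sigma : Omega -> R).
Let T_ge0 : 0 <= T := ltW T_gt0.

Lemma predictable_stopped K sigma : predictable F T K -> stopping_time F T sigma ->
  measurable_fun setT (fun w => K (sigma w) w).
Proof.
move=> pK [sT sF] _ B mB; rewrite setTI; have := pK B mB.
have mle s : 0 <= s <= T -> measurable [set w | sigma w <= s].
  by move=> h; apply: (Fmeasurable Ffil h); exact: sF.
pose H := [set D : set (R * Omega) | measurable [set w | D (sigma w, w)]].
suff : <<s `[0, T] `*` setT, predictable_rectangles F T >> `<=` H.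
  move=> /[apply]; rewrite /H/= (_ : [set w | _] = (fun w => K (sigma w) w) @^-1` B)//.
  apply/seteqP; split => w /=; first by move=> [].
  by move=> h; split=> //; rewrite in_itv/= sT.
apply: smallest_sub.
  split; first by rewrite /H/= (_ : [set w | _] = set0).
    move=> D hD; rewrite /H/= (_ : [set w | _] = setT `\` [set w | D (sigma w, w)]); first exact: measurableD.
    apply/seteqP; split => w /=; first by move=> [_].
    by move=> [_ h]; split=> //; rewrite in_itv/= sT.
  move=> D hD; rewrite /H/= (_ : [set w | _] = \bigcup_l [set w | D l (sigma w, w)]); first by apply: bigcup_measurable => l _; exact: hD.
  by apply/seteqP; split => w [l _ h]; exists l.
move=> D [[A FA ->]|[s [u [A [s0 su uT FA ->]]]]]; rewrite /H/=.
  have z : 0 <= (0 : R) <= T by rewrite lexx.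
  rewrite (_ : [set w | _] = [set w | sigma w <= 0] `&` A).
    apply: measurableI; first exact: mle.
    exact: (Fmeasurable Ffil z).
  apply/seteqP; split => w /=; first by move=> [[->] ?].
  move=> [h ?]; split=> //; apply/eqP; rewrite eq_le h; by case/andP: (sT w).
have hs : 0 <= s <= T by rewrite s0 (le_trans su).
have hu : 0 <= u <= T by rewrite (le_trans s0 su).
rewrite (_ : [set w | _] = ([set w | sigma w <= u] `\` [set w | sigma w <= s]) `&` A).
  apply: measurableI; first by apply: measurableD; exact: mle.
  exact: (Fmeasurable Ffil hs).
apply/seteqP; split => w /=.
  by rewrite in_itv/= => -[/andP[h1 h2] ?]; split=> //; split=> //; apply/negP; rewrite -ltNge.
by move=> [[h1 /negP]]; rewrite -ltNge => h2 ?; split=> //; rewrite in_itv/= h2.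
Qed.

Definition mesh (n j : nat) : R := j%:R * T / n.+1%:R.

Lemma mesh_grid n : is_grid T (mesh n) n.+1.
Proof.
split; first by rewrite /mesh !mul0r.
  by rewrite /mesh mulrAC divff ?mul1r// gt_eqF.
by move=> i j ij; rewrite /mesh ler_pM2r ?invr_gt0// ler_pM2r// ler_nat.
Qed.

(** Rounding up to the mesh looks only at closed inequalities on [sigma] at mesh times, so each
    level set is known at the rounded time even if the filtration is not right-continuous. *)
Lemma right_mesh sigma : stopping_time F T sigma -> exists J : nat -> Omega -> nat,
  (forall n w, [/\ (J n w <= n.+1)%N, sigma w <= mesh n (J n w) & mesh n (J n w) <= sigma w + T / n.+1%:R]) /\
  (forall n j, (j <= n.+1)%N -> F (mesh n j) [set w | J n w = j]).
Proof.
move=> [sT sF].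
have tg n := mesh_grid n.
have mS n j : mesh n j.+1 = mesh n j + T / n.+1%:R by rewrite /mesh -natr1; ring.
have /choice[J hJ] : forall nw : nat * Omega, exists j : nat, (j <= nw.1.+1)%N /\
    sigma nw.2 <= mesh nw.1 j /\ if j is j'.+1 then mesh nw.1 j' < sigma nw.2 else sigma nw.2 <= 0.
  move=> [n w] /=; have /andP[s0 s1] := sT w; have [h|h] := ltP 0 (sigma w).
    have [|j jr /andP[h1 h2]] := grid_locate (tg n) (x := sigma w); first by rewrite h.
    by exists j.+1.
  by exists 0%N; have [-> _ _] := tg n.
exists (fun n w => J (n, w)); split.
  move=> n w; have [h1 [h2 h3]] := hJ (n, w); split=> //; case: (J (n, w)) h3 => [|j] /= h3.
    have [-> _ _] := tg n; rewrite addr_ge0 ?divr_ge0//; by case/andP: (sT w).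
  by rewrite mS lerD2r ltW.
move=> n j jn; have jT := grid_in (tg n) jn; have sj := Fsigma Ffil jT.
have mono i l : (i <= l)%N -> mesh n i <= mesh n l by have [_ _] := tg n; exact.
case: j jn jT sj => [|j] jn jT sj.
  rewrite (_ : [set w | _] = [set w | sigma w <= mesh n 0]); first exact: sF.
  have [m0 _ _] := tg n; apply/seteqP; split => w /=.
    by move=> e; have [_ [h _]] := hJ (n, w); rewrite e in h.
  move=> h; have [_ [h2 h3]] := hJ (n, w); case: (J (n, w)) h3 => //= l h3.
  have := lt_le_trans h3 h; rewrite ltNge mono//.
have jT' := grid_in (tg n) (ltnW jn).
rewrite (_ : [set w | _] = [set w | sigma w <= mesh n j.+1] `\` [set w | sigma w <= mesh n j]).
  have h1 := sF _ jT; have h2 : F (mesh n j.+1) [set w | sigma w <= mesh n j].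
    have /andP[j0 _] := jT'; have /andP[_ j1] := jT.
    by apply: (Ffil.2 _ _ j0 (grid_step (tg n) j) j1); exact: sF.
  exact: sigma_setD.
apply/seteqP; split => w /=.
  by move=> e; have [_ [h2 h3]] := hJ (n, w); rewrite e in h2 h3; split=> //; apply/negP; rewrite -ltNge.
move=> [h1 /negP]; rewrite -ltNge => h2; have [_ [h3 h4]] := hJ (n, w).
apply/eqP; rewrite eqn_leq; apply/andP; split.
  case: (J (n, w)) h4 => //= l h4; rewrite ltnNge; apply/negP => jl.
  by have := lt_le_trans h4 h1; rewrite ltNge mono.
rewrite ltnNge; apply/negP => jl.
by have := lt_le_trans h2 h3; rewrite ltNge mono.
Qed.

Lemma mesh_in n j : (j <= n.+1)%N -> 0 <= mesh n j <= T.
Proof. exact: (grid_in (mesh_grid n)). Qed.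

Variables (sigma : Omega -> R) (J : nat -> Omega -> nat).
Hypotheses (sst : stopping_time F T sigma)
  (Jle : forall n w, [/\ (J n w <= n.+1)%N, sigma w <= mesh n (J n w) & mesh n (J n w) <= sigma w + T / n.+1%:R])
  (JF : forall n j, (j <= n.+1)%N -> F (mesh n j) [set w | J n w = j]).

Definition rstop n w := mesh n (J n w).

Lemma rstop_in n w : 0 <= rstop n w <= T.
Proof. by apply: mesh_in; have [] := Jle n w. Qed.

Lemma rstop_stopping n : stopping_time F T (rstop n).
Proof.
split; first by move=> w; exact: rstop_in.
move=> t tT; have st := Fsigma Ffil tT; have [F0 FC FU] := st.
rewrite (_ : [set w | _] = \bigcup_j (if (j <= n.+1)%N && (mesh n j <= t) then [set w | J n w = j] else set0)).
  apply: FU => j; case: ifPn => // /andP[jn jt].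
  have /andP[j0 _] := mesh_in jn; have /andP[_ t1] := tT.
  by apply: (Ffil.2 _ _ j0 jt t1); exact: JF.
apply/seteqP; split => w /=.
  by move=> h; exists (J n w) => //; have [-> _ _] := Jle n w; rewrite h.
by move=> [j _]; case: ifPn => // /andP[_ h] /= jE; rewrite /rstop jE.
Qed.

Lemma rstop_sum n Y w : Y (rstop n w) w = \sum_(j < n.+2) Y (mesh n j) w * \1_[set w | J n w = j] w.
Proof.
have [jn _ _] := Jle n w; have jn' : (J n w < n.+2)%N by [].
rewrite (bigD1 (Ordinal jn'))//= big1 ?addr0; last first.
  move=> i ij; rewrite indicE memNset ?mulr0//= => e; move/eqP: ij; apply; exact/val_inj.
by rewrite indicE mem_set// mulr1.
Qed.

Lemma rstop_measurable n Y : adapted F T Y -> measurable_fun setT (fun w => Y (rstop n w) w).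
Proof.
move=> aY; under eq_fun do rewrite rstop_sum.
apply: measurable_sum => j; have jT := mesh_in (ltn_ord j : (j <= n.+1)%N).
apply: measurable_funM; first exact: (adapted_meas Ffil aY jT).
by apply: measurable_indic; apply: (Fmeasurable Ffil jT); apply: JF; exact: (ltn_ord j).
Qed.

Lemma rstop_cvg (f : R -> R) w : rcont T f -> f (rstop n w) @[n --> \oo] --> f (sigma w).
Proof.
move=> fc; have /andP[s0 s1] := sst.1 w; have [sT|sT] := ltP (sigma w) T; last first.
  have E : sigma w = T by apply/eqP; rewrite eq_le s1.
  have H n : rstop n w = T.
    have [_ h _] := Jle n w; have /andP[_ h2] := rstop_in n w.
    by apply/eqP; rewrite eq_le h2 -E.
  by under eq_fun do rewrite H; rewrite E; exact: cvg_cst.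
apply/cvgrPdist_lt => e e0; have [|h h0 H] := fc (sigma w) _ e e0; first by rewrite s0.
near=> n; rewrite distrC; apply: H; have [_ -> h2] := Jle n w => /=.
apply: (le_lt_trans h2); rewrite ltrD2l ltr_pdivrMr// mulrC -ltr_pdivrMr//.
apply: (lt_le_trans (truncnS_gt _)); rewrite ler_nat ltnS; near: n; exact: nbhs_infty_ge.
Unshelve. all: by end_near. Qed.

End StoppingTimes.

Section Stopped.
Context {d : measure_display} {Omega : measurableType d} {R : realType}.
Variables (P : probability Omega R) (F : R -> set (set Omega)) (T : R).
Hypotheses (T_gt0 : 0 < T) (Ffil : filtration F T).
Implicit Types (Y : R -> Omega -> R) (sigma : Omega -> R).
Let T_ge0 : 0 <= T := ltW T_gt0.

Lemma stopped_measurable Y sigma : adapted F T Y -> cadlag T Y -> stopping_time F T sigma ->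
  measurable_fun setT (fun w => Y (sigma w) w).
Proof.
move=> aY cY st; have [J [h1 h2]] := right_mesh T_gt0 Ffil st.
apply: (measurable_fun_cvg (h := fun n w => Y (rstop T J n w) w)).
  move=> n; have := @rstop_measurable _ _ _ F T T_gt0 Ffil sigma J h1 h2 n Y aY; exact.
move=> w _; apply: (rstop_cvg T_gt0 st h1 (f := Y ^~ w)).
by apply/rcontP => t tT; exact: (cY w).1.
Qed.

Lemma wealth_stopped_measurable n (S : R -> Omega -> 'cV[R]_n) theta sigma :
  (forall i, adapted F T (fun t w => S t w i ord0)) -> (forall i, cadlag T (fun t w => S t w i ord0)) ->
  predictable_vec F T theta -> stopping_time F T sigma ->
  measurable_fun setT (fun w => wealth S theta (sigma w) w).
Proof.
move=> aS cS pth st; under eq_fun do rewrite /wealth mxE.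
apply: measurable_sum => i; apply: measurable_funM; last exact: stopped_measurable (aS i) (cS i) st.
exact: predictable_stopped (pth i) st.
Qed.

(** At a time with finitely many values the integral splits over the values, and on each piece the
    comparison at a deterministic time applies with a weight known at that time. *)
Lemma rstop_compare sigma J n (U f g : R -> Omega -> R) :
  (forall n w, [/\ (J n w <= n.+1)%N, sigma w <= mesh T n (J n w) & mesh T n (J n w) <= sigma w + T / n.+1%:R]) ->
  (forall n j, (j <= n.+1)%N -> F (mesh T n j) [set w | J n w = j]) ->
  adapted F T U -> (forall t w, 0 <= U t w) ->
  (forall t, 0 <= t <= T -> measurable_fun setT (f t)) -> (forall t, 0 <= t <= T -> measurable_fun setT (g t)) ->
  (forall t w, 0 <= f t w) -> (forall t w, 0 <= g t w) ->
  (forall t, 0 <= t <= T -> forall B, F t B -> (\int[P]_(w in B) (f t w)%:E <= \int[P]_(w in B) (g t w)%:E)%E) ->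
  (\int[P]_w (U (rstop T J n w) w * f (rstop T J n w) w)%:E <=
   \int[P]_w (U (rstop T J n w) w * g (rstop T J n w) w)%:E)%E.
Proof.
move=> h1 h2 aU U0 mf mg f0 g0 fg.
pose ind j w : R := \1_[set w | J n w = j] w.
have mind (j : 'I_n.+2) : Fmeas (F (mesh T n j)) (ind j).
  have jT := mesh_in T_gt0 (ltn_ord j : (j <= n.+1)%N); have sj := Fsigma Ffil jT.
  rewrite (_ : ind j = fun w => if w \in [set w | J n w = j] then cst 1 w else cst 0 w).
    by apply: (Fmeas_if sj); [apply: h2; exact: (ltn_ord j)|exact: Fmeas_cst|exact: Fmeas_cst].
  by apply/funext => w; rewrite /ind indicE; case: (w \in _).
have E (f1 : R -> Omega -> R) : (forall t, 0 <= t <= T -> measurable_fun setT (f1 t)) -> (forall t w, 0 <= f1 t w) ->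
    (\int[P]_w (U (rstop T J n w) w * f1 (rstop T J n w) w)%:E =
     \sum_(j < n.+2) \int[P]_w ((U (mesh T n j) w * ind j w) * f1 (mesh T n j) w)%:E)%E.
  move=> mf1 f10; rewrite -ge0_integral_sum//.
  - apply: eq_integral => w _; rewrite sumEFin; congr EFin.
    rewrite (rstop_sum h1 n (fun t w => U t w * f1 t w)); apply: eq_bigr => j _.
    by rewrite /ind; ring.
  - move=> j; have jT := mesh_in T_gt0 (ltn_ord j : (j <= n.+1)%N).
    apply/measurable_EFinP; apply: measurable_funM; last exact: mf1.
    apply: measurable_funM; first by apply: (Fmeas_meas Ffil jT); exact: (aU _ jT).
    exact: (Fmeas_meas Ffil jT).
  - by move=> j w _; rewrite lee_fin !mulr_ge0// /ind indicE ler0n.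
rewrite !E//; apply: lee_sum => j _.
have jT := mesh_in T_gt0 (ltn_ord j : (j <= n.+1)%N); have sj := Fsigma Ffil jT.
apply: (density_compare sj (Fmeasurable Ffil jT)) => //; [exact: mf|exact: mg|exact: fg| |].
  by apply: (FmeasM sj) => //; exact: (aU _ jT).
by move=> w; rewrite mulr_ge0// /ind indicE ler0n.
Qed.

End Stopped.

(** * Quadratic hedging *)

Section ChangeOfNumeraire.
Context {d : measure_display} {Omega : measurableType d} {R : realType}.
Variables (P : probability Omega R) (T : R) (T_gt0 : 0 < T)
  (F : R -> set (set Omega)) (Ffil : filtration F T)
  (n : nat) (i0 : 'I_n) (S : R -> Omega -> 'cV[R]_n) (S_semimart : semimartingale_vec P F T S).
Notation X := (asset S i0).
Definition discounted (t : R) (w : Omega) : 'cV[R]_n := (X t w)^-1 *: S t w.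
Notation Shat := discounted.
Hypothesis X_nice : nice_numeraire F T P X.
Notation m := (fine 'E_P[fun w => (X T w ^+ 2)%R]%E).
Variable Phat : probability Omega R.
Hypothesis Phat_density : forall A, measurable A ->
  Phat A = (\int[P]_(w in A) (X T w ^+ 2 / m)%:E)%E.

Let T_ge0 : 0 <= T := ltW T_gt0.
Let tT : 0 <= T <= T. Proof. by rewrite T_ge0 lexx. Qed.

Lemma asset_adapted i : adapted F T (fun t w => S t w i ord0).
Proof. by have [] := S_semimart i. Qed.

Lemma asset_cadlag i : cadlag T (fun t w => S t w i ord0).
Proof. by have [] := S_semimart i. Qed.

Lemma numeraire_pos : {ae P, forall w, forall t, 0 <= t <= T -> 0 < X t w}.
Proof. by apply: filterS X_nice.1 => w []. Qed.

Lemma numeraire_measurable t : 0 <= t <= T -> measurable_fun setT (X t).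
Proof. by move=> ht; apply: (adapted_meas Ffil (asset_adapted i0) ht). Qed.

Let mX2 : measurable_fun setT (fun w => X T w ^+ 2).
Proof. by apply: measurable_funX; exact: numeraire_measurable. Qed.

Lemma second_moment : ('E_P[fun w => (X T w ^+ 2)%R] = m%:E)%E.
Proof.
rewrite fineK// unlock; apply: integrable_fin_num => //.
by have [_ [lo [hi [_ _ /(_ T tT)[Y [] iX _ _ _ _]]]]] := X_nice.
Qed.

(** If [m] were 0, division by it would give the density 0 and [Phat] would have no mass. *)
Lemma second_moment_gt0 : 0 < m.
Proof.
rewrite lt_neqAle; apply/andP; split; last first.
  rewrite fine_ge0// unlock; apply: integral_ge0 => w _; rewrite lee_fin; exact: sqr_ge0.
apply/eqP => m0; have := Phat_density measurableT; rewrite probability_setT -m0.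
under eq_integral do rewrite invr0 mulr0.
by rewrite integral0 => /eqP; rewrite eqe oner_eq0.
Qed.

Lemma null_PQ A : measurable A -> P A = 0%E -> Phat A = 0%E.
Proof.
move=> mA PA; rewrite Phat_density//; apply: null_set_integral => //.
by apply: measurable_funTS; apply/measurable_EFinP; exact: measurable_funM.
Qed.

Lemma null_QP A : measurable A -> Phat A = 0%E -> P A = 0%E.
Proof.
move=> mA; rewrite Phat_density// => h.
have mD : measurable_fun A (fun w => (X T w ^+ 2 / m)%:E).
  by apply: measurable_funTS; apply/measurable_EFinP; exact: measurable_funM.
have D0 w : (0 <= (X T w ^+ 2 / m)%:E)%E by rewrite lee_fin divr_ge0 ?sqr_ge0 ?(ltW second_moment_gt0).
have /(ae_eq_integral_abs P mA mD) H : (\int[P]_(w in A) `|(X T w ^+ 2 / m)%:E| = 0)%E.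
  by rewrite -[RHS]h; apply: eq_integral => w _; rewrite gee0_abs.
apply: measure_negligible => //.
have H2 : {ae P, forall w, ~ A w}.
  apply: filterS2 H numeraire_pos => w h1 h2 Aw; have := h1 Aw => -[] /eqP.
  by rewrite mulf_eq0 invr_eq0 expf_eq0/= !gt_eqF ?second_moment_gt0 ?h2.
by apply: negligibleS H2 => w Aw /(_ Aw).
Qed.

(** The measure identity on sets is extended to nonnegative functions by [density_compare] in both
    directions, comparing the constant 1 under [Phat] with the density under [P]. *)
Lemma density_integral (h : Omega -> R) : measurable_fun setT h -> (forall w, 0 <= h w) ->
  (m%:E * \int[Phat]_w (h w)%:E = \int[P]_w (h w * X T w ^+ 2)%:E)%E.
Proof.
move=> mh h0; have mm := second_moment_gt0.
have mF : Fmeas measurable h by apply/Fmeas_measurable.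
have D0 w : 0 <= X T w ^+ 2 / m by rewrite divr_ge0 ?sqr_ge0 ?(ltW mm).
have mD : measurable_fun setT (fun w => X T w ^+ 2 / m) by exact: measurable_funM.
have E B : measurable B -> (\int[Phat]_(w in B) (cst (1 : R) w)%:E = \int[P]_(w in B) (X T w ^+ 2 / m)%:E)%E.
  move=> mB; rewrite -Phat_density// -[RHS]mul1e -integral_cst//.
have -> : (\int[Phat]_w (h w)%:E = \int[P]_w (h w * (X T w ^+ 2 / m))%:E)%E.
  rewrite (_ : (\int[Phat]_w (h w)%:E = \int[Phat]_w (h w * cst (1 : R) w)%:E)%E); last first.
    by apply: eq_integral => w _; rewrite mulr1.
  apply/eqP; rewrite eq_le; apply/andP; split;
    apply: (density_compare (@sigma_algebra_measurable _ Omega)) => // B mB; by rewrite E.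
rewrite -ge0_integralZl_EFin//; last 3 first.
- by move=> w _; rewrite lee_fin mulr_ge0.
- by apply/measurable_EFinP; exact: measurable_funM.
- exact: ltW.
by apply: eq_integral => w _; rewrite -EFinM; congr EFin; field; rewrite gt_eqF.
Qed.

Lemma asset_good i : good P F T (asset S i).
Proof. by apply: semimartingale_good => //; exact: S_semimart. Qed.

Lemma numeraireV_adapted : adapted F T (fun t w => (X t w)^-1).
Proof.
move=> t ht; apply: (Fmeas_comp (Fsigma Ffil ht) measurable_inv).
exact: (asset_adapted i0 ht).
Qed.

Lemma numeraireV_good : good P F T (fun t w => (X t w)^-1).
Proof.
apply: (goodV T_gt0 Ffil (asset_good i0)); first exact: numeraireV_adapted.
apply: filterS X_nice.1 => w [h1 h2]; split; first by move=> t ht; rewrite gt_eqF// h1.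
apply: (cadlagV_bounded01 T_gt0 (f := X ^~ w)).
- by move=> t ht; exact: (asset_cadlag i0 w).1.
- by move=> t ht; exact: (asset_cadlag i0 w).2.
- by move=> t ht; rewrite gt_eqF// h1.
- by move=> t ht; rewrite gt_eqF// h2.
Qed.

Lemma discounted_good i : good P F T (asset Shat i).
Proof.
rewrite (_ : asset Shat i = fun t w => (X t w)^-1 * asset S i t w).
  by apply: goodM => //; [exact: numeraireV_good|exact: asset_good].
by apply/funext => t; apply/funext => w; rewrite /asset mxE.
Qed.

Lemma self_financing_discounted theta :
  self_financing F T S P theta <-> self_financing F T Shat Phat theta.
Proof.
split=> h.
  apply: (self_financing_acont null_PQ).
  apply: (self_financing_numeraire T_gt0 Ffil asset_good discounted_good numeraireV_good _ h).
  by apply: aeW.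
have {}h := self_financing_acont null_QP h.
apply: (self_financing_numeraire T_gt0 Ffil discounted_good asset_good (asset_good i0) _ h).
apply: filterS numeraire_pos => w hw t ht.
by rewrite /discounted scalerA divff ?scale1r// gt_eqF// hw.
Qed.

Lemma wealth_discounted theta t w : wealth Shat theta t w = (X t w)^-1 * wealth S theta t w.
Proof. by rewrite /wealth -scalemxAr mxE. Qed.

Lemma self_financing_predictable (Q : probability Omega R) (S' : R -> Omega -> 'cV[R]_n) theta :
  self_financing F T S' Q theta -> predictable_vec F T theta.
Proof. by move=> [I []]. Qed.

Let mV theta sigma : predictable_vec F T theta -> stopping_time F T sigma ->
  measurable_fun setT (fun w => wealth S theta (sigma w) w).
Proof. exact: (wealth_stopped_measurable T_gt0 Ffil asset_adapted asset_cadlag). Qed.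

Let mX sigma : stopping_time F T sigma -> measurable_fun setT (fun w => X (sigma w) w).
Proof. exact: (stopped_measurable T_gt0 Ffil (asset_adapted i0) (asset_cadlag i0)). Qed.

Let mVhat theta sigma : predictable_vec F T theta -> stopping_time F T sigma ->
  measurable_fun setT (fun w => wealth Shat theta (sigma w) w).
Proof.
move=> pth st; under eq_fun do rewrite wealth_discounted.
apply: measurable_funM; last exact: mV.
exact: (measurableT_comp measurable_inv (mX st)).
Qed.

Lemma stopping_T : stopping_time F T (fun=> T).
Proof.
split=> // t /andP[t0 t1]; have ht : 0 <= t <= T by rewrite t0.
have [F0 FC _] := Fsigma Ffil ht.
have [h|h] := leP T t; last by rewrite (_ : [set w | _] = set0)//; apply/seteqP; split.
rewrite (_ : [set w | _] = setT `\` set0); first exact: FC.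
by rewrite setD0; apply/seteqP; split.
Qed.

(** The nice-numeraire bounds in integrated form over sets of [F t], which removes the version of
    the conditional expectation and is what [rstop_compare] consumes. *)
Lemma numeraire_bounds : exists lo hi : R, [/\ 0 < lo, 0 < hi &
  forall t, 0 <= t <= T -> forall B, F t B ->
   ((\int[P]_(w in B) (lo * X t w ^+ 2)%:E <= \int[P]_(w in B) (X T w ^+ 2)%:E) /\
    (\int[P]_(w in B) (X T w ^+ 2)%:E <= \int[P]_(w in B) (hi * X t w ^+ 2)%:E))%E].
Proof.
have [_ [lo [hi [lo0 lohi hY]]]] := X_nice; exists lo, hi; split=> //; first exact: lt_le_trans lohi.
move=> t ht B FB; have [Y [_ iY mY eY] hb] := hY t ht.
have mB : measurable B by exact: (Fmeasurable Ffil ht).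
have mYm : measurable_fun setT Y by apply: (Fmeas_meas Ffil ht).
have mXt := numeraire_measurable ht.
have mX2t (c : R) : measurable_fun setT (fun w => (c * X t w ^+ 2)%:E).
  by apply/measurable_EFinP; apply: measurable_funM => //; exact: measurable_funX.
(* [Y] is nonnegative only almost everywhere; its positive part allows comparison of nonnegative
   integrals. *)
pose Yp w := Num.max (Y w) 0.
have mYp : measurable_fun setT (EFin \o Yp) by apply/measurable_EFinP; exact: measurable_maxr.
have hb' : {ae P, forall w, [/\ 0 <= Y w, lo * X t w ^+ 2 <= Y w & Y w <= hi * X t w ^+ 2]}.
  apply: filterS2 hb numeraire_pos => w /andP[h1 h2] h3.
  have x0 : 0 < X t w ^+ 2 by rewrite exprn_gt0// h3.
  move: h1 h2; rewrite ler_pdivlMr// ler_pdivrMr// => h1 h2.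
  by split=> //; apply: le_trans h1; rewrite mulr_ge0// ltW.
rewrite -eY// (_ : (\int[P]_(w in B) (Y w)%:E = \int[P]_(w in B) (Yp w)%:E)%E); last first.
  apply: ae_eq_integral => //; [exact: measurable_funTS (measurable_int _ iY)|exact: measurable_funTS|].
  by apply: filterS hb' => w [h _ _] _; rewrite /Yp max_l.
split; apply: ae_ge0_le_integral => //;
  try (by move=> w _; rewrite lee_fin ?le_max ?lexx ?orbT// mulr_ge0 ?sqr_ge0// ltW// (lt_le_trans lo0));
  try exact: measurable_funTS;
  by apply: filterS hb' => w [h1 h2 h3] _; rewrite lee_fin /Yp max_l.
Qed.

Definition sq_wealth (S' : R -> Omega -> 'cV[R]_n) (theta : R -> Omega -> 'rV[R]_n) t w : R :=
  wealth S' theta t w ^+ 2.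

Lemma discounted_sq theta : {ae P, forall w, forall t, 0 <= t <= T ->
  sq_wealth Shat theta t w * X t w ^+ 2 = sq_wealth S theta t w}.
Proof.
apply: filterS numeraire_pos => w hw t ht; rewrite /sq_wealth wealth_discounted exprMn exprVn.
by rewrite mulrC mulVKf// expf_neq0// gt_eqF// hw.
Qed.

Lemma expectationE (Q : probability Omega R) (f : Omega -> R) : ('E_Q[f] = \int[Q]_w (f w)%:E)%E.
Proof. by rewrite unlock. Qed.

Lemma sup_finite theta (Q : probability Omega R) (S' : R -> Omega -> 'cV[R]_n) :
  (ereal_sup [set 'E_Q[fun w => (wealth S' theta (sigma w) w ^+ 2)%R] | sigma in stopping_time F T] < +oo)%E <->
  exists M : R, forall sigma, stopping_time F T sigma ->
    (\int[Q]_w (sq_wealth S' theta (sigma w) w)%:E <= M%:E)%E.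
Proof.
split=> [h|[M hM]].
  have h0 : (0 <= ereal_sup [set 'E_Q[fun w => (wealth S' theta (sigma w) w ^+ 2)%R] | sigma in stopping_time F T])%E.
    apply: (@le_trans _ _ ('E_Q[fun w => (wealth S' theta T w ^+ 2)%R])%E).
      by rewrite expectationE; apply: integral_ge0 => w _; rewrite lee_fin sqr_ge0.
    by apply: ereal_sup_ubound; exists (fun=> T) => //; exact: stopping_T.
  exists (fine (ereal_sup [set 'E_Q[fun w => (wealth S' theta (sigma w) w ^+ 2)%R] | sigma in stopping_time F T])%E).
  move=> sigma st; rewrite fineK; last by rewrite ge0_fin_numE.
  by apply: ereal_sup_ubound; exists sigma => //; rewrite expectationE.
apply: (@le_lt_trans _ _ M%:E); last exact: ltry.
by apply: ge_ereal_sup => _ [sigma st <-]; rewrite expectationE; exact: hM.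
Qed.

(** * Transfer of the uniform second-moment bound *)

Section Tame.
Variable theta : R -> Omega -> 'rV[R]_n.
Hypothesis sf : self_financing F T S P theta.

Let pth : predictable_vec F T theta := self_financing_predictable sf.
Let rV : regular P F T (wealth S theta) := (self_financing_regular T_gt0 Ffil (fun i => (asset_good i).1) sf).1.

Let aU : adapted F T (sq_wealth Shat theta).
Proof.
move=> t ht; rewrite (_ : sq_wealth Shat theta t = fun w => ((X t w)^-1 * wealth S theta t w) * ((X t w)^-1 * wealth S theta t w)).
  have sF := Fsigma Ffil ht; have h : Fmeas (F t) (fun w => (X t w)^-1 * wealth S theta t w).
    by apply: (FmeasM sF); [exact: (numeraireV_adapted ht)|exact: (rV.1 t ht)].
  exact: (FmeasM sF).
by apply/funext => w; rewrite /sq_wealth wealth_discounted expr2.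
Qed.

Let U0 S' t w : 0 <= sq_wealth S' theta t w. Proof. exact: sqr_ge0. Qed.

Let mS sigma : stopping_time F T sigma -> measurable_fun setT (fun w => sq_wealth S theta (sigma w) w).
Proof. by move=> st; apply: measurable_funX; exact: mV. Qed.

Let mShat sigma : stopping_time F T sigma -> measurable_fun setT (fun w => sq_wealth Shat theta (sigma w) w).
Proof. by move=> st; apply: measurable_funX; exact: mVhat. Qed.

Let rcU : {ae P, forall w, rcont T (sq_wealth S theta ^~ w) /\ rcont T (sq_wealth Shat theta ^~ w)}.
Proof.
apply: filterS2 rV.2 (numeraireV_good.1).2 => w [h1 _] [h2 _].
have e2 S' : sq_wealth S' theta ^~ w = fun t => wealth S' theta t w * wealth S' theta t w.
  by apply/funext => t; rewrite /sq_wealth expr2.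
rewrite !e2; split; first exact: rcontM.
have h3 : rcont T (fun t => wealth Shat theta t w).
  rewrite (_ : (fun t => _) = fun t => (X t w)^-1 * wealth S theta t w); first exact: rcontM.
  by apply/funext => t; rewrite wealth_discounted.
exact: rcontM.
Qed.

Lemma sq_wealth_integral (c : R) sigma : 0 <= c -> stopping_time F T sigma ->
  (\int[P]_w (sq_wealth Shat theta (sigma w) w * (c * X (sigma w) w ^+ 2))%:E =
   c%:E * \int[P]_w (sq_wealth S theta (sigma w) w)%:E)%E.
Proof.
move=> c0 st; have mc : measurable_fun setT (fun w => c * X (sigma w) w ^+ 2).
  by apply: measurable_funM => //; apply: measurable_funX; exact: mX.
rewrite -ge0_integralZl_EFin//; last 2 first.
- by move=> w _; rewrite lee_fin.
- by apply/measurable_EFinP; exact: mS.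
apply: ge0_ae_eq_integral => //.
- by apply/measurable_EFinP; apply: measurable_funM => //; exact: mShat.
- by apply/measurable_EFinP; apply: measurable_funM => //; exact: mS.
- by move=> w _; rewrite lee_fin mulr_ge0// mulr_ge0// sqr_ge0.
- by move=> w _; rewrite -EFinM lee_fin mulr_ge0.
apply: filterS (discounted_sq theta) => w hw _; rewrite -EFinM mulrCA hw//.
exact: st.1.
Qed.

Let mc (c : R) t : 0 <= t <= T -> measurable_fun setT (fun w => c * X t w ^+ 2).
Proof. by move=> ht; apply: measurable_funM => //; apply: measurable_funX; exact: numeraire_measurable. Qed.

(* Optional sampling is replaced by Fatou's lemma along mesh-valued stopping times decreasing to sigma. *)
Lemma sq_wealth_upper : exists2 hi : R, 0 < hi & forall (M : \bar R),
  (forall sigma, stopping_time F T sigma -> (\int[P]_w (sq_wealth S theta (sigma w) w)%:E <= M)%E) ->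
  forall sigma, stopping_time F T sigma ->
   (m%:E * \int[Phat]_w (sq_wealth Shat theta (sigma w) w)%:E <= hi%:E * M)%E.
Proof.
have [lo [hi [lo0 hi0 hb]]] := numeraire_bounds; exists hi => // M hM sigma st.
rewrite density_integral//; last exact: mShat.
have [J [h1 h2]] := right_mesh T_gt0 Ffil st.
apply: (fatou_bound (fn := fun l w => sq_wealth Shat theta (rstop T J l w) w * X T w ^+ 2)).
- move=> l; apply: measurable_funM => //; apply: mShat; exact: (rstop_stopping T_gt0 Ffil h1 h2 l).
- by apply: measurable_funM => //; exact: mShat.
- by move=> l w; rewrite mulr_ge0// sqr_ge0.
- by move=> w; rewrite mulr_ge0// sqr_ge0.
- apply: filterS rcU => w [_ hw]; apply: cvgMl; exact: (rstop_cvg T_gt0 st h1 hw).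
move=> l; have sl := rstop_stopping T_gt0 Ffil h1 h2 l.
apply: (@le_trans _ _ (\int[P]_w (sq_wealth Shat theta (rstop T J l w) w * (hi * X (rstop T J l w) w ^+ 2))%:E)%E).
  have H := @rstop_compare _ _ _ P F T T_gt0 Ffil sigma J l (sq_wealth Shat theta) (fun _ w => X T w ^+ 2)
    (fun t w => hi * X t w ^+ 2) h1 h2 aU; apply: H => //.
  - by move=> t ht; exact: mc.
  - by move=> t w; exact: sqr_ge0.
  - by move=> t w; rewrite mulr_ge0 ?sqr_ge0 ?(ltW hi0).
  - by move=> t ht B FB; exact: (hb t ht B FB).2.
rewrite sq_wealth_integral ?(ltW hi0)//; apply: lee_wpmul2l; last exact: hM.
by rewrite lee_fin ltW.
Qed.

(** Again the discounted squared wealth is the adapted weight: the undiscounted square is rewritten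
    as this weight times the squared numeraire, which the lower bound compares with its terminal
    value. *)
Lemma sq_wealth_lower : exists2 lo : R, 0 < lo & forall (M : \bar R),
  (forall sigma, stopping_time F T sigma -> (\int[Phat]_w (sq_wealth Shat theta (sigma w) w)%:E <= M)%E) ->
  forall sigma, stopping_time F T sigma ->
   (lo%:E * \int[P]_w (sq_wealth S theta (sigma w) w)%:E <= m%:E * M)%E.
Proof.
have [lo [hi [lo0 hi0 hb]]] := numeraire_bounds; exists lo => // M hM sigma st.
rewrite -ge0_integralZl_EFin ?(ltW lo0)//; last 2 first.
- by move=> w _; rewrite lee_fin.
- by apply/measurable_EFinP; exact: mS.
have [J [h1 h2]] := right_mesh T_gt0 Ffil st.
apply: (fatou_bound (fn := fun l w => lo * sq_wealth S theta (rstop T J l w) w)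
  (f := fun w => lo * sq_wealth S theta (sigma w) w)).
- move=> l; apply: measurable_funM => //; apply: mS; exact: (rstop_stopping T_gt0 Ffil h1 h2 l).
- by apply: measurable_funM => //; exact: mS.
- by move=> l w; rewrite mulr_ge0// ltW.
- by move=> w; rewrite mulr_ge0// ltW.
- apply: filterS rcU => w [hw _]; apply: cvgMr; exact: (rstop_cvg T_gt0 st h1 hw).
move=> l; have sl := rstop_stopping T_gt0 Ffil h1 h2 l.
have -> : (\int[P]_w (lo * sq_wealth S theta (rstop T J l w) w)%:E =
    \int[P]_w (sq_wealth Shat theta (rstop T J l w) w * (lo * X (rstop T J l w) w ^+ 2))%:E)%E.
  rewrite sq_wealth_integral ?(ltW lo0)// -ge0_integralZl_EFin ?(ltW lo0)//.
    by move=> w _; rewrite lee_fin.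
  by apply/measurable_EFinP; exact: mS.
apply: (@le_trans _ _ (\int[P]_w (sq_wealth Shat theta (rstop T J l w) w * X T w ^+ 2)%:E)%E).
  have H := @rstop_compare _ _ _ P F T T_gt0 Ffil sigma J l (sq_wealth Shat theta) (fun t w => lo * X t w ^+ 2)
    (fun _ w => X T w ^+ 2) h1 h2 aU; apply: H => //.
  - by move=> t ht; exact: mc.
  - by move=> t w; rewrite mulr_ge0 ?sqr_ge0 ?(ltW lo0).
  - by move=> t w; exact: sqr_ge0.
  - by move=> t ht B FB; exact: (hb t ht B FB).1.
rewrite -density_integral//; last exact: mShat.
apply: lee_wpmul2l; last exact: hM.
by rewrite lee_fin (ltW second_moment_gt0).
Qed.

End Tame.

Lemma tame_discounted theta : tame F T S P theta <-> tame F T Shat Phat theta.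
Proof.
have m0 := second_moment_gt0.
split=> -[sf /sup_finite[M hM]].
  split; first exact/self_financing_discounted.
  apply/sup_finite; have [hi hi0 h] := sq_wealth_upper sf; exists (m^-1 * (hi * M)) => sigma st.
  have := h _ hM sigma st; by rewrite -lee_pdivlMl.
have {}sf : self_financing F T S P theta by exact/self_financing_discounted.
split => //; apply/sup_finite; have [lo lo0 h] := sq_wealth_lower sf; exists (lo^-1 * (m * M)) => sigma st.
have := h _ hM sigma st; by rewrite -lee_pdivlMl.
Qed.

(** The squared numeraire in the density cancels the squared discount factor, so squared distances
    at [T] agree up to the constant [m]. This yields both the [L^2] convergence in admissibility and
    the hedging error. *)
Lemma error_discounted (V K : Omega -> R) : measurable_fun setT V -> measurable_fun setT K ->
  ('E_P[fun w => ((V w - K w) ^+ 2)%R] = m%:E * 'E_Phat[fun w => (((X T w)^-1 * V w - K w / X T w) ^+ 2)%R])%E.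
Proof.
move=> mV1 mK; rewrite expectationE ['E_Phat[_]%E]expectationE.
have mXi : measurable_fun setT (fun w => (X T w)^-1).
  exact: (measurableT_comp measurable_inv (numeraire_measurable tT)).
have mh : measurable_fun setT (fun w => ((X T w)^-1 * V w - K w / X T w) ^+ 2).
  by apply: measurable_funX; apply: measurable_funB; exact: measurable_funM.
rewrite density_integral//; last by move=> w; exact: sqr_ge0.
apply: ge0_ae_eq_integral => //.
- by apply/measurable_EFinP; apply: measurable_funX; exact: measurable_funB.
- by apply/measurable_EFinP; exact: measurable_funM.
- by move=> w _; rewrite lee_fin sqr_ge0.
- by move=> w _; rewrite lee_fin mulr_ge0 ?sqr_ge0.
apply: filterS numeraire_pos => w hw _; congr EFin.
by field; rewrite gt_eqF// hw.
Qed.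

Lemma admissible_discounted theta : admissible F T S P theta <-> admissible F T Shat Phat theta.
Proof.
have m0 := second_moment_gt0.
have meas (tn : nat -> R -> Omega -> 'rV[R]_n) (th : R -> Omega -> 'rV[R]_n) sigma :
    (forall l, tame F T S P (tn l)) -> self_financing F T S P th -> stopping_time F T sigma ->
    [/\ forall l, measurable_fun setT (fun w => wealth S (tn l) (sigma w) w),
      measurable_fun setT (fun w => wealth S th (sigma w) w),
      forall l, measurable_fun setT (fun w => wealth Shat (tn l) (sigma w) w) &
      measurable_fun setT (fun w => wealth Shat th (sigma w) w)].
  move=> htn hth st; have ptn l := self_financing_predictable (htn l).1.
  have pth := self_financing_predictable hth.
  by split=> [l||l|]; [exact: mV|exact: mV|exact: mVhat|exact: mVhat].
have errE (tn : nat -> R -> Omega -> 'rV[R]_n) l :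
    (forall l, tame F T S P (tn l)) -> self_financing F T S P theta ->
    ('E_P[fun w => ((wealth S (tn l) T w - wealth S theta T w) ^+ 2)%R] =
     m%:E * 'E_Phat[fun w => ((wealth Shat (tn l) T w - wealth Shat theta T w) ^+ 2)%R])%E.
  move=> htn hth; have [h1 h2 _ _] := meas tn theta _ htn hth stopping_T.
  rewrite (error_discounted (h1 l) h2); congr (_ * _)%E; congr expectation; apply/funext => w.
  by rewrite !wealth_discounted [wealth S theta T w / _]mulrC.
split=> -[sf [tn [htn hp hL]]].
  split; first exact/self_financing_discounted.
  exists tn; split; first by move=> l; exact/tame_discounted.
    move=> sigma st; have [h1 h2 h3 h4] := meas tn theta _ htn sf st.
    apply: (cvg_in_probability_acont null_PQ) => //.
    have := cvg_in_probabilityM h1 h2 (measurableT_comp measurable_inv (mX st)) (hp sigma st).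
    rewrite (_ : (fun w => _) = fun w => wealth Shat theta (sigma w) w); last first.
      by apply/funext => w; rewrite wealth_discounted.
    rewrite (_ : (fun m0 w => _) = fun l w => wealth Shat (tn l) (sigma w) w)//.
    by apply/funext => l; apply/funext => w; rewrite wealth_discounted.
  have := cvgeZl (y := (m^-1)%:E) isT hL; rewrite mule0; apply: cvg_trans.
  apply: near_eq_cvg; apply: nearW => l; rewrite errE// muleA -EFinM mulVf ?gt_eqF// mul1e//.
have {}sf : self_financing F T S P theta by exact/self_financing_discounted.
have {}htn l : tame F T S P (tn l) by exact/tame_discounted.
split=> //; exists tn; split=> //.
  move=> sigma st; have [h1 h2 h3 h4] := meas tn theta _ htn sf st.
  have hpP := cvg_in_probability_acont null_QP h3 h4 (hp sigma st).
  have := cvg_in_probabilityM h3 h4 (mX st) hpP.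
  apply: cvg_in_probability_ae => //; [by move=> l; apply: measurable_funM => //; exact: mX|by apply: measurable_funM => //; exact: mX|].
  apply: filterS numeraire_pos => w hw; have x0 : X (sigma w) w != 0 by rewrite gt_eqF// hw// st.1.
  by split=> [l|]; rewrite wealth_discounted mulrA divff// mul1r.
have := cvgeZl (y := m%:E) isT hL; rewrite mule0; apply: cvg_trans.
by apply: near_eq_cvg; apply: nearW => l; rewrite errE.
Qed.

Variables (v vhat : R).
Hypothesis vhat_def : {ae P, forall w, vhat = v / X 0 w}.

Lemma admissible_from_discounted :
  admissible_from F T v S P = admissible_from F T vhat Shat Phat.
Proof.
have h0 : 0 <= (0 : R) <= T by rewrite lexx.
apply/seteqP; split => theta [adm hv]; (split; first exact/admissible_discounted).
  apply: (ae_acont null_PQ); apply: filterS2 hv vhat_def => w h1 h2.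
  by rewrite wealth_discounted h1 h2 mulrC.
have {}hv := ae_acont null_QP hv.
apply: filterS3 hv vhat_def numeraire_pos => w h1 h2 h3.
have x0 : X 0 w != 0 by rewrite gt_eqF// h3.
move: h1; rewrite wealth_discounted h2 mulrC => h1.
by apply: (mulIf (invr_neq0 x0)); rewrite h1.
Qed.

Variable H : Omega -> R.
Hypothesis mH : measurable_fun setT H.

Lemma hedging_error_discounted theta : admissible_from F T v S P theta ->
  (hedging_error T S P H theta =
   m%:E * hedging_error T Shat Phat (fun w => (H w / X T w)%R) theta)%E.
Proof.
move=> [[sf _] _]; have mW := mV (self_financing_predictable sf) stopping_T.
rewrite /hedging_error (error_discounted mW mH); congr (_ * _)%E; congr expectation.
by apply/funext => w; rewrite wealth_discounted.
Qed.

End ChangeOfNumeraire.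

Theorem mainTheorem5 (d : measure_display) (Omega : measurableType d)
    (R : realType) (P : probability Omega R)
    (T : R) (T_gt0 : 0 < T)
    (F : R -> set (set Omega)) (F_filtration : filtration F T)
    (F0_trivial : forall A, F 0 A -> P A = 0%E \/ P A = 1%E)
    (n : nat) (n_ge2 : (2 <= n)%N)
    (S : R -> Omega -> 'cV[R]_n) (S_semimart : semimartingale_vec P F T S) :
  let X := fun t w => S t w (Ordinal (ltnW n_ge2)) ord0 in
  let Shat := fun t w => (X t w)^-1 *: S t w in
  forall (X_nice : nice_numeraire F T P X)
    (H : Omega -> R) (H_L2 : H \in Lfun P 2%:E)
    (v vhat : R) (vhat_def : {ae P, forall w, vhat = v / X 0 w})
    (Phat : probability Omega R)
    (Phat_density : forall A, measurable A ->
      Phat A = (\int[P]_(w in A)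
        (X T w ^+ 2 / fine 'E_P[fun w' => (X T w' ^+ 2)%R])%:E)%E),
  let Hhat := fun w => H w / X T w in
  [/\ admissible_from F T v S P = admissible_from F T vhat Shat Phat,
      (ereal_inf [set hedging_error T S P H theta
                 | theta in admissible_from F T v S P]
       = 'E_P[fun w => (X T w ^+ 2)%R]
         * ereal_inf [set hedging_error T Shat Phat Hhat theta
                     | theta in admissible_from F T vhat Shat Phat])%E &
      argmin_on (admissible_from F T v S P) (hedging_error T S P H)
      = argmin_on (admissible_from F T vhat Shat Phat)
          (hedging_error T Shat Phat Hhat)].
Proof.
move=> X Shat X_nice H H_L2 v vhat vhat_def Phat Phat_density Hhat.
have mH : measurable_fun setT H by exact: (set_mem (sub_Lfun_mfun H_L2)).
pose i0 := Ordinal (ltnW n_ge2).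
have A := admissible_from_discounted T_gt0 F_filtration (i0 := i0) S_semimart X_nice Phat_density vhat_def.
have E th := @hedging_error_discounted _ _ _ P T T_gt0 F F_filtration n i0 S S_semimart X_nice Phat Phat_density v H mH th.
have m2 := second_moment T_gt0 (i0 := i0) X_nice.
have m0 := second_moment_gt0 (i0 := i0) Phat_density.
have Ad : admissible_from F T v S P = admissible_from F T vhat Shat Phat by exact: A.
split=> //.
  rewrite [X in (_ = X * _)%E]m2 -ereal_inf_pZl// -Ad; congr ereal_inf.
  apply/seteqP; split => [_ [th hth <-]|_ [_ [th hth <-] <-]].
    by exists (hedging_error T Shat Phat Hhat th); [exists th|rewrite -E].
  by exists th => //; rewrite E.
rewrite -Ad; apply/seteqP; split => th [hth hmin]; split=> // b hb.
  by rewrite -(lee_pmul2l (x := (fine 'E_P[fun w => (X T w ^+ 2)%R])%:E))// -!E//; exact: hmin.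
by rewrite !E// lee_pmul2l//; exact: hmin.
Qed.
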